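(* Let $\alpha>0$, $\beta>0$, $Q=\mathbb R^+\times\mathbb R^+$, let $\omega,\Omega,\rho$ be as in the context, and for $x>0$, $t>0$ let $$U(x,t)=\frac{\beta i}{\pi}\int_{\partial\Omega}\big[e^{i\lambda x-\omega(\lambda)t}-e^{i\lambda x}\big]\frac{\lambda[i\lambda+\rho(\lambda)]\rho(\lambda)}{\omega(\lambda)}\,d\lambda,\qquad v(x,t):=\frac{\partial U(x,t)}{\partial t}.$$ Then $v$ (extended by continuity to the boundary) is $C^\infty$ in $\overline Q-\{(0,0)\}$, satisfies $\partial_tv=\alpha\partial_x^2v-\beta\partial_x^4v$ in $Q$, $v(x,0)=0$ for $x>0$, $v(0,t)=0$ and $v_x(0,t)=0$ for $t>0$, and $v\not\equiv0$. Consequently, the initial-boundary-value problem $$\partial_tV=\alpha\partial_x^2V-\beta\partial_x^4V\ \text{ in }Q,\qquad V(x,0)=0\ (x>0),\qquad V(0,t)=0,\ \ V_x(0,t)=0\ (t>0)$$ does not have a unique solution; in fact it has infinitely many solutions.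
   Context: $\mathbb R^+=(0,\infty)$, $\overline Q=[0,\infty)\times[0,\infty)$. $\omega(\lambda)=\alpha\lambda^2+\beta\lambda^4$. $\Omega=\{\lambda\in\mathbb C:\operatorname{Im}\lambda\ge0,\ \operatorname{Re}(\alpha\lambda^2+\beta\lambda^4)\le0\}$. Its boundary $\partial\Omega$ consists of two curves, one through $0$ (lower) and one through $i\sqrt{\alpha/\beta}$ (upper); it is positively oriented, i.e. the lower curve is traversed from left to right and the upper curve from right to left. $\rho(\lambda)=-\sqrt{\lambda^2+\alpha/\beta}$ (principal square root) is the holomorphic branch of the square root of $\lambda^2+\alpha/\beta$ on $\mathbb C-\{i\eta:\eta\in\mathbb R,\ |\eta|\ge\sqrt{\alpha/\beta}\}$ that is negative on $\mathbb R$; $\rho(i\sqrt{\alpha/\beta})=0$ by continuity. Solutions of the problem are understood as functions that are $C^\infty$ in $\overline Q-\{(0,0)\}$ (no condition is imposed at the corner $(0,0)$). *)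

(* Defs.v *)
From Stdlib Require Import Reals Lra Psatz.
From Coquelicot Require Import Coquelicot.
Open Scope R_scope.

Definition Cexp (z : C) : C :=
  (exp (Re z) * cos (Im z), exp (Re z) * sin (Im z)).

(** Principal square root: nonnegative real part, and nonnegative imaginary
    part on the cut [(-oo, 0)]. *)
Definition Csqrt (z : C) : C :=
  (sqrt ((Cmod z + Re z) / 2),
   (if Rle_dec 0 (Im z) then 1 else -1) * sqrt ((Cmod z - Re z) / 2)).

Lemma Csqrt_sqr (z : C) : (Csqrt z * Csqrt z)%C = z /\ 0 <= Re (Csqrt z).
Proof.
destruct z as [a b]; unfold Csqrt; simpl Re; simpl Im.
set (m := Cmod (a, b)).
assert (hm : 0 <= m) by apply Cmod_ge_0.
assert (hm2 : m * m = a ^ 2 + b ^ 2).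
{ unfold m, Cmod; simpl fst; simpl snd; apply sqrt_sqrt; nra. }
assert (ha : - m <= a <= m) by (split; nra).
assert (hp := sqrt_sqrt ((m + a) / 2) ltac:(lra)).
assert (hq := sqrt_sqrt ((m - a) / 2) ltac:(lra)).
assert (hpq : sqrt ((m + a) / 2) * sqrt ((m - a) / 2) = Rabs b / 2).
{ rewrite <- sqrt_mult by lra.
  replace ((m + a) / 2 * ((m - a) / 2)) with (Rsqr (b / 2))
    by (unfold Rsqr; nra).
  rewrite sqrt_Rsqr_abs; unfold Rdiv.
  rewrite Rabs_mult, (Rabs_right (/ 2)); lra. }
split; [|apply sqrt_pos].
unfold Cmult; simpl fst; simpl snd; revert hpq; unfold Rabs.
destruct (Rle_dec 0 b), (Rcase_abs b); intros hpq; try lra;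
  apply injective_projections; simpl fst; simpl snd; nra.
Qed.

(** ** Derivatives of complex-valued functions of a real variable *)

Definition Derive_nC (f : R -> C) (n : nat) (s : R) : C :=
  (Derive_n (fun r => Re (f r)) n s, Derive_n (fun r => Im (f r)) n s).

(** Derivative of [f] at [s] relative to the set [D] of real numbers; it is
    one-sided when [s] is an endpoint of the interval [D].  [C_R_NormedModule]
    is [C] viewed as a normed space over [R]. *)
Definition is_derive_in (D : R -> Prop) (f : R -> C) (s : R) (l : C) : Prop :=
  @filterdiff R_AbsRing R_NormedModule C_R_NormedModule f
    (within D (locally s)) (fun h : R => scal h (l : C_R_NormedModule)).

(** ** Contour integrals along curves parametrized by the whole real line

    Both ends are taken to infinity independently.  The curves used below have
    at most one corner, whose velocity is irrelevant to the integral. *)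

Definition pullback (f : C -> C) (gamma : R -> C) (s : R) : C :=
  (f (gamma s) * Derive_nC gamma 1 s)%C.

Definition ex_contour_integral (f : C -> C) (gamma : R -> C) : Prop :=
  @ex_RInt_gen C_R_NormedModule (pullback f gamma)
    (Rbar_locally m_infty) (Rbar_locally p_infty).

Definition contour_integral (f : C -> C) (gamma : R -> C) : C :=
  @RInt_gen C_R_CompleteNormedModule (pullback f gamma)
    (Rbar_locally m_infty) (Rbar_locally p_infty).

(** ** The region Omega and its boundary *)

Definition omega (alpha beta : R) (lambda : C) : C :=
  (alpha * lambda ^ 2 + beta * lambda ^ 4)%C.

Definition Omega (alpha beta : R) (lambda : C) : Prop :=
  0 <= Im lambda /\ Re (omega alpha beta lambda) <= 0.

Definition boundary (A : C -> Prop) (z : C) : Prop :=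
  ~ locally z A /\ ~ locally z (fun w => ~ A w).

(** For [lambda = s + i y], the equation [Re (omega lambda) = 0] reads
    [beta y^4 - (alpha + 6 beta s^2) y^2 + alpha s^2 + beta s^4 = 0], which is
    quadratic in [y^2]; its two nonnegative solutions [y] are [height_low] and
    [height_up]. *)
Definition discr (alpha beta s : R) : R :=
  alpha ^ 2 + 8 * alpha * beta * s ^ 2 + 32 * beta ^ 2 * s ^ 4.

Definition height_low (alpha beta s : R) : R :=
  sqrt ((alpha + 6 * beta * s ^ 2 - sqrt (discr alpha beta s)) / (2 * beta)).

Definition height_up (alpha beta s : R) : R :=
  sqrt ((alpha + 6 * beta * s ^ 2 + sqrt (discr alpha beta s)) / (2 * beta)).

Definition curve_low (alpha beta s : R) : C :=
  (s, height_low alpha beta s).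

(** Traversed from right to left. *)
Definition curve_up (alpha beta s : R) : C :=
  (- s, height_up alpha beta (- s)).

Definition ex_integral_dOmega (alpha beta : R) (f : C -> C) : Prop :=
  ex_contour_integral f (curve_low alpha beta) /\
  ex_contour_integral f (curve_up alpha beta).

Definition integral_dOmega (alpha beta : R) (f : C -> C) : C :=
  (contour_integral f (curve_low alpha beta) +
   contour_integral f (curve_up alpha beta))%C.

(** ** The functions U and v *)

Definition rho (alpha beta : R) (lambda : C) : C :=
  (- Csqrt (lambda ^ 2 + RtoC (alpha / beta)))%C.

(** Total division leaves junk values at [0] and [i sqrt (alpha / beta)], the
    two (removable) zeros of [omega] on the boundary of [Omega]. *)
Definition integrand (alpha beta x t : R) (lambda : C) : C :=
  ((Cexp (Ci * lambda * x - omega alpha beta lambda * t)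
      - Cexp (Ci * lambda * x))
   * (lambda * (Ci * lambda + rho alpha beta lambda) * rho alpha beta lambda
      / omega alpha beta lambda))%C.

Definition U (alpha beta x t : R) : C :=
  (beta * Ci / PI * integral_dOmega alpha beta (integrand alpha beta x t))%C.

Definition v (alpha beta x t : R) : C :=
  Derive_nC (fun tau => U alpha beta x tau) 1 t.

(** ** The initial-boundary-value problem *)

(** The closed quarter plane without its corner. *)
Definition Qbar0 (x t : R) : Prop :=
  0 <= x /\ 0 <= t /\ ~ (x = 0 /\ t = 0).

Definition continuous_Qbar0 (V : R -> R -> C) : Prop :=
  forall x t, Qbar0 x t ->
    filterlim (fun p : R * R => V (fst p) (snd p))
      (within (fun p : R * R => Qbar0 (fst p) (snd p)) (locally (x, t)))
      (locally (V x t)).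

(** [V] is of class C^k on [Qbar0], with one-sided normal derivatives on the
    two edges.  The values of [V] outside [Qbar0] are irrelevant. *)
Fixpoint Ck_Qbar0 (k : nat) (V : R -> R -> C) : Prop :=
  continuous_Qbar0 V /\
  match k with
  | O => True
  | S k' =>
      exists Vx Vt : R -> R -> C,
        (forall x t, Qbar0 x t ->
           is_derive_in (fun y => Qbar0 y t) (fun y => V y t) x (Vx x t) /\
           is_derive_in (fun tau => Qbar0 x tau) (fun tau => V x tau) t
             (Vt x t)) /\
        Ck_Qbar0 k' Vx /\ Ck_Qbar0 k' Vt
  end.

Definition smooth_Qbar0 (V : R -> R -> C) : Prop :=
  forall k : nat, Ck_Qbar0 k V.

Definition is_solution (alpha beta : R) (V : R -> R -> C) : Prop :=
  smooth_Qbar0 V /\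
  (forall x t, 0 < x -> 0 < t ->
     Derive_nC (fun tau => V x tau) 1 t =
     (alpha * Derive_nC (fun y => V y t) 2 x
      - beta * Derive_nC (fun y => V y t) 4 x)%C) /\
  (forall x, 0 < x -> V x 0 = 0%C) /\
  (forall t, 0 < t -> V 0 t = 0%C) /\
  (forall t, 0 < t ->
     is_derive_in (fun y => 0 <= y) (fun y => V y t) 0 0%C).

(** ** The two curves make up the boundary of Omega *)

Lemma Re_omega (alpha beta x y : R) :
  Re (omega alpha beta (x, y)) =
  alpha * (x ^ 2 - y ^ 2) + beta * (x ^ 4 - 6 * x ^ 2 * y ^ 2 + y ^ 4).
Proof. unfold omega, Re; simpl; ring. Qed.

Section Boundary.
Variables alpha beta : R.
Hypothesis alpha_gt0 : 0 < alpha.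
Hypothesis beta_gt0 : 0 < beta.

Lemma heights (s : R) :
  let L := height_low alpha beta s in let H := height_up alpha beta s in
  0 <= L /\ L < H /\
  forall y, Re (omega alpha beta (s, y)) =
    beta * ((y ^ 2 - L ^ 2) * (y ^ 2 - H ^ 2)).
Proof.
intros L H.
set (p := alpha + 6 * beta * s ^ 2).
set (q := sqrt (discr alpha beta s)).
assert (hs : 0 <= s ^ 2) by apply pow2_ge_0.
assert (hbs : 0 <= beta * s ^ 2) by nra.
assert (hd : 0 < discr alpha beta s) by (unfold discr; nra).
assert (hq : 0 < q) by (apply sqrt_lt_R0; exact hd).
assert (hq2 : q * q = discr alpha beta s) by (apply sqrt_sqrt; lra).
assert (hp : 0 < p) by (unfold p; nra).
assert (hqp : q <= p).
{ apply Rsqr_incr_0; [|lra|lra]; unfold Rsqr; rewrite hq2.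
  unfold discr, p; nra. }
assert (hL : L ^ 2 = (p - q) / (2 * beta)).
{ unfold L, height_low; fold p q; rewrite pow2_sqrt; [reflexivity|].
  apply Rdiv_le_0_compat; lra. }
assert (hH : H ^ 2 = (p + q) / (2 * beta)).
{ unfold H, height_up; fold p q; rewrite pow2_sqrt; [reflexivity|].
  apply Rdiv_le_0_compat; lra. }
split; [apply sqrt_pos|split].
- unfold L, H, height_low, height_up; fold p q; apply sqrt_lt_1_alt; split.
  + apply Rdiv_le_0_compat; lra.
  + apply Rmult_lt_compat_r; [apply Rinv_0_lt_compat; lra|lra].
- intros y; rewrite Re_omega, hL, hH.
  assert (e : (p - q) * (p + q) = p * p - discr alpha beta s)
    by (rewrite <- hq2; ring).
  replace (beta * ((y ^ 2 - (p - q) / (2 * beta)) *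
             (y ^ 2 - (p + q) / (2 * beta))))
    with (beta * y ^ 4 - p * y ^ 2 + ((p - q) * (p + q)) / (4 * beta))
    by (field; lra).
  rewrite e; unfold p, discr; field; lra.
Qed.

Lemma locally_gt0 (f : C -> R) (z : C) :
  continuous f z -> 0 < f z -> locally z (fun w => 0 < f w).
Proof.
intros hf hz; apply (hf (fun r => 0 < r)).
exact (open_gt 0 (f z) hz).
Qed.

Lemma continuous_Re_omega (z : C) :
  continuous (fun w : C => Re (omega alpha beta w)) z.
Proof.
assert (hr : continuous (fun w : C => Re w) z) by apply continuous_fst.
assert (hi : continuous (fun w : C => Im w) z) by apply continuous_snd.
assert (hM : forall f g : C -> R, continuous f z -> continuous g z ->
  continuous (fun w => f w * g w) z)
  by (intros f g hf hg; exact (continuous_mult (K := R_AbsRing) f g z hf hg)).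
assert (hD : forall f g : C -> R, continuous f z -> continuous g z ->
  continuous (fun w => f w + g w) z)
  by (intros f g hf hg;
      exact (continuous_plus (V := R_NormedModule) f g z hf hg)).
assert (hc : forall c : R, continuous (fun _ : C => c) z)
  by (intros c; apply continuous_const).
assert (h2 := hD _ _ (hM _ _ hr hr) (hM _ _ (hc (-1)) (hM _ _ hi hi))).
assert (h4 := hM _ _ (hc (-4)) (hM _ _ (hM _ _ hr hr) (hM _ _ hi hi))).
assert (h := hD _ _ (hM _ _ (hc alpha) h2)
  (hM _ _ (hc beta) (hD _ _ (hM _ _ h2 h2) h4))).
refine (continuous_ext _ _ z _ h).
intros [x y]; rewrite Re_omega; unfold Re, Im; simpl; ring.
Qed.

Lemma boundary_Omega (z : C) :
  boundary (Omega alpha beta) z <->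
  exists s, z = curve_low alpha beta s \/ z = curve_up alpha beta s.
Proof.
destruct z as [x y].
destruct (heights x) as [hL [hLH hE]].
set (L := height_low alpha beta x) in *.
set (H := height_up alpha beta x) in *.
assert (hcont := continuous_Re_omega (x, y)).
assert (hneg : continuous (fun w : C => - Re (omega alpha beta w)) (x, y))
  by exact (continuous_opp (V := R_NormedModule) _ _ hcont).
assert (him : continuous (fun w : C => Im w) (x, y))
  by apply continuous_snd.
assert (himn : continuous (fun w : C => - Im w) (x, y))
  by exact (continuous_opp (V := R_NormedModule) _ _ him).
split.
- intros [hin hout].
  destruct (Req_dec y L) as [->|nL]; [exists x; left; reflexivity|].
  destruct (Req_dec y H) as [->|nH].
  { exists (- x); right; unfold curve_up; rewrite !Ropp_involutive.
    reflexivity. }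
  exfalso.
  destruct (Rlt_le_dec y 0) as [y0|y0].
  { apply hout.
    generalize (locally_gt0 _ _ himn (ltac:(simpl; lra))).
    apply filter_imp; intros w hw [hw0 _]; lra. }
  destruct (Rlt_le_dec 0 (Re (omega alpha beta (x, y)))) as [r|r].
  { apply hout; generalize (locally_gt0 _ _ hcont r).
    apply filter_imp; intros w hw [_ hw0]; lra. }
  apply hin.
  assert (hLy : L < y /\ y < H).
  { rewrite hE in r.
    assert (r' : (y ^ 2 - L ^ 2) * (y ^ 2 - H ^ 2) <= 0) by nra.
    split; apply Rnot_le_lt; intros c.
    - assert (y < L) by lra.
      assert (y ^ 2 < L ^ 2) by nra. assert (L ^ 2 < H ^ 2) by nra. nra.
    - assert (H < y) by lra.
      assert (H ^ 2 < y ^ 2) by nra. assert (L ^ 2 < H ^ 2) by nra. nra. }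
  destruct hLy as [hLy hyH].
  assert (r1 : 0 < - Re (omega alpha beta (x, y))).
  { rewrite hE.
    assert (0 < y ^ 2 - L ^ 2) by nra.
    assert (0 < H ^ 2 - y ^ 2) by nra.
    assert (0 < (y ^ 2 - L ^ 2) * (H ^ 2 - y ^ 2)) by nra. nra. }
  assert (hy : 0 < Im (x, y)) by (simpl; lra).
  generalize (filter_and _ _ (locally_gt0 _ _ him hy)
    (locally_gt0 _ _ hneg r1)).
  apply filter_imp; intros w [h1 h2].
  split; [apply Rlt_le; exact h1|lra].
- intros hs.
  assert (hy : y = L \/ y = H).
  { destruct hs as [s [e|e]]; injection e as ex ey; rewrite <- ex in ey;
      auto. }
  assert (zin : Omega alpha beta (x, y)).
  { split; [simpl; lra|].
    rewrite hE; destruct hy as [->| ->]; right; ring. }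
  split; [|intros c; exact (locally_singleton _ _ c zin)].
  intros [eps heps].
  assert (e0 := cond_pos eps).
  assert (near : forall d, Rabs d < eps -> Omega alpha beta (x, y + d)).
  { intros d hd; apply heps; split; [apply ball_center|].
    change (Rabs (y + d - y) < eps).
    replace (y + d - y) with d by ring; exact hd. }
  destruct hy as [e|e].
  + destruct (near (- (eps / 2))) as [h1 h2].
    { rewrite Rabs_Ropp, Rabs_right; lra. }
    simpl in h1; rewrite hE in h2.
    set (y' := y + - (eps / 2)) in *.
    assert (y' < L) by (unfold y'; lra).
    assert (y' ^ 2 < L ^ 2) by nra. assert (L ^ 2 < H ^ 2) by nra.
    assert (0 < (y' ^ 2 - L ^ 2) * (y' ^ 2 - H ^ 2)) by nra. nra.
  + destruct (near (eps / 2)) as [h1 h2].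
    { rewrite Rabs_right; lra. }
    rewrite hE in h2.
    set (y' := y + eps / 2) in *.
    assert (H < y') by (unfold y'; lra).
    assert (H ^ 2 < y' ^ 2) by nra. assert (L ^ 2 < H ^ 2) by nra.
    assert (0 < (y' ^ 2 - L ^ 2) * (y' ^ 2 - H ^ 2)) by nra. nra.
Qed.

End Boundary.

(* Main.v *)
Require Import Defs.
From Stdlib Require Import Reals.
From Coquelicot Require Import Coquelicot.
From Stdlib Require Import Lra Psatz.
Open Scope R_scope.

(** The proof rests on the substitution [lambda = lam u = kappa sinh u] with
    [kappa = sqrt (alpha / beta)].  Then [sqrt (lambda^2 + alpha / beta)] is
    [mu u = kappa cosh u], so [lambda], [rho = - mu] and
    [omega = beta lambda^2 mu^2] are entire functions of [u].

    The contour is symmetric under [lambda -> - conj lambda], which leaves twice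
    the imaginary part of the integral over its right half
    ([is_RInt_gen_symmetric]).  The right half of the upper curve is the image of
    that of the lower curve under [u -> conj u + i pi / 2], a map that exchanges
    [lam] and [i conj mu].  Differentiating in [t] cancels the division by
    [omega], and for positive [x] and [t] this gives [v] as [- 2 beta / pi] times
    the imaginary part of
    [[ int exp (- omega t) (A exp (i lam x) + B exp (- mu x)) du ]]
    along one curve, the right half of the lower one ([U_formula],
    [U_derive_aux]).

    The integrand is entire, so by Cauchy's theorem ([HInt_graph]) the curve can
    be moved to the horizontal line [Im u = pi / 12] ([Wc_curve]).  On that line
    both [exp (i lam x)] and [exp (- mu x)] decay doubly exponentially when
    [x > 0], and so does [exp (- omega t)] when [t > 0].  Hence one integral
    represents [v] and all its derivatives up to both edges, away from the corner
    ([V_smooth]), and the equation is the dispersion relation of the two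
    exponentials ([V_equation]).

    On [x = 0] the line can be moved further to the real axis, where the
    integrand is real: this gives [V = 0] ([Wc_left]); the integrand of the first
    derivative vanishes identically ([Wc_left_x]).  That of the second derivative
    has a strict sign ([Wc_left_xx]), so the solution is not zero ([Wc_nonzero]).
    At [t = 0] the two exponentials are exchanged by the reflection above, and the
    line can be moved onto its mirror image, so the two contributions cancel
    ([Wc_initial]).  The multiples of this solution are pairwise distinct
    solutions of the same homogeneous problem. *)

(** * Integrals over the half-line *)

Definition decays (F : R -> R) (B : R) : Prop :=
  (forall p, continuous F p) /\
  (forall p, 0 < p -> Rabs (F p) <= B * exp (- p)).

(** Meaningful when the limit exists and is finite, which [decays] guarantees
    ([HInt_correct]). *)
Definition HInt (F : R -> R) : R :=
  real (Lim (fun S => RInt F 0 S) p_infty).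

Lemma ex_RInt_cont (F : R -> R) (a b : R) :
  (forall p, continuous F p) -> ex_RInt F a b.
Proof. intros h; apply (@ex_RInt_continuous R_CompleteNormedModule); intros; apply h. Qed.

Lemma RInt_tail (F : R -> R) (B u w : R) :
  decays F B -> 0 <= u <= w -> Rabs (RInt F u w) <= B * (exp (- u) - exp (- w)).
Proof.
intros [hc hb] huw.
assert (he : is_RInt (fun p => B * exp (- p)) u w (B * (exp (- u) - exp (- w)))).
{ replace (B * (exp (- u) - exp (- w)))
    with (minus (- B * exp (- w)) (- B * exp (- u)))
    by (unfold minus, plus, opp; simpl; ring).
  apply (is_RInt_derive (fun p => - B * exp (- p)) (fun p => B * exp (- p))).
  - intros x _; auto_derive; [exact I|ring].
  - intros x _; apply (ex_derive_continuous (fun p => B * exp (- p))).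
    auto_derive; exact I. }
assert (hx := ex_RInt_cont F u w hc).
apply Rabs_le; split.
- assert (h := is_RInt_opp _ _ _ _ he).
  rewrite <- (is_RInt_unique _ _ _ _ he).
  rewrite <- (RInt_opp (V := R_CompleteNormedModule)) by (eexists; exact he).
  apply RInt_le; [lra|eexists; exact h|exact hx|].
  intros p hp; specialize (hb p (Rle_lt_trans _ _ _ (proj1 huw) (proj1 hp))).
  apply Rabs_le_between in hb; unfold opp; simpl; lra.
- rewrite <- (is_RInt_unique _ _ _ _ he).
  apply RInt_le; [lra|exact hx|eexists; exact he|].
  intros p hp; specialize (hb p (Rle_lt_trans _ _ _ (proj1 huw) (proj1 hp))).
  apply Rabs_le_between in hb; lra.
Qed.

Lemma decays_nonneg (F : R -> R) (B : R) : decays F B -> 0 <= B.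
Proof.
intros [_ h]; specialize (h 1 Rlt_0_1).
assert (h0 := Rabs_pos (F 1)); assert (h1 := exp_pos (Ropp 1)).
apply Rnot_lt_le; intros hB; assert (B * exp (Ropp 1) < 0) by nra; lra.
Qed.

Lemma RInt_diff (F : R -> R) (u w : R) : (forall p, continuous F p) ->
  RInt F 0 w - RInt F 0 u = RInt F u w.
Proof.
intros h.
rewrite <- (RInt_Chasles (V := R_CompleteNormedModule) F 0 u w)
  by (apply ex_RInt_cont; exact h).
unfold plus; simpl; ring.
Qed.

Lemma exp_tail (e : R) : 0 < e -> exists M, 0 <= M /\ forall u, M <= u -> exp (- u) < e.
Proof.
intros he; exists (Rmax 0 (1 - ln e)); split; [apply Rmax_l|].
intros u hu; assert (h := Rmax_r 0 (1 - ln e)).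
apply Rlt_le_trans with (exp (ln e)); [apply exp_increasing; lra|rewrite exp_ln; lra].
Qed.

Lemma HInt_correct (F : R -> R) (B : R) : decays F B ->
  is_lim (fun S => RInt F 0 S) p_infty (HInt F).
Proof.
intros hF; assert (hB := decays_nonneg F B hF).
assert (h : exists l : R_CompleteSpace,
  filterlim (fun S => RInt F 0 S) (Rbar_locally p_infty) (locally l)).
{ apply filterlim_locally_cauchy; intros eps.
  destruct (exp_tail (eps / (B + 1))) as [M [hM0 hM]].
  { apply Rdiv_lt_0_compat; [apply cond_pos|lra]. }
  assert (key : forall u w, M < u -> u <= w -> Rabs (RInt F 0 w - RInt F 0 u) < eps).
  { intros u w hu hw; rewrite RInt_diff by apply hF.
    apply Rle_lt_trans with (1 := RInt_tail F B u w hF ltac:(lra)).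
    specialize (hM u ltac:(lra)); assert (h1 := exp_pos (- w)).
    assert (h2 := exp_pos (- u)).
    apply Rlt_le_trans with ((B + 1) * (eps / (B + 1))); [nra|].
    right; field; lra. }
  exists (fun u => M < u); split; [exists M; auto|].
  intros u w hu hw; destruct (Rle_dec u w) as [huw|huw].
  - exact (key u w hu huw).
  - apply (@ball_sym R_UniformSpace); apply key; lra. }
destruct h as [l hl].
assert (hl' : is_lim (fun S => RInt F 0 S) p_infty l) by exact hl.
unfold HInt; rewrite (is_lim_unique _ _ _ hl'); exact hl'.
Qed.

Lemma is_lim_HInt (F : R -> R) (l : R) :
  is_lim (fun S => RInt F 0 S) p_infty l -> HInt F = l.
Proof. intros h; unfold HInt; rewrite (is_lim_unique _ _ _ h); reflexivity. Qed.

Lemma HInt_bound (F : R -> R) (B : R) : decays F B -> Rabs (HInt F) <= B.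
Proof.
intros hF; assert (hB := decays_nonneg F B hF).
assert (h : Rbar_locally p_infty (fun S => Rabs (RInt F 0 S) <= B)).
{ exists 0; intros S hS.
  assert (h := RInt_tail F B 0 S hF ltac:(lra)).
  rewrite Ropp_0, exp_0 in h; assert (h1 := exp_pos (- S)); nra. }
assert (hl := HInt_correct F B hF).
apply Rabs_le; split.
- apply (is_lim_le_loc (fun _ => - B) (fun S => RInt F 0 S) p_infty (- B) (HInt F));
    [|apply is_lim_const|exact hl].
  revert h; apply filter_imp; intros S hS; apply Rabs_le_between in hS; lra.
- apply (is_lim_le_loc (fun S => RInt F 0 S) (fun _ => B) p_infty (HInt F) B);
    [|exact hl|apply is_lim_const].
  revert h; apply filter_imp; intros S hS; apply Rabs_le_between in hS; lra.
Qed.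

Lemma HInt_ext (F G : R -> R) : (forall p, 0 < p -> F p = G p) -> HInt F = HInt G.
Proof.
intros h; unfold HInt; f_equal; apply Lim_ext_loc.
exists 0; intros S hS; apply RInt_ext.
rewrite Rmin_left, Rmax_right by lra; intros p hp; symmetry; apply h; lra.
Qed.

Lemma continuous_lin (X : UniformSpace) (F G : X -> R) (a b : R) (x : X) :
  continuous F x -> continuous G x -> continuous (fun y => a * F y + b * G y) x.
Proof.
intros hF hG; apply (continuous_plus (V := R_NormedModule)).
- apply (continuous_scal_r (V := R_NormedModule) a F); exact hF.
- apply (continuous_scal_r (V := R_NormedModule) b G); exact hG.
Qed.

Lemma HInt_lin (F G : R -> R) (B B' a b : R) : decays F B -> decays G B' ->
  HInt (fun p => a * F p + b * G p) = a * HInt F + b * HInt G.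
Proof.
intros hF hG; apply is_lim_HInt.
apply (is_lim_ext (fun S => a * RInt F 0 S + b * RInt G 0 S)).
- intros S; symmetry.
  apply (is_RInt_unique (V := R_CompleteNormedModule)).
  apply (is_RInt_plus (V := R_NormedModule)); apply (is_RInt_scal (V := R_NormedModule));
    apply (RInt_correct (V := R_CompleteNormedModule)); apply ex_RInt_cont; [apply hF|apply hG].
- apply (is_lim_plus _ _ p_infty (a * HInt F) (b * HInt G));
    [| |reflexivity].
  + apply (is_lim_scal_l (fun S => RInt F 0 S) a p_infty (HInt F)).
    exact (HInt_correct F B hF).
  + apply (is_lim_scal_l (fun S => RInt G 0 S) b p_infty (HInt G)).
    exact (HInt_correct G B' hG).
Qed.

Lemma decays_lin (F G : R -> R) (B B' a b : R) : decays F B -> decays G B' ->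
  decays (fun p => a * F p + b * G p) (Rabs a * B + Rabs b * B').
Proof.
intros [hF hF'] [hG hG']; split.
- intros p; apply continuous_lin; auto.
- intros p hp; specialize (hF' p hp); specialize (hG' p hp).
  eapply Rle_trans; [apply Rabs_triang|]; rewrite !Rabs_mult.
  assert (h1 := Rabs_pos a); assert (h2 := Rabs_pos b).
  assert (Rabs a * Rabs (F p) <= Rabs a * (B * exp (- p)))
    by (apply Rmult_le_compat_l; assumption).
  assert (Rabs b * Rabs (G p) <= Rabs b * (B' * exp (- p)))
    by (apply Rmult_le_compat_l; assumption).
  lra.
Qed.

Lemma HInt_pos (F : R -> R) (B : R) :
  decays F B -> (forall p, 0 < p -> 0 < F p) -> 0 < HInt F.
Proof.
intros hF hp.
assert (h1 : 0 < RInt F 0 1).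
{ apply RInt_gt_0; [lra|intros; apply hp; lra|intros; apply hF]. }
apply Rlt_le_trans with (1 := h1).
apply (is_lim_le_loc (fun _ => RInt F 0 1) (fun S => RInt F 0 S) p_infty (RInt F 0 1) (HInt F));
  [|apply is_lim_const|exact (HInt_correct F B hF)].
exists 1; intros S hS.
assert (h := RInt_diff F 1 S (proj1 hF)).
assert (0 <= RInt F 1 S); [|lra].
apply RInt_ge_0; [lra|apply ex_RInt_cont, hF|].
intros p hpp; apply Rlt_le, hp; lra.
Qed.

(** Differentiation and continuity under the integral sign both come from
    pointwise Taylor estimates that are integrable in [p]. *)
Lemma HInt_diff_le (F1 F0 F' : R -> R) (B1 B0 B' h B : R) :
  decays F1 B1 -> decays F0 B0 -> decays F' B' ->
  (forall p, 0 < p -> Rabs (F1 p - F0 p - h * F' p) <= B * exp (- p)) ->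
  Rabs (HInt F1 - HInt F0 - h * HInt F') <= B.
Proof.
intros h1 h0 h' hB.
assert (hd := decays_lin F1 F0 B1 B0 1 (-1) h1 h0).
replace (HInt F1 - HInt F0 - h * HInt F')
  with (HInt (fun p => 1 * (1 * F1 p + -1 * F0 p) + - h * F' p)).
- apply HInt_bound; split.
  + intros p; apply continuous_lin; [apply hd|apply h'].
  + intros p hp; replace (1 * (1 * F1 p + -1 * F0 p) + - h * F' p)
      with (F1 p - F0 p - h * F' p) by ring; auto.
- rewrite (HInt_lin _ _ _ _ _ _ hd h'), (HInt_lin _ _ _ _ _ _ h1 h0); ring.
Qed.

(** * The complex exponential *)

Lemma Ceq (z w : C) : Re z = Re w -> Im z = Im w -> z = w.
Proof. destruct z, w; unfold Re, Im; simpl; intros -> ->; reflexivity. Qed.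

Lemma Re_mult (z w : C) : Re (z * w) = Re z * Re w - Im z * Im w.
Proof. reflexivity. Qed.
Lemma Im_mult (z w : C) : Im (z * w) = Re z * Im w + Im z * Re w.
Proof. reflexivity. Qed.
Lemma Re_plus (z w : C) : Re (z + w) = Re z + Re w.
Proof. reflexivity. Qed.
Lemma Im_plus (z w : C) : Im (z + w) = Im z + Im w.
Proof. reflexivity. Qed.

Lemma Cexp_plus (z w : C) : Cexp (z + w) = (Cexp z * Cexp w)%C.
Proof.
apply Ceq; unfold Cexp; rewrite Re_plus, Im_plus, exp_plus.
- rewrite cos_plus; unfold Re, Im, Cmult; simpl; ring.
- rewrite sin_plus; unfold Re, Im, Cmult; simpl; ring.
Qed.

Lemma Cexp_0 : Cexp 0 = 1%C.
Proof. unfold Cexp, Re, Im, RtoC; simpl; rewrite exp_0, cos_0, sin_0; apply Ceq; unfold Re, Im; simpl; ring. Qed.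

Lemma Cmod_Cexp (z : C) : Cmod (Cexp z) = exp (Re z).
Proof.
unfold Cmod, Cexp, fst, snd.
replace ((exp (Re z) * cos (Im z)) ^ 2 + (exp (Re z) * sin (Im z)) ^ 2)
  with ((exp (Re z))² * ((sin (Im z))² + (cos (Im z))²)) by (unfold Rsqr; ring).
rewrite sin2_cos2, Rmult_1_r; apply sqrt_Rsqr; left; apply exp_pos.
Qed.

Lemma Re_le_Cmod (z : C) : Rabs (Re z) <= Cmod z.
Proof.
unfold Cmod; rewrite <- sqrt_Rsqr_abs; apply sqrt_le_1_alt; unfold Rsqr, Re.
assert (h := pow2_ge_0 (snd z)); nra.
Qed.
Lemma Im_le_Cmod (z : C) : Rabs (Im z) <= Cmod z.
Proof.
unfold Cmod; rewrite <- sqrt_Rsqr_abs; apply sqrt_le_1_alt; unfold Rsqr, Im.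
assert (h := pow2_ge_0 (fst z)); nra.
Qed.

(** * Continuity and derivatives along real paths *)

Definition ccont {X : UniformSpace} (f : X -> C) (x : X) : Prop :=
  continuous (fun y => Re (f y)) x /\ continuous (fun y => Im (f y)) x.

Definition pder (gamma : R -> C) (s : R) (l : C) : Prop :=
  is_derive (fun r => Re (gamma r)) s (Re l) /\
  is_derive (fun r => Im (gamma r)) s (Im l).

Section Continuity.
Context {X : UniformSpace}.
Implicit Types (f g : X -> C) (x : X).

Lemma ccont_const (c : C) x : ccont (fun _ : X => c) x.
Proof. split; apply continuous_const. Qed.

Lemma ccont_plus f g x : ccont f x -> ccont g x -> ccont (fun y => f y + g y)%C x.
Proof.
intros [a b] [c d]; split.
- exact (continuous_plus (V := R_NormedModule) _ _ _ a c).
- exact (continuous_plus (V := R_NormedModule) _ _ _ b d).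
Qed.

Lemma ccont_mult f g x : ccont f x -> ccont g x -> ccont (fun y => f y * g y)%C x.
Proof.
intros [a b] [c d]; split.
- exact (continuous_minus (V := R_NormedModule) _ _ _
    (continuous_mult (K := R_AbsRing) _ _ _ a c) (continuous_mult (K := R_AbsRing) _ _ _ b d)).
- exact (continuous_plus (V := R_NormedModule) _ _ _
    (continuous_mult (K := R_AbsRing) _ _ _ a d) (continuous_mult (K := R_AbsRing) _ _ _ b c)).
Qed.

Lemma ccont_opp f x : ccont f x -> ccont (fun y => - f y)%C x.
Proof.
intros [a b]; split.
- exact (continuous_opp (V := R_NormedModule) _ _ a).
- exact (continuous_opp (V := R_NormedModule) _ _ b).
Qed.

Lemma ccont_pair (u w : X -> R) x :
  continuous u x -> continuous w x -> ccont (fun y => (u y, w y)) x.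
Proof. intros h1 h2; split; [exact h1|exact h2]. Qed.

Lemma ccont_Cexp f x : ccont f x -> ccont (fun y => Cexp (f y)) x.
Proof.
intros [a b]; unfold Cexp; apply ccont_pair; apply (continuous_mult (K := R_AbsRing)).
- exact (continuous_comp _ exp x a (continuous_exp _)).
- exact (continuous_comp _ cos x b (continuous_cos _)).
- exact (continuous_comp _ exp x a (continuous_exp _)).
- exact (continuous_comp _ sin x b (continuous_sin _)).
Qed.
End Continuity.

Lemma pder_const (c : C) s : pder (fun _ => c) s 0.
Proof. split; apply is_derive_Reals, derivable_pt_lim_const. Qed.

Lemma pder_plus f g s l m :
  pder f s l -> pder g s m -> pder (fun r => f r + g r)%C s (l + m).
Proof.
intros [a b] [c d]; split.
- exact (is_derive_plus (V := R_NormedModule) _ _ _ _ _ a c).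
- exact (is_derive_plus (V := R_NormedModule) _ _ _ _ _ b d).
Qed.

Lemma is_derive_Rmult (f g : R -> R) s l m : is_derive f s l -> is_derive g s m ->
  is_derive (fun r => f r * g r) s (l * g s + f s * m).
Proof.
intros a b; exact (is_derive_mult (K := R_AbsRing) f g s l m a b Rmult_comm).
Qed.

Lemma pder_mult f g s l m :
  pder f s l -> pder g s m -> pder (fun r => f r * g r)%C s (l * g s + f s * m).
Proof.
intros [a b] [c d]; split.
- replace (Re (l * g s + f s * m)) with
    ((Re l * Re (g s) + Re (f s) * Re m) - (Im l * Im (g s) + Im (f s) * Im m))
    by (rewrite Re_plus, !Re_mult; ring).
  exact (is_derive_minus (V := R_NormedModule) _ _ _ _ _
    (is_derive_Rmult _ _ _ _ _ a c) (is_derive_Rmult _ _ _ _ _ b d)).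
- replace (Im (l * g s + f s * m)) with
    ((Re l * Im (g s) + Re (f s) * Im m) + (Im l * Re (g s) + Im (f s) * Re m))
    by (rewrite Im_plus, !Im_mult; ring).
  exact (is_derive_plus (V := R_NormedModule) _ _ _ _ _
    (is_derive_Rmult _ _ _ _ _ a d) (is_derive_Rmult _ _ _ _ _ b c)).
Qed.

Lemma pder_pair (u w : R -> R) s du dw :
  is_derive u s du -> is_derive w s dw -> pder (fun r => (u r, w r)) s (du, dw).
Proof. intros h1 h2; split; assumption. Qed.

Lemma pder_Cexp f s l : pder f s l -> pder (fun r => Cexp (f r)) s (Cexp (f s) * l).
Proof.
intros [a b].
assert (he : is_derive (fun r => exp (Re (f r))) s (Re l * exp (Re (f s))))
  by exact (is_derive_comp exp _ s _ _ (is_derive_exp _) a).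
assert (hc : is_derive (fun r => cos (Im (f r))) s (Im l * - sin (Im (f s))))
  by exact (is_derive_comp cos _ s _ _ (is_derive_cos _) b).
assert (hs : is_derive (fun r => sin (Im (f r))) s (Im l * cos (Im (f s))))
  by exact (is_derive_comp sin _ s _ _ (is_derive_sin _) b).
split.
- replace (Re (Cexp (f s) * l)) with (Re l * exp (Re (f s)) * cos (Im (f s)) +
    exp (Re (f s)) * (Im l * - sin (Im (f s)))) by (rewrite Re_mult; unfold Cexp, Re, Im; simpl; ring).
  exact (is_derive_Rmult _ _ _ _ _ he hc).
- replace (Im (Cexp (f s) * l)) with (Re l * exp (Re (f s)) * sin (Im (f s)) +
    exp (Re (f s)) * (Im l * cos (Im (f s)))) by (rewrite Im_mult; unfold Cexp, Re, Im; simpl; ring).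
  exact (is_derive_Rmult _ _ _ _ _ he hs).
Qed.

Lemma pder_eq f s l l' : pder f s l -> l = l' -> pder f s l'.
Proof. intros h <-; exact h. Qed.

Lemma pder_ccont f s l : pder f s l -> ccont f s.
Proof.
intros [a b]; split; apply (ex_derive_continuous (V := R_NormedModule)); eexists; eassumption.
Qed.

(** * Entire functions *)

(** The chain rule along real paths characterizes the complex derivative and
    makes every closure property immediate. *)
Definition entire (f f' : C -> C) : Prop :=
  (forall gamma s l, pder gamma s l ->
     pder (fun r => f (gamma r)) s (f' (gamma s) * l)) /\
  (forall (X : UniformSpace) (G : X -> C) x, ccont G x -> ccont (fun y => f (G y)) x) /\
  (forall (X : UniformSpace) (G : X -> C) x, ccont G x -> ccont (fun y => f' (G y)) x).

Definition is_entire (f : C -> C) : Prop := exists f', entire f f'.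

Lemma entire_const c : is_entire (fun _ => c).
Proof.
exists (fun _ => 0%C); split; [|split].
- intros gamma s l _; apply pder_eq with (1 := pder_const c s); ring.
- intros; apply ccont_const.
- intros; apply ccont_const.
Qed.

Lemma entire_id : is_entire (fun z => z).
Proof.
exists (fun _ => 1%C); split; [|split].
- intros gamma s l h; apply pder_eq with (1 := h); ring.
- auto.
- intros; apply ccont_const.
Qed.

Lemma entire_plus f g : is_entire f -> is_entire g -> is_entire (fun z => f z + g z)%C.
Proof.
intros [f' [f1 [f2 f3]]] [g' [g1 [g2 g3]]]; exists (fun z => f' z + g' z)%C; split; [|split].
- intros gamma s l h; eapply pder_eq; [apply pder_plus; [apply f1, h|apply g1, h]|ring].
- intros; apply ccont_plus; auto.
- intros; apply ccont_plus; auto.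
Qed.

Lemma entire_mult f g : is_entire f -> is_entire g -> is_entire (fun z => f z * g z)%C.
Proof.
intros [f' [f1 [f2 f3]]] [g' [g1 [g2 g3]]].
exists (fun z => f' z * g z + f z * g' z)%C; split; [|split].
- intros gamma s l h; eapply pder_eq; [apply pder_mult; [apply f1, h|apply g1, h]|simpl; ring].
- intros; apply ccont_mult; auto.
- intros; apply ccont_plus; apply ccont_mult; auto.
Qed.

Lemma entire_Cexp f : is_entire f -> is_entire (fun z => Cexp (f z)).
Proof.
intros [f' [f1 [f2 f3]]]; exists (fun z => Cexp (f z) * f' z)%C; split; [|split].
- intros gamma s l h; eapply pder_eq; [apply pder_Cexp, f1, h|simpl; ring].
- intros; apply ccont_Cexp; auto.
- intros; apply ccont_mult; auto; apply ccont_Cexp; auto.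
Qed.

Lemma entire_ccont f : is_entire f -> forall (X : UniformSpace) (G : X -> C) x,
  ccont G x -> ccont (fun y => f (G y)) x.
Proof. intros [f' [_ [h _]]]; exact h. Qed.

Lemma entire_ext f g : (forall z, f z = g z) -> is_entire f -> is_entire g.
Proof.
intros h [f' [f1 [f2 f3]]]; exists f'; split; [|split]; [| |exact f3].
- intros gamma s l hl; destruct (f1 gamma s l hl) as [a b]; split.
  + eapply is_derive_ext; [|exact a]; intros t; simpl; rewrite h; reflexivity.
  + eapply is_derive_ext; [|exact b]; intros t; simpl; rewrite h; reflexivity.
- intros X G x hG; destruct (f2 X G x hG) as [a b]; split.
  + eapply continuous_ext; [|exact a]; intros t; simpl; rewrite h; reflexivity.
  + eapply continuous_ext; [|exact b]; intros t; simpl; rewrite h; reflexivity.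
Qed.

(** * Cauchy's theorem *)

Lemma continuity_2d_of (F : R * R -> R) (x y : R) :
  continuous F (x, y) -> continuity_2d_pt (fun u w => F (u, w)) x y.
Proof.
intros h eps.
assert (h' := h (ball (F (x, y)) eps) (locally_ball _ eps)).
destruct h' as [d hd]; exists d; intros u w hu hw.
exact (hd (u, w) (conj hu hw)).
Qed.

(** Cauchy's theorem for the homotopy from the horizontal line [Im u = c] to
    the graph of [h]: the difference of the two integrals over [[0, S]] is the
    contribution of the two vertical ends. *)
Section Graph.
Variables (T : C -> C) (h h' : R -> R) (c : R).
Hypothesis hT : is_entire T.
Hypothesis hd : forall p, is_derive h p (h' p).
Hypothesis hc : forall p, continuous h' p.

Definition vertical (p : R) : R :=
  RInt (fun tau => (h p - c) * Re (T (p, c + tau * (h p - c)))) 0 1.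

Let graph_term (p : R) : R :=
  Im (T (p, h p) * (1, h' p)) - Im (T (p, c)).

(** The mixed derivatives of the homotopy [(p, tau) |-> c + tau (h p - c)] agree, so the
    [p]-derivative is an exact [tau]-derivative and integrates to its end values. *)
Lemma vertical_derive (p : R) : is_derive vertical p (graph_term p).
Proof.
destruct hT as [T' [T1 [T2 T3]]].
assert (hh : forall p, continuous h p)
  by (intros; apply (ex_derive_continuous (V := R_NormedModule)); eexists; apply hd).
set (D := fun p tau => Im (T' (p, c + tau * (h p - c)) * (1, tau * h' p) * (0, h p - c)
  + T (p, c + tau * (h p - c)) * (0, h' p))).
assert (hDp : forall p tau, is_derive
  (fun q => (h q - c) * Re (T (q, c + tau * (h q - c)))) p (D p tau)).
{ intros q tau.
  assert (hg : pder (fun q => (q, c + tau * (h q - c))) q (1, tau * h' q)).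
  { apply pder_pair; [apply (is_derive_id (K := R_AbsRing))|].
    assert (hq := hd q); auto_derive; [exists (h' q); exact hq|].
    replace (Derive (fun x : R => h x) q) with (h' q) by (symmetry; apply is_derive_unique, hq); ring. }
  assert (hw : pder (fun q => (0, h q - c)) q (0, h' q)).
  { apply pder_pair; [apply (is_derive_const (K := R_AbsRing) (V := R_NormedModule))|].
    assert (hq := hd q); auto_derive; [exists (h' q); exact hq|].
    replace (Derive (fun x : R => h x) q) with (h' q) by (symmetry; apply is_derive_unique, hq); ring. }
  assert (hm := proj2 (pder_mult _ _ _ _ _ (T1 _ _ _ hg) hw)).
  refine (is_derive_ext _ _ _ _ _ hm).
  intros t; rewrite Im_mult; simpl; unfold Re; ring. }
assert (hDt : forall p tau, is_derive
  (fun r => Im (T (p, c + r * (h p - c)) * (1, r * h' p))) tau (D p tau)).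
{ intros q tau.
  assert (hg : pder (fun r => (q, c + r * (h q - c))) tau (0, h q - c)).
  { apply pder_pair; [apply (is_derive_const (K := R_AbsRing) (V := R_NormedModule))|].
    auto_derive; [exact I|ring]. }
  assert (hw : pder (fun r => (1, r * h' q)) tau (0, h' q)).
  { apply pder_pair; [apply (is_derive_const (K := R_AbsRing) (V := R_NormedModule))|].
    auto_derive; [exact I|ring]. }
  assert (hm := proj2 (pder_mult _ _ _ _ _ (T1 _ _ _ hg) hw)).
  replace (D q tau) with (Im (T' (q, c + tau * (h q - c))%R * (0, h q - c)%R * (1, tau * h' q)%R +
        T (q, c + tau * (h q - c))%R * (0, h' q)%R)).
  { exact hm. }
  unfold D; do 2 f_equal; ring. }
assert (hDc : forall z : R * R, continuous (fun z => D (fst z) (snd z)) z).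
{ intros z.
  assert (k1 : continuous (fun z : R * R => fst z) z) by apply continuous_fst.
  assert (k2 : continuous (fun z : R * R => snd z) z) by apply continuous_snd.
  assert (k3 : continuous (fun z : R * R => h (fst z) - c) z).
  { apply (continuous_minus (V := R_NormedModule)); [|apply continuous_const].
    exact (continuous_comp _ h z k1 (hh _)). }
  assert (k4 : continuous (fun z : R * R => h' (fst z)) z)
    by exact (continuous_comp _ h' z k1 (hc _)).
  assert (kG : ccont (fun z : R * R => (fst z, c + snd z * (h (fst z) - c))) z).
  { apply ccont_pair; [exact k1|].
    apply (continuous_plus (V := R_NormedModule)); [apply continuous_const|].
    exact (continuous_mult (K := R_AbsRing) _ _ _ k2 k3). }
  assert (k0 : forall a : R, continuous (fun z : R * R => a) z) by (intros; apply continuous_const).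
  refine (proj2 (ccont_plus _ _ _ (ccont_mult _ _ _ (ccont_mult _ _ _ (T3 _ _ _ kG)
    (ccont_pair (fun _ => 1) (fun z => snd z * h' (fst z)) z (k0 1) _)) (ccont_pair (fun _ => 0) _ z (k0 0) k3))
    (ccont_mult _ _ _ (T2 _ _ _ kG) (ccont_pair (fun _ => 0) _ z (k0 0) k4)))).
  exact (continuous_mult (K := R_AbsRing) _ _ _ k2 k4). }
assert (hDc2 : forall p tau, continuous (D p) tau).
{ intros q tau.
  apply (continuous_comp (fun r => (q, r)) (fun z : R * R => D (fst z) (snd z))).
  - apply (continuous_comp_2 (fun _ : R => q) (fun r : R => r) (fun a b => (a, b)) tau).
    + apply continuous_const.
    + apply continuous_id.
    + apply (continuous_ext (fun z : R * R => z)); [intros [? ?]; reflexivity|apply continuous_id].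
  - apply hDc. }
assert (hDer : forall p tau, Derive (fun q => (h q - c) * Re (T (q, c + tau * (h q - c)))) p = D p tau)
  by (intros; apply is_derive_unique, hDp).
assert (hmain : is_derive vertical p
  (RInt (fun tau => Derive (fun q => (h q - c) * Re (T (q, c + tau * (h q - c)))) p) 0 1)).
{ unfold vertical.
  apply (is_derive_RInt_param (fun p tau => (h p - c) * Re (T (p, c + tau * (h p - c)))) 0 1 p).
  - apply filter_forall; intros q tau _; eexists; apply hDp.
  - intros tau _.
    apply (continuity_2d_pt_ext (fun u w => D u w)); [intros; symmetry; apply hDer|].
    exact (continuity_2d_of (fun z => D (fst z) (snd z)) p tau (hDc _)).
  - apply filter_forall; intros q; apply ex_RInt_cont; intros tau.
    apply (continuous_scal_r (V := R_NormedModule) (h q - c)).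
    refine (proj1 (T2 _ (fun tau => (q, c + tau * (h q - c))) tau _)).
    apply ccont_pair; [apply continuous_const|].
    apply (ex_derive_continuous (fun tau => c + tau * (h q - c))); auto_derive; exact I. }
replace (graph_term p) with
  (RInt (fun tau => Derive (fun q => (h q - c) * Re (T (q, c + tau * (h q - c)))) p) 0 1).
{ exact hmain. }
rewrite (RInt_ext _ (D p)) by (intros; apply hDer).
apply (is_RInt_unique (V := R_CompleteNormedModule)).
assert (hF := is_RInt_derive (fun r => Im (T (p, c + r * (h p - c)) * (1, r * h' p))) (D p) 0 1
  (fun x _ => hDt p x) (fun x _ => hDc2 p x)).
replace (graph_term p) with (minus (Im (T (p, c + 1 * (h p - c)) * (1, 1 * h' p)))
  (Im (T (p, c + 0 * (h p - c)) * (1, 0 * h' p)))).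
{ exact hF. }
unfold graph_term, minus, plus, opp; simpl.
replace (c + 1 * (h p - c)) with (h p) by ring; replace (c + 0 * (h p - c)) with c by ring.
rewrite Rmult_1_l, Rmult_0_l; unfold Im; simpl; ring.
Qed.

(** On the segment over [p = 0] the function [T] is imaginary and [du = i dy], so
    this end only affects real parts; the other end disappears as [p] grows. *)
Lemma HInt_graph (B B1 B2 M : R) :
  (forall y, Re (T (0, y)) = 0) ->
  decays (fun p => Im (T (p, c))) B1 ->
  decays (fun p => Im (T (p, h p) * (1, h' p))) B2 ->
  (forall p, 0 < p -> Rabs (h p - c) <= M) ->
  (forall p tau, 0 < p -> 0 <= tau <= 1 -> Cmod (T (p, c + tau * (h p - c))) <= B * exp (- p)) ->
  HInt (fun p => Im (T (p, h p) * (1, h' p))) = HInt (fun p => Im (T (p, c))).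
Proof.
intros h0 d1 d2 hM hB.
assert (hg := decays_lin _ _ _ _ 1 (-1) d2 d1).
assert (hI := HInt_lin _ _ _ _ 1 (-1) d2 d1).
assert (hz : HInt (fun p => 1 * Im (T (p, h p) * (1, h' p)) + -1 * Im (T (p, c))) = 0);
  [|rewrite hI in hz; lra].
assert (hS : forall S, RInt (fun p => 1 * Im (T (p, h p) * (1, h' p)) + -1 * Im (T (p, c))) 0 S
  = vertical S).
{ intros S; apply (is_RInt_unique (V := R_CompleteNormedModule)).
  assert (hv0 : vertical 0 = 0).
  { unfold vertical; rewrite (RInt_ext _ (fun _ => 0)).
    - rewrite RInt_const; unfold scal; simpl; unfold mult; simpl; ring.
    - intros tau _; rewrite h0; apply Rmult_0_r. }
  replace (vertical S) with (minus (vertical S) (vertical 0))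
    by (rewrite hv0; unfold minus, plus, opp; simpl; ring).
  apply (is_RInt_derive vertical).
  - intros x _; cbv beta.
    replace (1 * Im (T (x, h x) * (1, h' x)) + -1 * Im (T (x, c))) with (graph_term x)
      by (unfold graph_term; ring).
    apply vertical_derive.
  - intros x _; apply hg. }
apply is_lim_HInt.
apply (is_lim_ext vertical); [intros; symmetry; apply hS|].
destruct (Rle_dec 0 (M * B)) as [hMB|hMB].
2:{ exfalso; apply hMB; apply Rmult_le_pos.
    - apply Rle_trans with (2 := hM 1 Rlt_0_1), Rabs_pos.
    - specialize (hB 1 0 Rlt_0_1 ltac:(lra)).
      assert (k := Rle_trans _ _ _ (Cmod_ge_0 _) hB); assert (e := exp_pos (Ropp 1)).
      apply Rnot_lt_le; intros hn; assert (B * exp (Ropp 1) < 0) by nra; lra. }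
assert (hb : forall S, 0 < S -> Rabs (vertical S) <= M * B * exp (- S)).
{ intros S hS0; unfold vertical.
  replace (M * B * exp (- S)) with ((1 - 0) * (M * (B * exp (- S)))) by ring.
  apply abs_RInt_le_const; [lra| |].
  - apply ex_RInt_cont; intros tau.
    apply (continuous_scal_r (V := R_NormedModule) (h S - c)).
    refine (proj1 (entire_ccont T hT _ (fun tau => (S, c + tau * (h S - c))) tau _)).
    apply ccont_pair; [apply continuous_const|].
    apply (ex_derive_continuous (fun tau => c + tau * (h S - c))); auto_derive; exact I.
  - intros tau ht; rewrite Rabs_mult; apply Rmult_le_compat; try apply Rabs_pos.
    + apply hM; lra.
    + apply Rle_trans with (1 := Re_le_Cmod _); apply hB; assumption. }
apply is_lim_spec; intros eps.
destruct (exp_tail (eps / (M * B + 1))) as [N [hN0 hN]].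
{ apply Rdiv_lt_0_compat; [apply cond_pos|lra]. }
exists N; intros S hSN; rewrite Rminus_0_r.
apply Rle_lt_trans with (1 := hb S ltac:(lra)).
specialize (hN S ltac:(lra)); assert (k := exp_pos (- S)).
apply Rlt_le_trans with ((M * B + 1) * (eps / (M * B + 1))); [nra|right; field; lra].
Qed.
End Graph.

(** * Doubly exponential decay and growth *)

Lemma exp_mul (m : nat) (z : R) : exp (INR m * z) = exp z ^ m.
Proof.
induction m as [|m IH]; [simpl; rewrite Rmult_0_l; apply exp_0|].
rewrite S_INR, Rmult_plus_distr_r, exp_plus, IH, Rmult_1_l; simpl; ring.
Qed.

Lemma pow_exp_bound (d : R) (m : nat) : 0 < d ->
  exists B, 0 <= B /\ forall y, 0 < y -> y ^ m * exp (- (d * y)) <= B.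
Proof.
intros hd; set (m' := INR (S m)).
assert (hm' : 0 < m') by (unfold m'; apply lt_0_INR, Nat.lt_0_succ).
exists ((1 + m' / d) ^ S m); split.
{ apply pow_le; assert (0 < m' / d) by (apply Rdiv_lt_0_compat; lra); lra. }
intros y hy.
(* [y <= (m'/d) exp (d y / m')], raised to the power [m'] *)
assert (h1 : (1 + y) <= (1 + m' / d) * exp (d * y / m')).
{ assert (h := exp_ineq1_le (d * y / m')).
  assert (hp : 0 < d * y / m') by (apply Rdiv_lt_0_compat; [apply Rmult_lt_0_compat|]; lra).
  assert (hq : 0 < m' / d) by (apply Rdiv_lt_0_compat; lra).
  assert (e : m' / d * (d * y / m') = y) by (field; lra).
  assert (m' / d * (d * y / m') <= m' / d * exp (d * y / m')) by (apply Rmult_le_compat_l; lra).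
  lra. }
assert (h2 : (1 + y) ^ S m <= (1 + m' / d) ^ S m * exp (d * y)).
{ replace (exp (d * y)) with (exp (d * y / m') ^ S m).
  - rewrite <- Rpow_mult_distr; apply pow_incr; lra.
  - rewrite <- exp_mul; f_equal; fold m'; field; lra. }
assert (h3 : y ^ m <= (1 + y) ^ S m).
{ apply Rle_trans with ((1 + y) ^ m); [apply pow_incr; lra|].
  apply Rle_pow; [lra|auto]. }
rewrite exp_Ropp; assert (he := exp_pos (d * y)).
apply Rmult_le_reg_r with (exp (d * y)); [exact he|].
rewrite Rmult_assoc, Rinv_l, Rmult_1_r by lra; lra.
Qed.

Lemma exp_double_bound (d : R) (m : nat) : 0 < d ->
  exists B, 0 <= B /\ forall p, exp p ^ m * exp (- (d * exp p)) <= B * exp (- p).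
Proof.
intros hd; destruct (pow_exp_bound d (S m) hd) as [B [hB0 hB]].
exists B; split; [exact hB0|]; intros p.
assert (hp := exp_pos p); specialize (hB (exp p) hp); simpl in hB.
rewrite (exp_Ropp p); apply Rmult_le_reg_r with (exp p); [exact hp|].
rewrite (Rmult_assoc B), Rinv_l by lra; lra.
Qed.

(** Polynomial growth in [exp p], the common size of [lam] and [mu]. *)
Definition growth (g : R -> C) : Prop :=
  (forall p, ccont g p) /\
  exists B n, 0 <= B /\ forall p, 0 < p -> Cmod (g p) <= B * exp p ^ n.

Lemma growth_mult f g : growth f -> growth g -> growth (fun p => f p * g p)%C.
Proof.
intros [fc [B [n [hB hf]]]] [gc [B' [n' [hB' hg]]]]; split.
- intros p; apply ccont_mult; auto.
- exists (B * B'), (n + n')%nat; split; [apply Rmult_le_pos; assumption|].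
  intros p hp; rewrite Cmod_mult, pow_add.
  replace (B * B' * (exp p ^ n * exp p ^ n')) with ((B * exp p ^ n) * (B' * exp p ^ n')) by ring.
  apply Rmult_le_compat; auto using Cmod_ge_0.
Qed.

Lemma growth_opp f : growth f -> growth (fun p => - f p)%C.
Proof.
intros [fc [B [n [hB hf]]]]; split; [intros p; apply ccont_opp; auto|].
exists B, n; split; [exact hB|]; intros p hp; rewrite Cmod_opp; auto.
Qed.

Lemma growth_const (c : C) : growth (fun _ => c).
Proof.
split; [intros; apply ccont_const|].
exists (Cmod c), 0%nat; split; [apply Cmod_ge_0|]; intros; simpl; lra.
Qed.

(** Doubly exponential decay of the phase beats every growth. *)
Lemma Cexp_growth_bound (B d b : R) (n : nat) : 0 <= B -> 0 < d ->
  exists B', 0 <= B' /\ forall (z w : C) p,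
    Re z <= - (d * exp p) + b -> Cmod w <= B * exp p ^ n ->
    Cmod (Cexp z * w) <= B' * exp (- p).
Proof.
intros hB hd.
destruct (exp_double_bound d n hd) as [B' [hB' h]].
exists (exp b * B * B'); split.
{ assert (hb := exp_pos b); repeat apply Rmult_le_pos; lra. }
intros z w p hz hw; rewrite Cmod_mult, Cmod_Cexp; specialize (h p).
assert (h1 : exp (Re z) <= exp b * exp (- (d * exp p))).
{ rewrite <- exp_plus; destruct hz as [hz|hz].
  - left; apply exp_increasing; lra.
  - right; f_equal; lra. }
apply Rle_trans with ((exp b * exp (- (d * exp p))) * (B * exp p ^ n)).
- apply Rmult_le_compat; auto using Cmod_ge_0; left; apply exp_pos.
- replace (exp b * exp (- (d * exp p)) * (B * exp p ^ n))
    with ((exp b * B) * (exp p ^ n * exp (- (d * exp p)))) by ring.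
  rewrite (Rmult_assoc _ B'); apply Rmult_le_compat_l; [|exact h].
  apply Rmult_le_pos; [left; apply exp_pos|exact hB].
Qed.

Lemma growth_Cexp_bound (g : R -> C) (d b : R) : growth g -> 0 < d ->
  exists B, 0 <= B /\ forall (z : C) p, 0 < p -> Re z <= - (d * exp p) + b ->
    Cmod (Cexp z * g p) <= B * exp (- p).
Proof.
intros [_ [B [n [hB hg]]]] hd.
destruct (Cexp_growth_bound B d b n hB hd) as [B' [hB' h]].
exists B'; split; [exact hB'|]; intros z p hp hz; apply h; auto.
Qed.

Lemma mvt_bound (F F1 : R -> R) (a b B : R) :
  (forall x, is_derive F x (F1 x)) ->
  (forall x, Rmin a b <= x <= Rmax a b -> Rabs (F1 x) <= B) ->
  Rabs (F b - F a) <= B * Rabs (b - a).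
Proof.
intros h1 hB; destruct (MVT_gen F a b F1) as [c [hc e]].
- intros; apply h1.
- intros x _; apply derivable_continuous_pt; exists (F1 x); apply is_derive_Reals, h1.
- rewrite e, Rabs_mult; apply Rmult_le_compat_r; [apply Rabs_pos|apply hB, hc].
Qed.

Lemma taylor2_bound (F F1 F2 : R -> R) (a b B : R) :
  (forall x, is_derive F x (F1 x)) -> (forall x, is_derive F1 x (F2 x)) ->
  (forall x, Rmin a b <= x <= Rmax a b -> Rabs (F2 x) <= B) ->
  Rabs (F b - F a - (b - a) * F1 a) <= B * (b - a) ^ 2.
Proof.
intros h1 h2 hB; destruct (MVT_gen F a b F1) as [c [hc e]].
- intros; apply h1.
- intros x _; apply derivable_continuous_pt; exists (F1 x); apply is_derive_Reals, h1.
- assert (hca : Rabs (c - a) <= Rabs (b - a)).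
  { unfold Rmin, Rmax in hc; destruct (Rle_dec a b).
    - rewrite !Rabs_right; lra.
    - rewrite !Rabs_left1; lra. }
  assert (h := mvt_bound F1 F2 a c B h2).
  assert (hB0 : 0 <= B).
  { apply Rle_trans with (Rabs (F2 c)); [apply Rabs_pos|apply hB, hc]. }
  rewrite e; replace (F1 c * (b - a) - (b - a) * F1 a) with ((F1 c - F1 a) * (b - a)) by ring.
  rewrite Rabs_mult, <- pow2_abs; simpl; rewrite Rmult_1_r, <- Rmult_assoc.
  apply Rmult_le_compat_r; [apply Rabs_pos|].
  apply Rle_trans with (B * Rabs (c - a)).
  + apply h; intros x hx; apply hB.
    unfold Rmin, Rmax in *; destruct (Rle_dec a b), (Rle_dec a c); lra.
  + apply Rmult_le_compat_l; assumption.
Qed.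

(** * Derivatives from quadratic estimates *)
(** A quadratic remainder yields the derivative along any filter, hence two-sided and
    one-sided derivatives alike. *)
Lemma quad_filterdiff (V : NormedModule R_AbsRing) (f : R -> V)
    (F : (R -> Prop) -> Prop) {FF : Filter F} (s : R) (l : V) (B d : R) :
  0 < d ->
  (forall x : R, is_filter_lim F x -> x = s) ->
  (forall e : R, 0 < e -> F (fun y => Rabs (y - s) < e)) ->
  F (fun y => Rabs (y - s) < d ->
    norm (minus (minus (f y) (f s)) (scal (y - s) l)) <= B * (y - s) ^ 2) ->
  filterdiff f F (fun h : R => scal h l).
Proof.
intros hd hlim hs hq; split; [apply (is_linear_scal_l (K := R_AbsRing))|].
intros x hx; rewrite (hlim x hx); intros eps.
assert (he := cond_pos eps).
assert (hB : 0 < Rabs B + 1) by (assert (h := Rabs_pos B); lra).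
generalize (filter_and _ _ hq (filter_and _ _ (hs d hd)
  (hs (eps / (Rabs B + 1)) (Rdiv_lt_0_compat _ _ he hB)))).
apply filter_imp; intros y [h1 [h2 h3]]; specialize (h1 h2).
change (norm (minus (minus (f y) (f s)) (scal (y - s) l)) <= eps * Rabs (y - s)).
apply Rle_trans with (1 := h1).
rewrite <- pow2_abs; simpl; rewrite Rmult_1_r, <- Rmult_assoc.
apply Rmult_le_compat_r; [apply Rabs_pos|].
assert (h4 := Rle_abs B); assert (h5 := Rabs_pos (y - s)).
apply Rle_trans with ((Rabs B + 1) * (eps / (Rabs B + 1))).
- apply Rle_trans with ((Rabs B + 1) * Rabs (y - s)).
  + apply Rmult_le_compat_r; lra.
  + apply Rmult_le_compat_l; lra.
- right; field; lra.
Qed.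

Lemma norm_RtoC_le (r m : R) : Rabs r <= m ->
  @norm R_AbsRing C_R_NormedModule (RtoC r) <= m.
Proof.
intros h; apply Rle_trans with (2 := h); right.
unfold norm, RtoC; simpl; unfold prod_norm; simpl; unfold norm; simpl; unfold abs; simpl.
rewrite Rabs_R0, Rmult_0_l, Rplus_0_r, Rmult_1_r.
apply (sqrt_Rsqr (Rabs r)), Rabs_pos.
Qed.

Lemma within_lim_unique (D : R -> Prop) (s x : R) :
  D s -> is_filter_lim (within D (locally s)) x -> x = s.
Proof.
intros hD h; destruct (Req_dec x s) as [e|ne]; [exact e|exfalso].
assert (hp : 0 < Rabs (x - s)) by (apply Rabs_pos_lt; lra).
assert (hb := h (ball x (mkposreal _ hp)) (locally_ball x _)).
assert (hs := locally_singleton _ _ hb hD).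
change (Rabs (s - x) < Rabs (x - s)) in hs; rewrite Rabs_minus_sym in hs; lra.
Qed.

Lemma locally_near (s e : R) : 0 < e -> locally s (fun y => Rabs (y - s) < e).
Proof. intros he; exists (mkposreal e he); intros y hy; exact hy. Qed.

Lemma quad_derive_in (D : R -> Prop) (f : R -> R) (s l B d : R) : D s -> 0 < d ->
  (forall y, D y -> Rabs (y - s) < d -> Rabs (f y - f s - (y - s) * l) <= B * (y - s) ^ 2) ->
  is_derive_in D (fun y => RtoC (f y)) s (RtoC l).
Proof.
intros hD hd h; unfold is_derive_in.
apply (quad_filterdiff C_R_NormedModule _ _ s _ B d hd).
- intros x; apply within_lim_unique, hD.
- intros e he; unfold within; generalize (locally_near s e he); apply filter_imp; auto.
- unfold within; apply filter_forall; intros y hy hy2.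
  apply Rle_trans with (norm (RtoC (f y - f s - (y - s) * l) : C_R_NormedModule)).
  + right; apply f_equal.
    apply Ceq; unfold Re, Im, minus, plus, opp, scal; simpl;
      unfold plus, opp, scal; simpl; unfold mult; simpl; ring.
  + apply norm_RtoC_le; auto.
Qed.

Lemma quad_derive (f : R -> R) (s l B d : R) : 0 < d ->
  (forall y, Rabs (y - s) < d -> Rabs (f y - f s - (y - s) * l) <= B * (y - s) ^ 2) ->
  is_derive f s l.
Proof.
intros hd h; apply (quad_filterdiff R_NormedModule _ _ s _ B d hd).
- intros x hx; symmetry; exact (is_filter_lim_locally_unique s x hx).
- intros e he; apply locally_near, he.
- apply filter_forall; intros y hy; exact (h y hy).
Qed.

Lemma quad_derive_RtoC (f : R -> R) (s l B d : R) : 0 < d ->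
  (forall y, Rabs (y - s) < d -> Rabs (f y - f s - (y - s) * l) <= B * (y - s) ^ 2) ->
  @is_derive R_AbsRing C_R_NormedModule (fun y => RtoC (f y)) s (RtoC l).
Proof.
intros hd h; apply (quad_filterdiff C_R_NormedModule _ _ s _ B d hd).
- intros x hx; symmetry; exact (is_filter_lim_locally_unique s x hx).
- intros e he; apply locally_near, he.
- apply filter_forall; intros y hy.
  apply Rle_trans with (norm (RtoC (f y - f s - (y - s) * l) : C_R_NormedModule)).
  + right; apply f_equal.
    apply Ceq; unfold Re, Im, minus, plus, opp, scal; simpl;
      unfold plus, opp, scal; simpl; unfold mult; simpl; ring.
  + apply norm_RtoC_le; auto.
Qed.

(** * Superpositions of exponential waves *)

Lemma pder_affine (c d : C) s : pder (fun r => c * RtoC r + d)%C s c.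
Proof.
split.
- apply is_derive_ext with (fun r : R => Re c * r + Re d).
  { intros r; rewrite Re_plus, Re_mult; unfold Re, Im, RtoC; simpl; ring. }
  auto_derive; [exact I|ring].
- apply is_derive_ext with (fun r : R => Im c * r + Im d).
  { intros r; rewrite Im_plus, Im_mult; unfold Re, Im, RtoC; simpl; ring. }
  auto_derive; [exact I|ring].
Qed.

Lemma pder_Cexp_affine (c d e : C) s :
  pder (fun r => Cexp (c * RtoC r + d) * e)%C s (Cexp (c * RtoC s + d) * (c * e)).
Proof.
eapply pder_eq.
- apply pder_mult; [apply pder_Cexp, pder_affine|apply pder_const].
- simpl; ring.
Qed.

Definition term (X O g : R -> C) (x t p : R) : C :=
  (Cexp (X p * x - O p * t) * g p)%C.

Section Family.
Variables (X1 X2 O : R -> C) (k K : R).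
Hypothesis hk : 0 < k.
Hypothesis hK : 0 <= K.
Hypothesis gX1 : growth X1.
Hypothesis gX2 : growth X2.
Hypothesis gO : growth O.
Hypothesis hX1 : forall p, 0 < p -> Re (X1 p) <= - (k * exp p) + K.
Hypothesis hX2 : forall p, 0 < p -> Re (X2 p) <= - (k * exp p) + K.
Hypothesis hO : forall p, 0 < p -> k * exp p - K <= Re (O p).

Definition J (g1 g2 : R -> C) (x t p : R) : R :=
  Im (term X1 O g1 x t p + term X2 O g2 x t p).

Definition W (g1 g2 : R -> C) (x t : R) : R := HInt (J g1 g2 x t).

(** Away from the corner [x + t >= d], so at least one of the two decaying factors acts
    with a definite strength. *)
Lemma term_bound (X g : R -> C) (d m : R) :
  (forall p, 0 < p -> Re (X p) <= - (k * exp p) + K) -> growth g -> 0 < d ->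
  exists B, 0 <= B /\ forall x t p, 0 <= x -> 0 <= t -> d <= x + t <= m -> 0 < p ->
    Cmod (term X O g x t p) <= B * exp (- p).
Proof.
intros hX hg hd.
destruct (growth_Cexp_bound g (d * k) (m * K) hg (Rmult_lt_0_compat _ _ hd hk)) as [B [hB h]].
exists B; split; [exact hB|]; intros x t p hx ht hxt hp.
apply h; [exact hp|].
replace (Re (X p * x - O p * t)) with (x * Re (X p) - t * Re (O p))
  by (unfold Re, RtoC; simpl; ring).
specialize (hX p hp); specialize (hO p hp); assert (he := exp_pos p).
assert (x * Re (X p) <= x * (- (k * exp p) + K)) by (apply Rmult_le_compat_l; assumption).
assert (t * (k * exp p - K) <= t * Re (O p)) by (apply Rmult_le_compat_l; assumption).
assert (d * (k * exp p) <= (x + t) * (k * exp p)).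
{ apply Rmult_le_compat_r; [|lra]; apply Rmult_le_pos; lra. }
assert ((x + t) * K <= m * K) by (apply Rmult_le_compat_r; lra).
lra.
Qed.

Lemma J_bound (g1 g2 : R -> C) (d m : R) : growth g1 -> growth g2 -> 0 < d ->
  exists B, 0 <= B /\ forall x t p, 0 <= x -> 0 <= t -> d <= x + t <= m -> 0 < p ->
    Rabs (J g1 g2 x t p) <= B * exp (- p).
Proof.
intros h1 h2 hd.
destruct (term_bound X1 g1 d m hX1 h1 hd) as [B1 [p1 b1]].
destruct (term_bound X2 g2 d m hX2 h2 hd) as [B2 [p2 b2]].
exists (B1 + B2); split; [lra|]; intros x t p hx ht hxt hp.
unfold J; apply Rle_trans with (1 := Im_le_Cmod _).
apply Rle_trans with (1 := Cmod_triangle _ _).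
specialize (b1 x t p hx ht hxt hp); specialize (b2 x t p hx ht hxt hp); lra.
Qed.

Lemma term_ccont (X g : R -> C) x t p : growth X -> growth g -> ccont (term X O g x t) p.
Proof.
intros hX hg; unfold term, Cminus; apply ccont_mult; [|apply hg].
apply ccont_Cexp, ccont_plus.
- apply ccont_mult; [apply hX|apply ccont_const].
- apply ccont_opp, ccont_mult; [apply gO|apply ccont_const].
Qed.

Lemma J_continuous (g1 g2 : R -> C) x t : growth g1 -> growth g2 ->
  forall p, continuous (J g1 g2 x t) p.
Proof.
intros h1 h2 p; exact (proj2 (ccont_plus _ _ p (term_ccont X1 g1 x t p gX1 h1) (term_ccont X2 g2 x t p gX2 h2))).
Qed.

Lemma J_decays (g1 g2 : R -> C) x t : growth g1 -> growth g2 ->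
  0 <= x -> 0 <= t -> 0 < x + t -> exists B, decays (J g1 g2 x t) B.
Proof.
intros h1 h2 hx ht hxt.
destruct (J_bound g1 g2 (x + t) (x + t) h1 h2 hxt) as [B [_ hB]].
exists B; split; [apply J_continuous; assumption|].
intros p hp; apply hB; lra.
Qed.

Definition Dx (X g : R -> C) (p : R) : C := (X p * g p)%C.
Definition Dt (g : R -> C) (p : R) : C := (- O p * g p)%C.

Lemma growth_Dx X g : growth X -> growth g -> growth (Dx X g).
Proof. intros; apply growth_mult; assumption. Qed.

Lemma growth_Dt g : growth g -> growth (Dt g).
Proof.
intros h; exact (growth_mult (fun p => - O p)%C g (growth_opp O gO) h).
Qed.

Lemma term_pder_x (X g : R -> C) x t p :
  pder (fun y => term X O g y t p) x (term X O (Dx X g) x t p).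
Proof. exact (pder_Cexp_affine (X p) (- (O p * t)) (g p) x). Qed.

Lemma term_pder_t (X g : R -> C) x t p :
  pder (fun tau => term X O g x tau p) t (term X O (Dt g) x t p).
Proof.
assert (e : forall tau : R, (- O p * tau + X p * x = X p * x - O p * tau)%C) by (intros; ring).
destruct (pder_Cexp_affine (- O p) (X p * x) (g p) t) as [a b].
unfold term, Dt; rewrite <- e; split.
- eapply is_derive_ext; [|exact a]; intros r; cbv beta; rewrite e; reflexivity.
- eapply is_derive_ext; [|exact b]; intros r; cbv beta; rewrite e; reflexivity.
Qed.

Lemma J_derive_x (g1 g2 : R -> C) x t p :
  is_derive (fun y => J g1 g2 y t p) x (J (Dx X1 g1) (Dx X2 g2) x t p).
Proof. exact (proj2 (pder_plus _ _ _ _ _ (term_pder_x X1 g1 x t p) (term_pder_x X2 g2 x t p))). Qed.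

Lemma J_derive_t (g1 g2 : R -> C) x t p :
  is_derive (fun tau => J g1 g2 x tau p) t (J (Dt g1) (Dt g2) x t p).
Proof. exact (proj2 (pder_plus _ _ _ _ _ (term_pder_t X1 g1 x t p) (term_pder_t X2 g2 x t p))). Qed.

Lemma Rmin_Rmax_near (a b d x : R) : 0 <= a -> 0 <= b -> Rabs (b - a) < d ->
  Rmin a b <= x <= Rmax a b -> 0 <= x /\ Rabs (x - a) < d.
Proof.
intros ha hb hd; unfold Rmin, Rmax; destruct (Rle_dec a b) as [h|h]; intros hx; split; try lra.
- apply Rle_lt_trans with (2 := hd); rewrite !Rabs_right; lra.
- apply Rle_lt_trans with (2 := hd); rewrite !Rabs_left1; lra.
Qed.

Lemma W_quad_x (g1 g2 : R -> C) x t : growth g1 -> growth g2 ->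
  0 <= x -> 0 <= t -> 0 < x + t -> exists d B, 0 < d /\
  forall y, 0 <= y -> Rabs (y - x) < d ->
    Rabs (W g1 g2 y t - W g1 g2 x t - (y - x) * W (Dx X1 g1) (Dx X2 g2) x t) <= B * (y - x) ^ 2.
Proof.
intros h1 h2 hx ht hxt.
assert (h1' := growth_Dx X1 g1 gX1 h1); assert (h2' := growth_Dx X2 g2 gX2 h2).
destruct (J_bound (Dx X1 (Dx X1 g1)) (Dx X2 (Dx X2 g2)) ((x + t) / 2) (2 * (x + t))
  (growth_Dx _ _ gX1 h1') (growth_Dx _ _ gX2 h2') ltac:(lra)) as [B [hB0 hB]].
exists ((x + t) / 2), B; split; [lra|]; intros y hy hyx.
assert (hyx' := Rabs_def2 _ _ hyx).
destruct (J_decays g1 g2 y t h1 h2 hy ht ltac:(lra)) as [B1 d1].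
destruct (J_decays g1 g2 x t h1 h2 hx ht ltac:(lra)) as [B2 d2].
destruct (J_decays (Dx X1 g1) (Dx X2 g2) x t h1' h2' hx ht ltac:(lra)) as [B3 d3].
apply (HInt_diff_le _ _ _ _ _ _ _ _ d1 d2 d3); intros p hp.
replace (B * (y - x) ^ 2 * exp (- p)) with (B * exp (- p) * (y - x) ^ 2) by ring.
apply (taylor2_bound (fun z => J g1 g2 z t p) (fun z => J (Dx X1 g1) (Dx X2 g2) z t p)
  (fun z => J (Dx X1 (Dx X1 g1)) (Dx X2 (Dx X2 g2)) z t p)).
- intros; apply J_derive_x.
- intros; apply J_derive_x.
- intros z hz; destruct (Rmin_Rmax_near x y _ z hx hy hyx hz) as [z0 z1].
  apply Rabs_def2 in z1; apply hB; lra.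
Qed.

Lemma W_quad_t (g1 g2 : R -> C) x t : growth g1 -> growth g2 ->
  0 <= x -> 0 <= t -> 0 < x + t -> exists d B, 0 < d /\
  forall y, 0 <= y -> Rabs (y - t) < d ->
    Rabs (W g1 g2 x y - W g1 g2 x t - (y - t) * W (Dt g1) (Dt g2) x t) <= B * (y - t) ^ 2.
Proof.
intros h1 h2 hx ht hxt.
assert (h1' := growth_Dt g1 h1); assert (h2' := growth_Dt g2 h2).
destruct (J_bound (Dt (Dt g1)) (Dt (Dt g2)) ((x + t) / 2) (2 * (x + t))
  (growth_Dt _ h1') (growth_Dt _ h2') ltac:(lra)) as [B [hB0 hB]].
exists ((x + t) / 2), B; split; [lra|]; intros y hy hyx.
assert (hyx' := Rabs_def2 _ _ hyx).
destruct (J_decays g1 g2 x y h1 h2 hx hy ltac:(lra)) as [B1 d1].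
destruct (J_decays g1 g2 x t h1 h2 hx ht ltac:(lra)) as [B2 d2].
destruct (J_decays (Dt g1) (Dt g2) x t h1' h2' hx ht ltac:(lra)) as [B3 d3].
apply (HInt_diff_le _ _ _ _ _ _ _ _ d1 d2 d3); intros p hp.
replace (B * (y - t) ^ 2 * exp (- p)) with (B * exp (- p) * (y - t) ^ 2) by ring.
apply (taylor2_bound (fun z => J g1 g2 x z p) (fun z => J (Dt g1) (Dt g2) x z p)
  (fun z => J (Dt (Dt g1)) (Dt (Dt g2)) x z p)).
- intros; apply J_derive_t.
- intros; apply J_derive_t.
- intros z hz; destruct (Rmin_Rmax_near t y _ z ht hy hyx hz) as [z0 z1].
  apply Rabs_def2 in z1; apply hB; lra.
Qed.

(** The two variables are moved one after the other; a neighbourhood of size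
    [(x + t) / 4] keeps the intermediate point away from the corner. *)
Lemma W_lipschitz (g1 g2 : R -> C) x t : growth g1 -> growth g2 ->
  0 <= x -> 0 <= t -> 0 < x + t -> exists d B, 0 < d /\ 0 <= B /\
  forall y s, 0 <= y -> 0 <= s -> Rabs (y - x) < d -> Rabs (s - t) < d ->
    Rabs (W g1 g2 y s - W g1 g2 x t) <= B * (Rabs (y - x) + Rabs (s - t)).
Proof.
intros h1 h2 hx ht hxt.
destruct (J_bound (Dx X1 g1) (Dx X2 g2) ((x + t) / 2) (2 * (x + t))
  (growth_Dx _ _ gX1 h1) (growth_Dx _ _ gX2 h2) ltac:(lra)) as [Bx [hBx hx']].
destruct (J_bound (Dt g1) (Dt g2) ((x + t) / 2) (2 * (x + t))
  (growth_Dt _ h1) (growth_Dt _ h2) ltac:(lra)) as [Bt [hBt ht']].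
exists ((x + t) / 4), (Bx + Bt); split; [lra|split; [lra|]]; intros y s hy hs hyx hst.
assert (hyx' := Rabs_def2 _ _ hyx); assert (hst' := Rabs_def2 _ _ hst).
destruct (J_decays g1 g2 y s h1 h2 hy hs ltac:(lra)) as [B1 d1].
destruct (J_decays g1 g2 x t h1 h2 hx ht ltac:(lra)) as [B2 d2].
replace (W g1 g2 y s - W g1 g2 x t) with (W g1 g2 y s - W g1 g2 x t - 0 * W g1 g2 x t) by ring.
apply (HInt_diff_le _ _ _ _ _ _ _ _ d1 d2 d2); intros p hp.
replace (J g1 g2 y s p - J g1 g2 x t p - 0 * J g1 g2 x t p)
  with ((J g1 g2 y s p - J g1 g2 x s p) + (J g1 g2 x s p - J g1 g2 x t p)) by ring.
apply Rle_trans with (1 := Rabs_triang _ _).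
assert (a1 : Rabs (J g1 g2 y s p - J g1 g2 x s p) <= Bx * exp (- p) * Rabs (y - x)).
{ apply (mvt_bound (fun z => J g1 g2 z s p) (fun z => J (Dx X1 g1) (Dx X2 g2) z s p)).
  - intros; apply J_derive_x.
  - intros z hz; destruct (Rmin_Rmax_near x y _ z hx hy hyx hz) as [z0 z1].
    apply Rabs_def2 in z1; apply hx'; lra. }
assert (a2 : Rabs (J g1 g2 x s p - J g1 g2 x t p) <= Bt * exp (- p) * Rabs (s - t)).
{ apply (mvt_bound (fun z => J g1 g2 x z p) (fun z => J (Dt g1) (Dt g2) x z p)).
  - intros; apply J_derive_t.
  - intros z hz; destruct (Rmin_Rmax_near t s _ z ht hs hst hz) as [z0 z1].
    apply Rabs_def2 in z1; apply ht'; lra. }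
assert (0 <= Bt * exp (- p) * Rabs (y - x))
  by (repeat apply Rmult_le_pos; auto using Rabs_pos; left; apply exp_pos).
assert (0 <= Bx * exp (- p) * Rabs (s - t))
  by (repeat apply Rmult_le_pos; auto using Rabs_pos; left; apply exp_pos).
lra.
Qed.

Definition V (c : R) (g1 g2 : R -> C) (x t : R) : C := RtoC (c * W g1 g2 x t).

Lemma Qbar0_sum x t : Qbar0 x t -> 0 <= x /\ 0 <= t /\ 0 < x + t.
Proof.
intros [hx [ht h]]; split; [exact hx|split; [exact ht|]].
apply Rnot_le_lt; intros h'; apply h; lra.
Qed.

Lemma scaled_quad (a b l h c B : R) : Rabs (a - b - h * l) <= B * h ^ 2 ->
  Rabs (c * a - c * b - h * (c * l)) <= (Rabs c * B) * h ^ 2.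
Proof.
intros H; replace (c * a - c * b - h * (c * l)) with (c * (a - b - h * l)) by ring.
rewrite Rabs_mult, Rmult_assoc; apply Rmult_le_compat_l; [apply Rabs_pos|exact H].
Qed.

Lemma V_continuous c g1 g2 : growth g1 -> growth g2 -> continuous_Qbar0 (V c g1 g2).
Proof.
intros h1 h2 x t hxt; destruct (Qbar0_sum x t hxt) as [hx [ht hs]].
destruct (W_lipschitz g1 g2 x t h1 h2 hx ht hs) as [d [B [hd [hB h]]]].
apply filterlim_locally; intros eps.
assert (he := cond_pos eps).
set (L := Rabs c * B + 1).
assert (hL0 : 0 <= Rabs c * B) by (apply Rmult_le_pos; [apply Rabs_pos|exact hB]).
assert (hL : 0 < L) by (unfold L; lra).
assert (hr : 0 < Rmin d (eps / (4 * L))).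
{ apply Rmin_pos; [exact hd|apply Rdiv_lt_0_compat; lra]. }
exists (mkposreal _ hr); intros [y s] [hy1 hy2] hq.
destruct (Qbar0_sum _ _ hq) as [hy [hs' _]]; simpl in hy, hs', hy1, hy2 |- *.
change (Rabs (y - x) < Rmin d (eps / (4 * L))) in hy1.
change (Rabs (s - t) < Rmin d (eps / (4 * L))) in hy2.
assert (m1 := Rmin_l d (eps / (4 * L))); assert (m2 := Rmin_r d (eps / (4 * L))).
specialize (h y s hy hs' ltac:(lra) ltac:(lra)).
assert (hb : Rabs (c * W g1 g2 y s - c * W g1 g2 x t) < eps).
{ replace (c * W g1 g2 y s - c * W g1 g2 x t) with (c * (W g1 g2 y s - W g1 g2 x t)) by ring.
  rewrite Rabs_mult.
  apply Rle_lt_trans with (Rabs c * (B * (Rabs (y - x) + Rabs (s - t)))).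
  { apply Rmult_le_compat_l; [apply Rabs_pos|exact h]. }
  rewrite <- Rmult_assoc.
  apply Rle_lt_trans with (L * (2 * (eps / (4 * L)))).
  - apply Rle_trans with ((Rabs c * B) * (2 * (eps / (4 * L)))).
    + apply Rmult_le_compat_l; [exact hL0|lra].
    + apply Rmult_le_compat_r; [|unfold L; lra].
      assert (0 < eps / (4 * L)) by (apply Rdiv_lt_0_compat; lra); lra.
  - replace (L * (2 * (eps / (4 * L)))) with (eps / 2) by (field; lra); lra. }
split; [exact hb|].
change (Rabs (0 - 0) < eps); rewrite Rminus_0_r, Rabs_R0; exact he.
Qed.

Lemma V_derive_x c g1 g2 x t : growth g1 -> growth g2 -> Qbar0 x t ->
  is_derive_in (fun y => Qbar0 y t) (fun y => V c g1 g2 y t) x (V c (Dx X1 g1) (Dx X2 g2) x t).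
Proof.
intros h1 h2 hxt; destruct (Qbar0_sum x t hxt) as [hx [ht hs]].
destruct (W_quad_x g1 g2 x t h1 h2 hx ht hs) as [d [B [hd h]]].
apply (quad_derive_in _ (fun y => c * W g1 g2 y t) x _ (Rabs c * B) d hxt hd).
intros y hy hyd; apply scaled_quad, h; [apply hy|exact hyd].
Qed.

Lemma V_derive_t c g1 g2 x t : growth g1 -> growth g2 -> Qbar0 x t ->
  is_derive_in (fun tau => Qbar0 x tau) (fun tau => V c g1 g2 x tau) t (V c (Dt g1) (Dt g2) x t).
Proof.
intros h1 h2 hxt; destruct (Qbar0_sum x t hxt) as [hx [ht hs]].
destruct (W_quad_t g1 g2 x t h1 h2 hx ht hs) as [d [B [hd h]]].
apply (quad_derive_in _ (fun y => c * W g1 g2 x y) t _ (Rabs c * B) d hxt hd).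
intros y hy hyd; apply scaled_quad, h; [apply hy|exact hyd].
Qed.

(** Each derivative in [x] or [t] only multiplies the amplitudes by a phase, which stays
    within the family. *)
Lemma V_smooth c g1 g2 : growth g1 -> growth g2 -> smooth_Qbar0 (V c g1 g2).
Proof.
intros h1 h2 n; revert g1 g2 h1 h2; induction n as [|n IH]; intros g1 g2 h1 h2.
- split; [apply V_continuous; assumption|exact I].
- split; [apply V_continuous; assumption|].
  exists (V c (Dx X1 g1) (Dx X2 g2)), (V c (Dt g1) (Dt g2)); split; [|split].
  + intros x t hxt; split; [apply V_derive_x|apply V_derive_t]; assumption.
  + apply IH; apply growth_Dx; assumption.
  + apply IH; apply growth_Dt; assumption.
Qed.

Lemma W_derive_x g1 g2 x t : growth g1 -> growth g2 -> 0 < x -> 0 <= t ->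
  is_derive (fun y => W g1 g2 y t) x (W (Dx X1 g1) (Dx X2 g2) x t).
Proof.
intros h1 h2 hx ht.
destruct (W_quad_x g1 g2 x t h1 h2 ltac:(lra) ht ltac:(lra)) as [d [B [hd h]]].
apply (quad_derive _ x _ B (Rmin d x)); [apply Rmin_pos; lra|].
intros y hy; assert (m1 := Rmin_l d x); assert (m2 := Rmin_r d x).
assert (hy' := Rabs_def2 _ _ hy); apply h; lra.
Qed.

Lemma W_derive_t g1 g2 x t : growth g1 -> growth g2 -> 0 <= x -> 0 < t ->
  is_derive (fun tau => W g1 g2 x tau) t (W (Dt g1) (Dt g2) x t).
Proof.
intros h1 h2 hx ht.
destruct (W_quad_t g1 g2 x t h1 h2 hx ltac:(lra) ltac:(lra)) as [d [B [hd h]]].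
apply (quad_derive _ t _ B (Rmin d t)); [apply Rmin_pos; lra|].
intros y hy; assert (m1 := Rmin_l d t); assert (m2 := Rmin_r d t).
assert (hy' := Rabs_def2 _ _ hy); apply h; lra.
Qed.

Fixpoint Dxn (n : nat) (X g : R -> C) : R -> C :=
  match n with 0%nat => g | S m => Dx X (Dxn m X g) end.

Lemma growth_Dxn n X g : growth X -> growth g -> growth (Dxn n X g).
Proof. intros hX hg; induction n as [|n IH]; [exact hg|apply growth_Dx; assumption]. Qed.

Lemma W_Derive_n g1 g2 x t c n : growth g1 -> growth g2 -> 0 < x -> 0 <= t ->
  Derive_n (fun y => c * W g1 g2 y t) n x = c * W (Dxn n X1 g1) (Dxn n X2 g2) x t.
Proof.
intros h1 h2 hx ht; revert x hx; induction n as [|n IH]; intros x hx; [reflexivity|].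
simpl Derive_n.
rewrite (Derive_ext_loc _ (fun y => c * W (Dxn n X1 g1) (Dxn n X2 g2) y t)).
- rewrite Derive_scal; f_equal; apply is_derive_unique.
  apply W_derive_x; auto using growth_Dxn.
- exists (mkposreal x hx); intros y hy; apply IH.
  change (Rabs (y - x) < x) in hy; apply Rabs_def2 in hy; lra.
Qed.

Lemma Derive_nC_RtoC (f : R -> R) n s : Derive_nC (fun r => RtoC (f r)) n s = RtoC (Derive_n f n s).
Proof.
unfold Derive_nC, RtoC; apply Ceq; unfold Re, Im; simpl; [reflexivity|].
destruct n as [|n]; [reflexivity|].
rewrite Derive_n_const; reflexivity.
Qed.

(** The equation holds as soon as each phase satisfies the dispersion relation. *)
Lemma V_equation (alpha beta c : R) g1 g2 x t : growth g1 -> growth g2 ->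
  (forall p, (alpha * X1 p ^ 2 - beta * X1 p ^ 4 = - O p)%C) ->
  (forall p, (alpha * X2 p ^ 2 - beta * X2 p ^ 4 = - O p)%C) ->
  0 < x -> 0 < t ->
  Derive_nC (fun tau => V c g1 g2 x tau) 1 t =
    (alpha * Derive_nC (fun y => V c g1 g2 y t) 2 x
      - beta * Derive_nC (fun y => V c g1 g2 y t) 4 x)%C.
Proof.
intros h1 h2 e1 e2 hx ht; unfold V.
rewrite !Derive_nC_RtoC.
rewrite !W_Derive_n by (auto; lra).
replace (Derive_n (fun r => c * W g1 g2 x r) 1 t) with (c * W (Dt g1) (Dt g2) x t).
2:{ symmetry; simpl; rewrite Derive_scal; f_equal.
    apply is_derive_unique, W_derive_t; auto; lra. }
destruct (J_decays (Dxn 2 X1 g1) (Dxn 2 X2 g2) x t) as [B1 d1];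
  [apply growth_Dxn; assumption|apply growth_Dxn; assumption|lra|lra|lra|].
destruct (J_decays (Dxn 4 X1 g1) (Dxn 4 X2 g2) x t) as [B2 d2];
  [apply growth_Dxn; assumption|apply growth_Dxn; assumption|lra|lra|lra|].
assert (hW : W (Dt g1) (Dt g2) x t =
  alpha * W (Dxn 2 X1 g1) (Dxn 2 X2 g2) x t + - beta * W (Dxn 4 X1 g1) (Dxn 4 X2 g2) x t).
{ unfold W; rewrite <- (HInt_lin _ _ _ _ alpha (- beta) d1 d2); apply HInt_ext.
  intros p _; unfold J.
  replace (term X1 O (Dt g1) x t p + term X2 O (Dt g2) x t p)%C with
    (RtoC alpha * (term X1 O (Dxn 2 X1 g1) x t p + term X2 O (Dxn 2 X2 g2) x t p) +
     RtoC (- beta) * (term X1 O (Dxn 4 X1 g1) x t p + term X2 O (Dxn 4 X2 g2) x t p))%C.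
  - rewrite Im_plus, !Im_mult; unfold RtoC, Re, Im; simpl; ring.
  - unfold term; simpl Dxn; unfold Dt, Dx.
    replace (Cexp (X1 p * x - O p * t) * (- O p * g1 p))%C
      with (Cexp (X1 p * x - O p * t) * ((alpha * X1 p ^ 2 - beta * X1 p ^ 4) * g1 p))%C
      by (rewrite e1; reflexivity).
    replace (Cexp (X2 p * x - O p * t) * (- O p * g2 p))%C
      with (Cexp (X2 p * x - O p * t) * ((alpha * X2 p ^ 2 - beta * X2 p ^ 4) * g2 p))%C
      by (rewrite e2; reflexivity).
    rewrite RtoC_opp; simpl; ring. }
rewrite hW; apply Ceq; unfold Re, Im, RtoC; simpl; ring.
Qed.

Lemma V_is_solution (alpha beta c : R) g1 g2 : growth g1 -> growth g2 ->
  (forall p, (alpha * X1 p ^ 2 - beta * X1 p ^ 4 = - O p)%C) ->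
  (forall p, (alpha * X2 p ^ 2 - beta * X2 p ^ 4 = - O p)%C) ->
  (forall x, 0 < x -> W g1 g2 x 0 = 0) ->
  (forall t, 0 < t -> W g1 g2 0 t = 0) ->
  (forall t, 0 < t -> W (Dx X1 g1) (Dx X2 g2) 0 t = 0) ->
  is_solution alpha beta (V c g1 g2).
Proof.
intros h1 h2 e1 e2 b1 b2 b3; split; [apply V_smooth; assumption|].
split; [intros; apply V_equation; assumption|].
split; [intros x hx; unfold V; rewrite b1, Rmult_0_r by exact hx; reflexivity|].
split; [intros t ht; unfold V; rewrite b2, Rmult_0_r by exact ht; reflexivity|].
intros t ht.
destruct (W_quad_x g1 g2 0 t h1 h2 ltac:(lra) ltac:(lra) ltac:(lra)) as [d [B [hd h]]].
apply (quad_derive_in (fun y => 0 <= y) (fun y => c * W g1 g2 y t) 0 0 (Rabs c * B) d); [lra|exact hd|].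
intros y hy hyd; specialize (h y hy hyd); rewrite b3 in h by exact ht.
apply scaled_quad with (c := c) in h; rewrite Rmult_0_r in h; exact h.
Qed.
End Family.

(** * The uniformizing variable *)

Lemma HInt_zero : HInt (fun _ => 0) = 0.
Proof.
apply is_lim_HInt, (is_lim_ext (fun _ => 0)).
- intros S; rewrite RInt_const; unfold scal; simpl; unfold mult; simpl; ring.
- apply is_lim_const.
Qed.

Lemma entire_opp f : is_entire f -> is_entire (fun z => - f z)%C.
Proof.
intros h; apply (entire_ext (fun z => RtoC (-1) * f z)%C).
- intros z; apply Ceq; unfold Re, Im; simpl; ring.
- apply entire_mult; [apply entire_const|exact h].
Qed.

(** Contains [lam], [mu] and [omega_u] and is stable under products, hence contains
    every amplitude produced by differentiating in [x] and [t]. *)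
Definition tame (g : C -> C) : Prop :=
  is_entire g /\
  exists B n, 0 <= B /\ forall p y, 0 < p -> Cmod (g (p, y)) <= B * exp p ^ n.

Lemma tame_const c : tame (fun _ => c).
Proof.
split; [apply entire_const|exists (Cmod c), 0%nat]; split; [apply Cmod_ge_0|].
intros; simpl; lra.
Qed.

Lemma tame_mult f g : tame f -> tame g -> tame (fun u => f u * g u)%C.
Proof.
intros [ef [B [n [hB hf]]]] [eg [B' [n' [hB' hg]]]]; split; [apply entire_mult; assumption|].
exists (B * B'), (n + n')%nat; split; [apply Rmult_le_pos; assumption|].
intros p y hp; rewrite Cmod_mult, pow_add.
replace (B * B' * (exp p ^ n * exp p ^ n')) with ((B * exp p ^ n) * (B' * exp p ^ n')) by ring.
apply Rmult_le_compat; auto using Cmod_ge_0.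
Qed.

Lemma tame_plus f g : tame f -> tame g -> tame (fun u => f u + g u)%C.
Proof.
intros [ef [B [n [hB hf]]]] [eg [B' [n' [hB' hg]]]]; split; [apply entire_plus; assumption|].
exists (B + B'), (n + n')%nat; split; [lra|].
intros p y hp; apply Rle_trans with (1 := Cmod_triangle _ _).
assert (he : 1 <= exp p) by (rewrite <- exp_0; left; apply exp_increasing; exact hp).
assert (h1 : exp p ^ n <= exp p ^ (n + n')) by (apply Rle_pow; [lra|lia]).
assert (h2 : exp p ^ n' <= exp p ^ (n + n')) by (apply Rle_pow; [lra|lia]).
specialize (hf p y hp); specialize (hg p y hp).
assert (B * exp p ^ n <= B * exp p ^ (n + n')) by (apply Rmult_le_compat_l; assumption).
assert (B' * exp p ^ n' <= B' * exp p ^ (n + n')) by (apply Rmult_le_compat_l; assumption).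
lra.
Qed.

Lemma tame_opp f : tame f -> tame (fun u => - f u)%C.
Proof.
intros [ef [B [n [hB hf]]]]; split; [apply entire_opp, ef|].
exists B, n; split; [exact hB|]; intros p y hp; rewrite Cmod_opp; auto.
Qed.

Ltac tame :=
  lazymatch goal with
  | |- tame (fun u => Cmult (@?f u) (@?g u)) => apply (tame_mult f g); tame
  | |- tame (fun _ => ?a) => apply (tame_const a)
  | |- tame (fun u => ?f u) => change (tame f); tame
  | |- _ => auto with tame
  end.

Create HintDb tame.

Lemma tame_growth g h : tame g -> (forall p, continuous h p) -> growth (fun p => g (p, h p)).
Proof.
intros [eg [B [n [hB hg]]]] hh; split.
- intros p; apply (entire_ccont g eg _ (fun p => (p, h p))), ccont_pair; [apply continuous_id|apply hh].
- exists B, n; split; [exact hB|]; intros p hp; auto.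
Qed.

Section Uniformization.
Variables alpha beta : R.
Hypothesis alpha_gt0 : 0 < alpha.
Hypothesis beta_gt0 : 0 < beta.

Definition kappa : R := sqrt (alpha / beta).

Lemma kappa_gt0 : 0 < kappa.
Proof. apply sqrt_lt_R0, Rdiv_lt_0_compat; assumption. Qed.

Lemma kappa_sqr : kappa * kappa = alpha / beta.
Proof. apply sqrt_sqrt; left; apply Rdiv_lt_0_compat; assumption. Qed.

(** [lam = kappa sinh u] and [mu = kappa cosh u] turn [sqrt (lambda^2 + alpha / beta)]
    into an entire function. *)
Definition lam (u : C) : C := (RtoC (kappa / 2) * (Cexp u - Cexp (- u)))%C.
Definition mu (u : C) : C := (RtoC (kappa / 2) * (Cexp u + Cexp (- u)))%C.
Definition omega_u (u : C) : C := (beta * (lam u * lam u) * (mu u * mu u))%C.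

Lemma Cexp_inv u : (Cexp u * Cexp (- u) = 1)%C.
Proof. rewrite <- Cexp_plus; replace (u + - u)%C with (RtoC 0) by ring; apply Cexp_0. Qed.

Lemma Cmult_RtoC a b : (RtoC a * RtoC b)%C = RtoC (a * b).
Proof. apply Ceq; unfold Re, Im; simpl; ring. Qed.

Lemma mu_sqr u : (mu u * mu u = lam u * lam u + RtoC (alpha / beta))%C.
Proof.
unfold mu, lam; rewrite <- kappa_sqr, <- Cmult_RtoC.
assert (h := Cexp_inv u); set (e := Cexp u) in *; set (f := Cexp (- u)) in *.
assert (hk : RtoC kappa = (RtoC (kappa / 2) + RtoC (kappa / 2))%C).
{ apply Ceq; unfold Re, Im; simpl; field. }
rewrite hk; set (k := RtoC (kappa / 2)).
replace (k * (e + f) * (k * (e + f)))%C with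
  (k * (e - f) * (k * (e - f)) + (k + k) * (k + k) * (e * f))%C by ring.
rewrite h; ring.
Qed.

Lemma lam_pair p y : lam (p, y) = (kappa * (sinh p * cos y), kappa * (cosh p * sin y)).
Proof.
unfold lam, Cexp, sinh, cosh; apply Ceq; unfold Re, Im; simpl;
  rewrite cos_neg, sin_neg; field.
Qed.

Lemma mu_pair p y : mu (p, y) = (kappa * (cosh p * cos y), kappa * (sinh p * sin y)).
Proof.
unfold mu, Cexp, sinh, cosh; apply Ceq; unfold Re, Im; simpl;
  rewrite cos_neg, sin_neg; field.
Qed.

Lemma omega_lam u : omega alpha beta (lam u) = omega_u u.
Proof.
unfold omega_u, omega; rewrite mu_sqr.
replace (RtoC alpha) with (RtoC beta * RtoC (alpha / beta))%C
  by (rewrite Cmult_RtoC; f_equal; field; lra).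
simpl; ring.
Qed.

Lemma Cexp_double u : Cexp (u + u) = (Cexp u * Cexp u)%C.
Proof. apply Cexp_plus. Qed.

(** [omega_u u] is a multiple of [sinh (2 u) ^ 2], that is of [cosh (4 u) - 1]. *)
Lemma Re_om p y : Re (omega_u (p, y)) =
  beta * (alpha / beta) ^ 2 / 16 * (cos (4 * y) * (exp (4 * p) + exp (- (4 * p))) - 2).
Proof.
set (u := (p, y) : C).
assert (e : omega_u u = (RtoC (beta * (alpha / beta) ^ 2 / 16) *
  (Cexp (u + u + (u + u)) + Cexp (- (u + u + (u + u))) - 2))%C).
{ replace (- (u + u + (u + u)))%C with ((- u + - u) + (- u + - u))%C by ring.
  rewrite !Cexp_double; unfold omega_u, lam, mu.
  assert (h := Cexp_inv u); set (a := Cexp u) in *; set (b := Cexp (- u)) in *.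
  replace (beta * (alpha / beta) ^ 2 / 16) with
    (beta * ((kappa / 2) * (kappa / 2)) * ((kappa / 2) * (kappa / 2))).
  2:{ replace ((alpha / beta) ^ 2) with ((kappa * kappa) * (kappa * kappa))
        by (rewrite kappa_sqr; ring); field. }
  rewrite <- !Cmult_RtoC; set (k := RtoC (kappa / 2)).
  replace (beta * (k * (a - b) * (k * (a - b))) * (k * (a + b) * (k * (a + b))))%C with
    (beta * (k * k) * (k * k) * (a * a * (a * a) + b * b * (b * b) - 2 * (a * b) * (a * b)))%C by ring.
  rewrite h; f_equal; ring. }
rewrite e; unfold u, Cexp, Re, Im, RtoC; simpl.
replace (p + p + (p + p)) with (4 * p) by ring; replace (y + y + (y + y)) with (4 * y) by ring.
rewrite cos_neg; ring.
Qed.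

Lemma entire_lam : entire lam mu.
Proof.
assert (hu : forall gamma s l, pder gamma s l -> pder (fun r => - gamma r)%C s (- l)%C).
{ intros g s l [h1 h2]; split.
  - exact (is_derive_opp (V := R_NormedModule) _ _ _ h1).
  - exact (is_derive_opp (V := R_NormedModule) _ _ _ h2). }
split; [|split].
- intros g s l h.
  assert (h1 := pder_mult _ _ _ _ _ (pder_const (RtoC (kappa / 2)) s)
    (pder_plus _ _ _ _ _ (pder_Cexp _ _ _ h) (hu _ _ _ (pder_Cexp _ _ _ (hu _ _ _ h))))).
  apply pder_eq with (1 := h1); unfold mu; ring.
- intros X G x h; apply ccont_mult; [apply ccont_const|].
  apply ccont_plus; [apply ccont_Cexp, h|apply ccont_opp, ccont_Cexp, ccont_opp, h].
- intros X G x h; apply ccont_mult; [apply ccont_const|].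
  apply ccont_plus; [apply ccont_Cexp, h|apply ccont_Cexp, ccont_opp, h].
Qed.

Lemma is_entire_mu : is_entire mu.
Proof.
apply entire_mult; [apply entire_const|].
apply entire_plus; apply entire_Cexp; [apply entire_id|apply entire_opp, entire_id].
Qed.

Lemma Cexp_pair_bound p y : 0 < p ->
  Cmod (Cexp (p, y)) <= exp p /\ Cmod (Cexp (- (p, y))) <= exp p.
Proof.
intros hp; rewrite !Cmod_Cexp; simpl; split; [lra|].
left; apply exp_increasing; lra.
Qed.

Lemma tame_lam : tame lam.
Proof.
assert (hk := kappa_gt0).
split; [eexists; apply entire_lam|exists kappa, 1%nat]; split; [lra|].
intros p y hp; destruct (Cexp_pair_bound p y hp) as [h1 h2].
unfold lam; rewrite Cmod_mult, Cmod_R, Rabs_right by lra.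
assert (h := Cmod_triangle (Cexp (p, y)) (- Cexp (- (p, y)))).
rewrite Cmod_opp in h; unfold Cminus; simpl.
apply Rle_trans with (kappa / 2 * (2 * exp p)); [|right; field].
apply Rmult_le_compat_l; lra.
Qed.
#[local] Hint Resolve tame_lam : tame.

Lemma tame_mu : tame mu.
Proof.
assert (hk := kappa_gt0).
split; [apply is_entire_mu|exists kappa, 1%nat]; split; [lra|].
intros p y hp; destruct (Cexp_pair_bound p y hp) as [h1 h2].
unfold mu; rewrite Cmod_mult, Cmod_R, Rabs_right by lra.
assert (h := Cmod_triangle (Cexp (p, y)) (Cexp (- (p, y)))).
simpl; apply Rle_trans with (kappa / 2 * (2 * exp p)); [|right; field].
apply Rmult_le_compat_l; lra.
Qed.
#[local] Hint Resolve tame_mu : tame.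

Lemma tame_om : tame omega_u.
Proof.
unfold omega_u; tame.
Qed.
#[local] Hint Resolve tame_om : tame.

Definition rate_low (u : C) : C := (Ci * lam u)%C.
Definition rate_up (u : C) : C := (- mu u)%C.

Lemma tame_X1 : tame rate_low.
Proof. apply tame_mult; [apply tame_const|apply tame_lam]. Qed.
#[local] Hint Resolve tame_X1 : tame.

Lemma tame_X2 : tame rate_up.
Proof. apply tame_opp, tame_mu. Qed.
#[local] Hint Resolve tame_X2 : tame.

Lemma Re_X1 p y : Re (rate_low (p, y)) = - (kappa * (cosh p * sin y)).
Proof. unfold rate_low; rewrite lam_pair; unfold Re; simpl; ring. Qed.

Lemma Re_X2 p y : Re (rate_up (p, y)) = - (kappa * (cosh p * cos y)).
Proof. unfold rate_up; rewrite mu_pair; unfold Re; simpl; ring. Qed.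

Lemma dispersion_X1 u : (alpha * rate_low u ^ 2 - beta * rate_low u ^ 4 = - omega_u u)%C.
Proof.
rewrite <- omega_lam; unfold rate_low, omega.
assert (h : (Ci * Ci = - (1))%C) by (apply Ceq; unfold Re, Im; simpl; ring).
replace ((Ci * lam u) ^ 2)%C with ((Ci * Ci) * lam u ^ 2)%C by (simpl; ring).
replace ((Ci * lam u) ^ 4)%C with ((Ci * Ci) * (Ci * Ci) * lam u ^ 4)%C by (simpl; ring).
rewrite h; ring.
Qed.

Lemma dispersion_X2 u : (alpha * rate_up u ^ 2 - beta * rate_up u ^ 4 = - omega_u u)%C.
Proof.
assert (h := mu_sqr u).
replace (rate_up u ^ 2)%C with (mu u * mu u)%C by (unfold rate_up; simpl; ring).
replace (rate_up u ^ 4)%C with ((mu u * mu u) * (mu u * mu u))%C by (unfold rate_up; simpl; ring).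
replace (RtoC alpha) with (RtoC beta * RtoC (alpha / beta))%C
  by (rewrite Cmult_RtoC; f_equal; field; lra).
unfold omega_u; rewrite h; ring.
Qed.

(** * The integrands *)

(** [- lambda (i lambda + rho) rho dlambda / du] on the lower curve, and its counterpart
    on the upper curve carried to the lower one by [u -> conj u + i pi / 2] and
    conjugation. *)
Definition amp_low (u : C) : C := (lam u * (mu u * mu u) * (Ci * lam u - mu u))%C.
Definition amp_up (u : C) : C := (Ci * (lam u * lam u) * mu u * (Ci * lam u - mu u))%C.

Lemma tame_AB_factor : tame (fun u => Ci * lam u - mu u)%C.
Proof. apply (tame_plus rate_low rate_up); [apply tame_X1|apply tame_X2]. Qed.
#[local] Hint Resolve tame_AB_factor : tame.

Lemma tame_A : tame amp_low.
Proof.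
unfold amp_low; apply tame_mult; [tame|apply tame_AB_factor].
Qed.
#[local] Hint Resolve tame_A : tame.

Lemma tame_B : tame amp_up.
Proof.
unfold amp_up; apply tame_mult; [tame|apply tame_AB_factor].
Qed.
#[local] Hint Resolve tame_B : tame.

Definition wave (g1 g2 : C -> C) (x t : R) (u : C) : C :=
  (Cexp (rate_low u * x - omega_u u * t) * g1 u + Cexp (rate_up u * x - omega_u u * t) * g2 u)%C.

Lemma entire_T g1 g2 x t : tame g1 -> tame g2 -> is_entire (wave g1 g2 x t).
Proof.
intros [h1 _] [h2 _].
assert (hX : forall X, tame X -> is_entire (fun u => Cexp (X u * x - omega_u u * t))).
{ intros X [hX _]; apply entire_Cexp.
  apply (entire_plus (fun u => X u * x)%C (fun u => - (omega_u u * t))%C).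
  - apply entire_mult; [exact hX|apply entire_const].
  - apply entire_opp, entire_mult; [apply tame_om|apply entire_const]. }
apply entire_plus; apply entire_mult; auto; apply hX; [apply tame_X1|apply tame_X2].
Qed.

Lemma T_bound g1 g2 d b : tame g1 -> tame g2 -> 0 < d ->
  exists M, 0 <= M /\ forall x t p y : R, 0 < p ->
    Re (rate_low (p, y) * x - omega_u (p, y) * t) <= - (d * exp p) + b ->
    Re (rate_up (p, y) * x - omega_u (p, y) * t) <= - (d * exp p) + b ->
    Cmod (wave g1 g2 x t (p, y)) <= M * exp (- p).
Proof.
intros [_ [B1 [n1 [p1 h1]]]] [_ [B2 [n2 [p2 h2]]]] hd.
destruct (Cexp_growth_bound B1 d b n1 p1 hd) as [M1 [q1 k1]].
destruct (Cexp_growth_bound B2 d b n2 p2 hd) as [M2 [q2 k2]].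
exists (M1 + M2); split; [lra|]; intros x t p y hp e1 e2.
unfold wave; apply Rle_trans with (1 := Cmod_triangle _ _).
specialize (k1 _ _ p e1 (h1 p y hp)); specialize (k2 _ _ p e2 (h2 p y hp)); lra.
Qed.

Lemma Re_phase (X o : C) (x t : R) : Re (X * x - o * t) = x * Re X - t * Re o.
Proof. unfold Re, RtoC; simpl; ring. Qed.

Lemma cosh_ge p : exp p / 2 <= cosh p.
Proof. unfold cosh; assert (h := exp_pos (- p)); lra. Qed.

Definition om0 : R := beta * (alpha / beta) ^ 2 / 16.

Lemma om0_gt0 : 0 < om0.
Proof.
assert (h : 0 < alpha / beta) by (apply Rdiv_lt_0_compat; assumption).
assert (h2 := pow_lt _ 2 h); assert (h3 := Rmult_lt_0_compat _ _ beta_gt0 h2); unfold om0; lra.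
Qed.

(** [exp (- omega t)] decays on the lines of height less than [pi / 8]; at [pi / 12] the
    decisive factor [cos (4 Im u)] is [1 / 2]. *)
Definition eta0 : R := PI / 12.

Lemma eta0_bounds : 0 < eta0 < PI / 8.
Proof. unfold eta0; assert (h := PI_RGT_0); lra. Qed.

Lemma cos_4y_half y : 0 <= y <= eta0 -> / 2 <= cos (4 * y).
Proof.
intros hy; assert (h := PI_RGT_0); unfold eta0 in hy.
rewrite <- Rdiv_1_l, <- cos_PI3; apply cos_decr_1; lra.
Qed.

Lemma Re_om_ge_half p y : 0 < p -> / 2 <= cos (4 * y) ->
  om0 / 2 * exp p - 2 * om0 <= Re (omega_u (p, y)).
Proof.
intros hp hy; rewrite Re_om; fold om0.
assert (h0 := om0_gt0); assert (h1 := exp_pos (- (4 * p))).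
assert (h2 : exp p <= exp (4 * p)) by (left; apply exp_increasing; lra).
assert (h3 := exp_pos p).
assert (/ 2 * exp p <= cos (4 * y) * (exp (4 * p) + exp (- (4 * p)))).
{ apply Rmult_le_compat; lra. }
apply Rle_trans with (om0 * (/ 2 * exp p - 2)); [lra|].
apply Rmult_le_compat_l; lra.
Qed.

Lemma Re_om_ge p y : 0 <= y <= PI / 8 -> - (2 * om0) <= Re (omega_u (p, y)).
Proof.
intros hy; rewrite Re_om; fold om0.
assert (h0 := om0_gt0); assert (h1 := exp_pos (- (4 * p))); assert (h2 := exp_pos (4 * p)).
assert (0 <= cos (4 * y)) by (apply cos_ge_0; assert (h := PI_RGT_0); lra).
apply Rle_trans with (om0 * - 2); [lra|].
apply Rmult_le_compat_l; [lra|].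
assert (0 <= cos (4 * y) * (exp (4 * p) + exp (- (4 * p)))) by (apply Rmult_le_pos; lra); lra.
Qed.

Lemma sin_eta0_gt0 : 0 < sin eta0.
Proof. assert (h := eta0_bounds); assert (h' := PI_RGT_0); apply sin_gt_0; lra. Qed.

Lemma cos_eta0_gt0 : 0 < cos eta0.
Proof. assert (h := eta0_bounds); assert (h' := PI_RGT_0); apply cos_gt_0; lra. Qed.

(** The horizontal line [Im u = eta0]. *)
Definition on_line (g : C -> C) (p : R) : C := g (p, eta0).

Definition line_rate : R := Rmin (kappa * sin eta0 / 2) (Rmin (kappa * cos eta0 / 2) (om0 / 2)).
Definition line_loss : R := 2 * om0.

Lemma line_rate_gt0 : 0 < line_rate.
Proof.
assert (h := kappa_gt0); assert (h1 := sin_eta0_gt0); assert (h2 := cos_eta0_gt0); assert (h3 := om0_gt0).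
unfold line_rate; repeat apply Rmin_pos; try lra.
- assert (0 < kappa * sin eta0) by (apply Rmult_lt_0_compat; assumption); lra.
- assert (0 < kappa * cos eta0) by (apply Rmult_lt_0_compat; assumption); lra.
Qed.

Lemma line_loss_ge0 : 0 <= line_loss.
Proof. assert (h3 := om0_gt0); unfold line_loss; lra. Qed.

Lemma line_rate_le : line_rate <= kappa * sin eta0 / 2 /\ line_rate <= kappa * cos eta0 / 2 /\ line_rate <= om0 / 2.
Proof.
unfold line_rate; split; [apply Rmin_l|split].
- apply Rle_trans with (1 := Rmin_r _ _); apply Rmin_l.
- apply Rle_trans with (1 := Rmin_r _ _); apply Rmin_r.
Qed.

Lemma growth_on_line g : tame g -> growth (on_line g).
Proof. intros h; apply (tame_growth g (fun _ => eta0) h); intros; apply continuous_const. Qed.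

Lemma Re_le_cosh (s p : R) : 0 < s -> - (kappa * (cosh p * s)) <= - (kappa * s / 2 * exp p).
Proof.
intros hs; assert (h := cosh_ge p); assert (hk := kappa_gt0).
assert (kappa * s * (exp p / 2) <= kappa * s * cosh p).
{ apply Rmult_le_compat_l; [|exact h]; apply Rmult_le_pos; lra. }
lra.
Qed.

Lemma Re_rate_low_line p : 0 < p -> Re (on_line rate_low p) <= - (line_rate * exp p) + line_loss.
Proof.
intros _; unfold on_line; rewrite Re_X1.
assert (h := Re_le_cosh (sin eta0) p sin_eta0_gt0); destruct line_rate_le as [h1 _].
assert (h2 := line_loss_ge0); assert (h3 := exp_pos p).
assert (line_rate * exp p <= kappa * sin eta0 / 2 * exp p) by (apply Rmult_le_compat_r; lra); lra.
Qed.

Lemma Re_rate_up_line p : 0 < p -> Re (on_line rate_up p) <= - (line_rate * exp p) + line_loss.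
Proof.
intros _; unfold on_line; rewrite Re_X2.
assert (h := Re_le_cosh (cos eta0) p cos_eta0_gt0); destruct line_rate_le as [_ [h1 _]].
assert (h2 := line_loss_ge0); assert (h3 := exp_pos p).
assert (line_rate * exp p <= kappa * cos eta0 / 2 * exp p) by (apply Rmult_le_compat_r; lra); lra.
Qed.

Lemma Re_omega_line p : 0 < p -> line_rate * exp p - line_loss <= Re (on_line omega_u p).
Proof.
intros hp; unfold on_line; assert (h := eta0_bounds).
assert (h1 := Re_om_ge_half p eta0 hp (cos_4y_half eta0 ltac:(lra))).
destruct line_rate_le as [_ [_ h2]]; assert (h3 := exp_pos p); unfold line_loss.
assert (line_rate * exp p <= om0 / 2 * exp p) by (apply Rmult_le_compat_r; lra); lra.
Qed.

(** With [amp_low] and [amp_up], this is [v] up to the factor [- 2 beta / pi]. *)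
Definition Wc (g1 g2 : C -> C) (x t : R) : R :=
  W (on_line rate_low) (on_line rate_up) (on_line omega_u) (on_line g1) (on_line g2) x t.

Lemma Wc_T g1 g2 x t : Wc g1 g2 x t = HInt (fun p => Im (wave g1 g2 x t (p, eta0))).
Proof. reflexivity. Qed.

Lemma Wc_decays g1 g2 x t : tame g1 -> tame g2 -> 0 <= x -> 0 <= t -> 0 < x + t ->
  exists M, decays (fun p => Im (wave g1 g2 x t (p, eta0))) M.
Proof.
intros h1 h2 hx ht hxt.
exact (J_decays (on_line rate_low) (on_line rate_up) (on_line omega_u) line_rate line_loss line_rate_gt0 line_loss_ge0 (growth_on_line _ tame_X1)
  (growth_on_line _ tame_X2) (growth_on_line _ tame_om) Re_rate_low_line Re_rate_up_line Re_omega_line (on_line g1) (on_line g2) x t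
  (growth_on_line _ h1) (growth_on_line _ h2) hx ht hxt).
Qed.

(** * Shifting contours *)

(** Makes [g du] real along the imaginary axis, where all horizontal lines start. *)
Definition imaginary0 (g : C -> C) : Prop := forall y, Re (g (0, y)) = 0.

Lemma lam_0 y : lam (0, y) = (0, kappa * sin y).
Proof. rewrite lam_pair, sinh_0, cosh_0; apply Ceq; simpl; ring. Qed.

Lemma mu_0 y : mu (0, y) = (kappa * cos y, 0).
Proof. rewrite mu_pair, sinh_0, cosh_0; apply Ceq; simpl; ring. Qed.

Lemma Cexp_real z : Im z = 0 -> Cexp z = RtoC (exp (Re z)).
Proof. intros h; unfold Cexp; rewrite h, sin_0, cos_0; apply Ceq; unfold Re, Im; simpl; ring. Qed.

Lemma T_imaginary0 g1 g2 x t : imaginary0 g1 -> imaginary0 g2 ->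
  forall y, Re (wave g1 g2 x t (0, y)) = 0.
Proof.
intros h1 h2 y; unfold wave.
rewrite !Cexp_real.
- rewrite Re_plus, !Re_mult, h1, h2; unfold RtoC, Re, Im; simpl; ring.
- unfold rate_up, omega_u; rewrite lam_0, mu_0; unfold Im; simpl; ring.
- unfold rate_low, omega_u; rewrite lam_0, mu_0; unfold Im; simpl; ring.
Qed.

Lemma imaginary0_A : imaginary0 amp_low.
Proof. intros y; unfold amp_low; rewrite lam_0, mu_0; unfold Re; simpl; ring. Qed.

Lemma imaginary0_B : imaginary0 amp_up.
Proof. intros y; unfold amp_up; rewrite lam_0, mu_0; unfold Re; simpl; ring. Qed.

Lemma HInt_horizontal g1 g2 (x t c0 c1 d b : R) : tame g1 -> tame g2 ->
  imaginary0 g1 -> imaginary0 g2 -> c0 <= c1 -> 0 < d ->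
  (forall p y, 0 < p -> c0 <= y <= c1 ->
    Re (rate_low (p, y) * x - omega_u (p, y) * t) <= - (d * exp p) + b /\
    Re (rate_up (p, y) * x - omega_u (p, y) * t) <= - (d * exp p) + b) ->
  HInt (fun p => Im (wave g1 g2 x t (p, c1))) = HInt (fun p => Im (wave g1 g2 x t (p, c0))).
Proof.
intros h1 h2 i1 i2 hc hd hre.
destruct (T_bound g1 g2 d b h1 h2 hd) as [M [hM hT]].
assert (hb : forall p y, 0 < p -> c0 <= y <= c1 -> Cmod (wave g1 g2 x t (p, y)) <= M * exp (- p)).
{ intros p y hp hy; destruct (hre p y hp hy); apply hT; assumption. }
assert (he := entire_T g1 g2 x t h1 h2).
assert (hdec : forall y, c0 <= y <= c1 -> decays (fun p => Im (wave g1 g2 x t (p, y))) M).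
{ intros y hy; split.
  - intros p; apply (entire_ccont _ he _ (fun p => (p, y))).
    apply ccont_pair; [apply continuous_id|apply continuous_const].
  - intros p hp; apply Rle_trans with (1 := Im_le_Cmod _); apply hb; assumption. }
assert (e : forall p, Im (wave g1 g2 x t (p, c1) * (1, 0)) = Im (wave g1 g2 x t (p, c1)))
  by (intros p; rewrite Im_mult; unfold Re, Im; simpl; ring).
rewrite <- (HInt_ext _ _ (fun p _ => e p)).
refine (HInt_graph (wave g1 g2 x t) (fun _ => c1) (fun _ => 0) c0 he _ _ M M M (c1 - c0)
  (T_imaginary0 _ _ _ _ i1 i2) (hdec c0 ltac:(lra)) _ _ _).
- intros p; apply (is_derive_const (K := R_AbsRing) (V := R_NormedModule)).
- intros p; apply continuous_const.
- destruct (hdec c1 ltac:(lra)) as [u w]; split.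
  + intros p; eapply continuous_ext; [intros q; symmetry; apply e|apply u].
  + intros p hp; rewrite e; apply w, hp.
- intros p _; rewrite Rabs_right; lra.
- intros p tau hp ht; apply hb; [exact hp|].
  assert (0 <= tau * (c1 - c0)) by (apply Rmult_le_pos; lra).
  assert (tau * (c1 - c0) <= 1 * (c1 - c0)) by (apply Rmult_le_compat_r; lra); lra.
Qed.

(** On the boundary [x = 0], diffusion alone allows the shift to the real axis. *)
Lemma Wc_real_axis g1 g2 t : tame g1 -> tame g2 -> imaginary0 g1 -> imaginary0 g2 -> 0 < t ->
  Wc g1 g2 0 t = HInt (fun p => exp (- t * Re (omega_u (p, 0))) * Im (g1 (p, 0) + g2 (p, 0))).
Proof.
intros h1 h2 i1 i2 ht; rewrite Wc_T.
assert (hc := eta0_bounds); assert (h0 := om0_gt0).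
rewrite (HInt_horizontal g1 g2 0 t 0 eta0 (t * (om0 / 2)) (t * (2 * om0)) h1 h2 i1 i2 ltac:(lra)).
- apply HInt_ext; intros p hp; unfold wave.
  rewrite !Cexp_real.
  + rewrite !Re_phase, !Rmult_0_l, Im_plus, !Im_mult, Im_plus.
    replace (0 - t * Re (omega_u (p, 0))) with (- t * Re (omega_u (p, 0))) by ring.
    unfold RtoC, Re, Im; simpl; ring.
  + unfold rate_up, omega_u; rewrite lam_pair, mu_pair, sin_0, cos_0; unfold Im; simpl; ring.
  + unfold rate_low, omega_u; rewrite lam_pair, mu_pair, sin_0, cos_0; unfold Im; simpl; ring.
- apply Rmult_lt_0_compat; lra.
- intros p y hp hy; rewrite !Re_phase.
  assert (h := Re_om_ge_half p y hp (cos_4y_half y ltac:(lra))).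
  assert (t * (om0 / 2 * exp p - 2 * om0) <= t * Re (omega_u (p, y))) by (apply Rmult_le_compat_l; lra).
  lra.
Qed.

Lemma lam_real p : lam (p, 0) = RtoC (kappa * sinh p).
Proof. rewrite lam_pair, sin_0, cos_0; apply Ceq; unfold Re, Im; simpl; ring. Qed.

Lemma mu_real p : mu (p, 0) = RtoC (kappa * cosh p).
Proof. rewrite mu_pair, sin_0, cos_0; apply Ceq; unfold Re, Im; simpl; ring. Qed.

Lemma Wc_left t : 0 < t -> Wc amp_low amp_up 0 t = 0.
Proof.
intros ht; rewrite Wc_real_axis;
  auto using imaginary0_A, imaginary0_B with tame.
transitivity (HInt (fun _ => 0)); [|apply HInt_zero].
apply HInt_ext; intros p _.
unfold amp_low, amp_up; rewrite lam_real, mu_real; unfold Im; simpl; ring.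
Qed.

(** Both exponentials equal [exp (- omega t)] at [x = 0], and the differentiated
    amplitudes are opposite. *)
Lemma Wc_left_x t : Wc (fun u => rate_low u * amp_low u)%C (fun u => rate_up u * amp_up u)%C 0 t = 0.
Proof.
rewrite Wc_T; transitivity (HInt (fun _ => 0)); [|apply HInt_zero].
apply HInt_ext; intros p _; unfold wave.
replace (rate_low (p, eta0) * 0 - omega_u (p, eta0) * t)%C with (rate_up (p, eta0) * 0 - omega_u (p, eta0) * t)%C by ring.
replace (Cexp (rate_up (p, eta0) * 0 - omega_u (p, eta0) * t) * (rate_low (p, eta0) * amp_low (p, eta0)) +
  Cexp (rate_up (p, eta0) * 0 - omega_u (p, eta0) * t) * (rate_up (p, eta0) * amp_up (p, eta0)))%C with (RtoC 0).
- reflexivity.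
- unfold rate_low, rate_up, amp_low, amp_up; ring.
Qed.

(** On the real axis the second derivative of the amplitudes is
    [- lam^2 mu^2 (lam^2 + mu^2)], up to the factor [i]. *)
Lemma Wc_left_xx t : 0 < t ->
  Wc (fun u => rate_low u * (rate_low u * amp_low u))%C (fun u => rate_up u * (rate_up u * amp_up u))%C 0 t < 0.
Proof.
intros ht.
assert (t1 : tame (fun u => rate_low u * (rate_low u * amp_low u))%C) by tame.
assert (t2 : tame (fun u => rate_up u * (rate_up u * amp_up u))%C) by tame.
assert (i1 : imaginary0 (fun u => rate_low u * (rate_low u * amp_low u))%C).
{ intros y; unfold rate_low, amp_low; rewrite lam_0, mu_0; unfold Re; simpl; ring. }
assert (i2 : imaginary0 (fun u => rate_up u * (rate_up u * amp_up u))%C).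
{ intros y; unfold rate_up, amp_up; rewrite lam_0, mu_0; unfold Re; simpl; ring. }
rewrite Wc_real_axis by assumption.
set (F := fun p => exp (- t * Re (omega_u (p, 0))) *
  Im (rate_low (p, 0) * (rate_low (p, 0) * amp_low (p, 0)) + rate_up (p, 0) * (rate_up (p, 0) * amp_up (p, 0)))).
change (HInt F < 0).
assert (hF : forall p, F p = - (exp (- t * Re (omega_u (p, 0))) *
  ((kappa * sinh p) ^ 2 * (kappa * cosh p) ^ 2 * ((kappa * sinh p) ^ 2 + (kappa * cosh p) ^ 2)))).
{ intros p; unfold F, rate_low, rate_up, amp_low, amp_up; rewrite lam_real, mu_real; unfold Im; simpl; ring. }
assert (hT : forall p, F p = Im (wave (fun u => rate_low u * (rate_low u * amp_low u))%C (fun u => rate_up u * (rate_up u * amp_up u))%C 0 t (p, 0))).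
{ intros p; unfold F, wave; rewrite !Cexp_real.
  - rewrite !Re_phase, !Rmult_0_l.
    replace (0 - t * Re (omega_u (p, 0))) with (- t * Re (omega_u (p, 0))) by ring.
    generalize (rate_low (p, 0) * (rate_low (p, 0) * amp_low (p, 0)))%C (rate_up (p, 0) * (rate_up (p, 0) * amp_up (p, 0)))%C.
    intros a b; rewrite !Im_plus, !Im_mult; unfold RtoC, Re, Im; simpl; ring.
  - unfold rate_up, omega_u; rewrite lam_real, mu_real; unfold Im; simpl; ring.
  - unfold rate_low, omega_u; rewrite lam_real, mu_real; unfold Im; simpl; ring. }
assert (h0 := om0_gt0); assert (hk := kappa_gt0); assert (hc := eta0_bounds).
destruct (T_bound _ _ (t * (om0 / 2)) (t * (2 * om0)) t1 t2) as [M [_ hM]].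
{ apply Rmult_lt_0_compat; lra. }
assert (hd : decays F M).
{ split.
  - intros p; apply (continuous_ext _ F p (fun q => eq_sym (hT q))).
    apply (entire_ccont _ (entire_T _ _ 0 t t1 t2) _ (fun p => (p, 0))).
    apply ccont_pair; [apply continuous_id|apply continuous_const].
  - intros p hp; rewrite hT; apply Rle_trans with (1 := Im_le_Cmod _).
    assert (h := Re_om_ge_half p 0 hp (cos_4y_half 0 ltac:(lra))).
    assert (t * (om0 / 2 * exp p - 2 * om0) <= t * Re (omega_u (p, 0))) by (apply Rmult_le_compat_l; lra).
    apply hM; [exact hp| |]; rewrite Re_phase; lra. }
assert (hn := HInt_pos (fun p => -1 * F p + 0 * F p) _ (decays_lin F F M M (-1) 0 hd hd)).
rewrite (HInt_lin F F M M (-1) 0 hd hd) in hn.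
enough (0 < -1 * HInt F + 0 * HInt F) by lra.
apply hn; intros p hp; rewrite hF.
assert (hs : 0 < sinh p).
{ unfold sinh; assert (exp (- p) < exp p) by (apply exp_increasing; lra); lra. }
assert (hch : 0 < cosh p) by (assert (h := cosh_ge p); assert (h' := exp_pos p); lra).
assert (k1 : 0 < (kappa * sinh p) ^ 2) by (apply pow_lt, Rmult_lt_0_compat; assumption).
assert (k2 : 0 < (kappa * cosh p) ^ 2) by (apply pow_lt, Rmult_lt_0_compat; assumption).
assert (k3 := exp_pos (- t * Re (omega_u (p, 0)))).
assert (0 < exp (- t * Re (omega_u (p, 0))) *
  ((kappa * sinh p) ^ 2 * (kappa * cosh p) ^ 2 * ((kappa * sinh p) ^ 2 + (kappa * cosh p) ^ 2))).
{ apply Rmult_lt_0_compat; [exact k3|]; apply Rmult_lt_0_compat;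
    [apply Rmult_lt_0_compat|apply Rplus_lt_0_compat]; assumption. }
lra.
Qed.

(** * The initial value *)

Lemma lam_reflect p y : lam (p, PI / 2 - y) = (Ci * Cconj (mu (p, y)))%C.
Proof.
rewrite lam_pair, mu_pair, cos_shift, sin_shift; apply Ceq; unfold Re, Im; simpl; ring.
Qed.

Lemma mu_reflect p y : mu (p, PI / 2 - y) = (Ci * Cconj (lam (p, y)))%C.
Proof.
rewrite lam_pair, mu_pair, cos_shift, sin_shift; apply Ceq; unfold Re, Im; simpl; ring.
Qed.

Lemma Im_Cconj z : Im (Cconj z) = - Im z.
Proof. reflexivity. Qed.

Lemma Cexp_conj z : Cexp (Cconj z) = Cconj (Cexp z).
Proof. unfold Cexp, Cconj, Re, Im; simpl; rewrite cos_neg, sin_neg; apply Ceq; simpl; ring. Qed.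

(** The reflection [u -> conj u + i pi / 2] exchanges the two terms. *)
Lemma T_reflect x p y :
  wave amp_low (fun _ => RtoC 0) x 0 (p, PI / 2 - y) = Cconj (wave (fun _ => RtoC 0) amp_up x 0 (p, y)).
Proof.
unfold wave, rate_low, rate_up, amp_low, amp_up; rewrite lam_reflect, mu_reflect.
replace (Ci * (Ci * Cconj (mu (p, y))) * x - omega_u (p, (PI / 2 - y)%R) * 0)%C
  with (Cconj (- mu (p, y) * x - omega_u (p, y) * 0)%C).
- rewrite Cexp_conj.
  set (E := Cexp (- mu (p, y) * x - omega_u (p, y) * 0)).
  apply Ceq; unfold Re, Im; simpl; ring.
- apply Ceq; unfold Re, Im; simpl; ring.
Qed.

(** By [T_reflect] the second term on the line of height [eta0] is, up to sign, the first
    one on the line of height [pi / 2 - eta0]; between these heights [exp (i lam x)]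
    decays, so Cauchy's theorem makes the two cancel. *)
Lemma Wc_initial x : 0 < x -> Wc amp_low amp_up x 0 = 0.
Proof.
intros hx; rewrite Wc_T.
assert (hz : tame (fun _ => RtoC 0)) by apply tame_const.
assert (iz : imaginary0 (fun _ => RtoC 0)) by (intros y; reflexivity).
assert (hc := eta0_bounds); assert (hpi := PI_RGT_0); assert (hk := kappa_gt0); assert (hs := sin_eta0_gt0).
destruct (Wc_decays amp_low (fun _ => RtoC 0) x 0 tame_A hz ltac:(lra) ltac:(lra) ltac:(lra)) as [M1 d1].
destruct (Wc_decays (fun _ => RtoC 0) amp_up x 0 hz tame_B ltac:(lra) ltac:(lra) ltac:(lra)) as [M2 d2].
transitivity (HInt (fun p => 1 * Im (wave amp_low (fun _ => RtoC 0) x 0 (p, eta0)) +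
  1 * Im (wave (fun _ => RtoC 0) amp_up x 0 (p, eta0)))).
{ apply HInt_ext; intros p _; unfold wave.
  rewrite !Im_plus, !Im_mult; unfold RtoC, Re, Im; simpl; ring. }
rewrite (HInt_lin _ _ _ _ 1 1 d1 d2).
assert (e : HInt (fun p => Im (wave amp_low (fun _ => RtoC 0) x 0 (p, PI / 2 - eta0))) =
  HInt (fun p => Im (wave amp_low (fun _ => RtoC 0) x 0 (p, eta0)))).
{ apply (HInt_horizontal amp_low (fun _ => RtoC 0) x 0 eta0 (PI / 2 - eta0) (x * (kappa * sin eta0 / 2)) 0);
    auto using tame_A, imaginary0_A; [lra| |].
  - apply Rmult_lt_0_compat; [lra|]; assert (0 < kappa * sin eta0) by (apply Rmult_lt_0_compat; lra); lra.
  - intros p y hp hy; rewrite !Re_phase, Re_X1, Re_X2, Rmult_0_l, Rminus_0_r, Rplus_0_r, Rminus_0_r.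
    assert (h := Re_le_cosh (sin eta0) p hs); assert (hch := cosh_ge p); assert (hep := exp_pos p).
    assert (s1 : sin eta0 <= sin y) by (apply sin_incr_1; lra).
    assert (s2 : sin eta0 <= cos y) by (rewrite <- sin_shift; apply sin_incr_1; lra).
    assert (hmono : forall s, sin eta0 <= s -> x * - (kappa * (cosh p * s)) <= - (x * (kappa * sin eta0 / 2) * exp p)).
    { intros s hsc.
      assert (cosh p * sin eta0 <= cosh p * s) by (apply Rmult_le_compat_l; lra).
      assert (kappa * (cosh p * sin eta0) <= kappa * (cosh p * s)) by (apply Rmult_le_compat_l; lra).
      replace (- (x * (kappa * sin eta0 / 2) * exp p)) with (x * - (kappa * sin eta0 / 2 * exp p)) by ring.
      apply Rmult_le_compat_l; lra. }
    split; apply hmono; assumption. }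
rewrite <- e.
replace (HInt (fun p => Im (wave (fun _ => RtoC 0) amp_up x 0 (p, eta0)))) with
  (-1 * HInt (fun p => Im (wave amp_low (fun _ => RtoC 0) x 0 (p, PI / 2 - eta0)))); [ring|].
assert (d3 : decays (fun p => Im (wave amp_low (fun _ => RtoC 0) x 0 (p, PI / 2 - eta0))) M2).
{ assert (eq : forall p, Im (wave amp_low (fun _ => RtoC 0) x 0 (p, PI / 2 - eta0)) =
    -1 * Im (wave (fun _ => RtoC 0) amp_up x 0 (p, eta0))).
  { intros p; rewrite T_reflect, Im_Cconj; ring. }
  destruct d2 as [d2 d2']; split.
  - intros p; apply (continuous_ext _ _ p (fun q => eq_sym (eq q))).
    apply (continuous_scal_r (V := R_NormedModule) (-1)), d2.
  - intros p hp; rewrite eq, Rabs_mult.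
    replace (Rabs (-1)) with 1 by (rewrite Rabs_left; lra); rewrite Rmult_1_l; auto. }
assert (e2 := HInt_lin _ _ _ _ (-1) 0 d3 d3); rewrite Rmult_0_l, Rplus_0_r in e2.
rewrite <- e2; apply HInt_ext; intros p _; rewrite T_reflect, Im_Cconj; ring.
Qed.

Definition Vc (s : R) (x t : R) : C := RtoC (s * Wc amp_low amp_up x t).

Lemma Vc_is_solution s : is_solution alpha beta (Vc s).
Proof.
exact (V_is_solution (on_line rate_low) (on_line rate_up) (on_line omega_u) line_rate line_loss line_rate_gt0 line_loss_ge0 (growth_on_line _ tame_X1)
  (growth_on_line _ tame_X2) (growth_on_line _ tame_om) Re_rate_low_line Re_rate_up_line Re_omega_line alpha beta s (on_line amp_low) (on_line amp_up)
  (growth_on_line _ tame_A) (growth_on_line _ tame_B)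
  (fun p => dispersion_X1 (p, eta0)) (fun p => dispersion_X2 (p, eta0))
  Wc_initial Wc_left (fun t _ => Wc_left_x t)).
Qed.

Lemma Wc_quad_x g1 g2 x t : tame g1 -> tame g2 -> 0 <= x -> 0 < t ->
  exists d M, 0 < d /\ forall y, 0 <= y -> Rabs (y - x) < d ->
    Rabs (Wc g1 g2 y t - Wc g1 g2 x t -
      (y - x) * Wc (fun u => rate_low u * g1 u)%C (fun u => rate_up u * g2 u)%C x t) <= M * (y - x) ^ 2.
Proof.
intros h1 h2 hx ht.
exact (W_quad_x (on_line rate_low) (on_line rate_up) (on_line omega_u) line_rate line_loss line_rate_gt0 line_loss_ge0 (growth_on_line _ tame_X1)
  (growth_on_line _ tame_X2) (growth_on_line _ tame_om) Re_rate_low_line Re_rate_up_line Re_omega_line (on_line g1) (on_line g2) x t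
  (growth_on_line _ h1) (growth_on_line _ h2) hx (Rlt_le _ _ ht) (Rplus_le_lt_0_compat _ _ hx ht)).
Qed.

Lemma quad_zero (d M l : R) : 0 < d ->
  (forall h, 0 < h -> h < d -> Rabs (h * l) <= M * h ^ 2) -> l = 0.
Proof.
intros hd h; destruct (Req_dec l 0) as [e|ne]; [exact e|exfalso].
assert (hl := Rabs_pos_lt l ne).
set (M' := Rabs M + 1); assert (hM := Rle_abs M); assert (hM0 := Rabs_pos M).
set (e := Rmin (d / 2) (Rabs l / (2 * M'))).
assert (he : 0 < e) by (apply Rmin_pos; [lra|apply Rdiv_lt_0_compat; unfold M'; lra]).
assert (m1 := Rmin_l (d / 2) (Rabs l / (2 * M')) : e <= _).
assert (m2 := Rmin_r (d / 2) (Rabs l / (2 * M')) : e <= _).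
specialize (h e he ltac:(lra)).
rewrite Rabs_mult, (Rabs_right e) in h by lra.
assert (h2 : e * Rabs l <= e * (M' * e)).
{ apply Rle_trans with (1 := h); replace (M * e ^ 2) with (e * (M * e)) by ring.
  apply Rmult_le_compat_l; [lra|]; apply Rmult_le_compat_r; unfold M'; lra. }
apply Rmult_le_reg_l in h2; [|exact he].
assert (M' * e <= M' * (Rabs l / (2 * M'))) by (apply Rmult_le_compat_l; [unfold M'|]; lra).
replace (M' * (Rabs l / (2 * M'))) with (Rabs l / 2) in H by (field; unfold M'; lra).
lra.
Qed.

(** A solution vanishing in the interior would have zero second derivative at [x = 0],
    against [Wc_left_xx]. *)
Lemma Wc_nonzero : exists x t, 0 < x /\ 0 < t /\ Wc amp_low amp_up x t <> 0.
Proof.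
destruct (Classical_Prop.classic (exists x t, 0 < x /\ 0 < t /\ Wc amp_low amp_up x t <> 0)) as [h|h]; [exact h|].
exfalso.
assert (z0 : forall x, 0 <= x -> Wc amp_low amp_up x 1 = 0).
{ intros x [hx|<-]; [|apply Wc_left, Rlt_0_1].
  destruct (Req_dec (Wc amp_low amp_up x 1) 0) as [e|ne]; [exact e|].
  exfalso; apply h; exists x, 1; split; [exact hx|split; [lra|exact ne]]. }
assert (z1 : forall x, 0 <= x -> Wc (fun u => rate_low u * amp_low u)%C (fun u => rate_up u * amp_up u)%C x 1 = 0).
{ intros x hx; destruct (Wc_quad_x amp_low amp_up x 1 tame_A tame_B hx Rlt_0_1) as [d [M [hd hM]]].
  apply (quad_zero d M _ hd); intros e he hed.
  specialize (hM (x + e) ltac:(lra)); replace (x + e - x) with e in hM by ring.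
  rewrite Rabs_right in hM by lra; specialize (hM hed).
  rewrite !z0 in hM by lra.
  rewrite <- Rabs_Ropp; replace (- (e * _)) with
    (0 - 0 - e * Wc (fun u => rate_low u * amp_low u)%C (fun u => rate_up u * amp_up u)%C x 1) by ring; exact hM. }
assert (t1 : tame (fun u => rate_low u * amp_low u)%C) by tame.
assert (t2 : tame (fun u => rate_up u * amp_up u)%C) by tame.
assert (z2 : Wc (fun u => rate_low u * (rate_low u * amp_low u))%C (fun u => rate_up u * (rate_up u * amp_up u))%C 0 1 = 0).
{ destruct (Wc_quad_x _ _ 0 1 t1 t2 (Rle_refl 0) Rlt_0_1) as [d [M [hd hM]]].
  apply (quad_zero d M _ hd); intros e he hed.
  specialize (hM e ltac:(lra)); rewrite Rminus_0_r, (Rabs_right e) in hM by lra; specialize (hM hed).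
  rewrite !z1 in hM by lra.
  rewrite <- Rabs_Ropp; replace (- (e * _)) with
    (0 - 0 - e * Wc (fun u => rate_low u * (rate_low u * amp_low u))%C (fun u => rate_up u * (rate_up u * amp_up u))%C 0 1) by ring; exact hM. }
assert (h2 := Wc_left_xx 1 Rlt_0_1); lra.
Qed.
End Uniformization.

(** * The lower curve in the [u]-plane *)

(** [Re omega = 0] means that [sinh (2 u)] has argument [pi / 4], that is
    [tan (2 Im u) = tanh (2 Re u)]. *)
Definition tanh2 (p : R) : R := (exp (4 * p) - 1) / (exp (4 * p) + 1).
Definition q (p : R) : R := atan (tanh2 p) / 2.
Definition q' (p : R) : R := (1 - tanh2 p ^ 2) / (1 + tanh2 p ^ 2).

Lemma tanh2_bounds p : -1 < tanh2 p < 1.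
Proof.
unfold tanh2; assert (h := exp_pos (4 * p)); split.
- apply Rmult_lt_reg_r with (exp (4 * p) + 1); [lra|].
  unfold Rdiv; rewrite Rmult_assoc, Rinv_l by lra; lra.
- apply Rmult_lt_reg_r with (exp (4 * p) + 1); [lra|].
  unfold Rdiv; rewrite Rmult_assoc, Rinv_l by lra; lra.
Qed.

Lemma exp_4_ge1 p : 0 <= p -> 1 <= exp (4 * p).
Proof. intros hp; assert (h := exp_ineq1_le (4 * p)); lra. Qed.

Lemma tanh2_ge0 p : 0 <= p -> 0 <= tanh2 p.
Proof. intros hp; assert (h := exp_4_ge1 p hp); apply Rdiv_le_0_compat; lra. Qed.

Lemma q_derive p : is_derive q p (q' p).
Proof.
unfold q, q', tanh2; assert (h := exp_pos (4 * p)).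
set (E := exp (4 * p)) in *.
assert (hy : is_derive (fun p => (exp (4 * p) - 1) / (exp (4 * p) + 1)) p (8 * E / (E + 1) ^ 2)).
{ auto_derive; fold E; [lra|field; lra]. }
assert (ha := is_derive_comp atan _ p _ _ (is_derive_atan _) hy).
assert (hs := is_derive_scal _ p (/ 2) _ ha).
replace ((1 - ((E - 1) / (E + 1)) ^ 2) / (1 + ((E - 1) / (E + 1)) ^ 2)) with
  (/ 2 * scal (8 * E / (E + 1) ^ 2) (/ (1 + ((E - 1) / (E + 1))²))).
- refine (is_derive_ext _ _ _ _ _ hs); intros r; apply Rmult_comm.
- unfold scal; simpl; unfold mult; simpl; unfold Rsqr.
  assert (0 < 1 + ((E - 1) / (E + 1)) * ((E - 1) / (E + 1)))
    by (assert (k := Rle_0_sqr ((E - 1) / (E + 1))); unfold Rsqr in k; lra).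
  field; repeat split; nra.
Qed.

Lemma q'_continuous p : continuous q' p.
Proof.
apply (ex_derive_continuous (V := R_NormedModule)); unfold q', tanh2.
assert (h := exp_pos (4 * p)).
auto_derive; repeat split; try lra.
set (y := (exp (4 * p) + - (1)) * / (exp (4 * p) + 1)).
assert (k := pow2_ge_0 y); simpl in k; lra.
Qed.

Lemma q'_bound p : Rabs (q' p) <= 1.
Proof.
unfold q'; assert (h := tanh2_bounds p).
assert (h1 : 0 <= tanh2 p ^ 2) by apply pow2_ge_0.
assert (h2 : tanh2 p ^ 2 <= 1) by nra.
rewrite Rabs_right.
- apply Rmult_le_reg_r with (1 + tanh2 p ^ 2); [lra|].
  unfold Rdiv; rewrite Rmult_assoc, Rinv_l by lra; lra.
- apply Rle_ge, Rdiv_le_0_compat; lra.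
Qed.

Lemma q_bounds p : 0 <= p -> 0 <= q p <= PI / 8.
Proof.
intros hp; assert (h := tanh2_bounds p); assert (h' := tanh2_ge0 p hp).
assert (a1 : atan (tanh2 p) < PI / 4) by (rewrite <- atan_1; apply atan_increasing; lra).
assert (a0 : 0 <= atan (tanh2 p)).
{ rewrite <- atan_0; destruct h' as [h'|<-]; [left; apply atan_increasing, h'|right; reflexivity]. }
unfold q; lra.
Qed.

Lemma sin_2q p : sin (2 * q p) = tanh2 p * cos (2 * q p).
Proof.
unfold q; replace (2 * (atan (tanh2 p) / 2)) with (atan (tanh2 p)) by field.
rewrite sin_atan, cos_atan; unfold Rdiv; ring.
Qed.

Lemma Re_om_curve alpha beta (ha : 0 < alpha) (hb : 0 < beta) p : Re (omega_u alpha beta (p, q p)) = 0.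
Proof.
rewrite Re_om by assumption; rewrite exp_Ropp.
assert (h := exp_pos (4 * p)).
assert (hs : 0 < 1 + (tanh2 p)²) by (assert (k := Rle_0_sqr (tanh2 p)); lra).
assert (e : cos (4 * q p) = (1 - (tanh2 p)²) / (1 + (tanh2 p)²)).
{ replace (4 * q p) with (2 * (2 * q p)) by ring; rewrite cos_2a, sin_2q.
  unfold q; replace (2 * (atan (tanh2 p) / 2)) with (atan (tanh2 p)) by field.
  rewrite cos_atan.
  assert (hq := sqrt_sqrt (1 + (tanh2 p)²) ltac:(lra)).
  assert (hq0 := sqrt_lt_R0 _ hs); set (r := sqrt (1 + (tanh2 p)²)) in *.
  rewrite <- hq; unfold Rsqr; field; lra. }
rewrite e.
replace ((1 - (tanh2 p)²) / (1 + (tanh2 p)²) * (exp (4 * p) + / exp (4 * p)) - 2) with 0; [ring|].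
unfold tanh2, Rsqr; field; repeat split; nra.
Qed.

(** [sin q] is at least [tanh (2 p) / 4], which is exponentially close to [1 / 4]. *)
Lemma cosh_sin_q_ge p : 0 <= p -> exp p / 8 - / 4 <= cosh p * sin (q p).
Proof.
intros hp; assert (hq := q_bounds p hp); assert (hpi := PI_RGT_0).
assert (hy := tanh2_bounds p); assert (hy0 := tanh2_ge0 p hp).
assert (s0 : 0 <= sin (q p)) by (apply sin_ge_0; lra).
assert (s1 : sin (2 * q p) <= 2 * sin (q p)).
{ rewrite sin_2a; assert (k := COS_bound (q p)).
  assert (sin (q p) * cos (q p) <= sin (q p) * 1) by (apply Rmult_le_compat_l; lra); lra. }
assert (s2 : tanh2 p / 2 <= sin (2 * q p)).
{ unfold q; replace (2 * (atan (tanh2 p) / 2)) with (atan (tanh2 p)) by field.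
  rewrite sin_atan.
  assert (hs : 0 < 1 + (tanh2 p)²) by (assert (k := Rle_0_sqr (tanh2 p)); lra).
  apply Rmult_le_compat_l; [exact hy0|].
  apply Rinv_le_contravar; [apply sqrt_lt_R0, hs|].
  rewrite <- (sqrt_Rsqr 2) by lra; apply sqrt_le_1_alt; unfold Rsqr; nra. }
assert (s3 : 1 - 2 * exp (- p) * exp (- p) <= tanh2 p).
{ assert (h := exp_4_ge1 p hp); assert (he := exp_pos (4 * p)).
  apply Rle_trans with (1 - 2 * exp (- (4 * p))).
  - rewrite Rmult_assoc, <- exp_plus.
    assert (exp (- (4 * p)) <= exp (- p + - p)); [|lra].
    destruct hp as [hp|<-]; [left; apply exp_increasing; lra|right; f_equal; ring].
  - unfold tanh2; rewrite exp_Ropp; set (E := exp (4 * p)) in *.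
    apply Rmult_le_reg_r with (E * (E + 1)); [apply Rmult_lt_0_compat; lra|].
    replace ((1 - 2 * / E) * (E * (E + 1))) with ((E - 2) * (E + 1)) by (field; lra).
    replace ((E - 1) / (E + 1) * (E * (E + 1))) with ((E - 1) * E) by (field; lra).
    nra. }
assert (hc := cosh_ge p); assert (hep := exp_pos p); assert (hem := exp_pos (- p)).
assert (hem1 : exp (- p) <= 1).
{ rewrite <- exp_0; destruct hp as [hp|<-]; [left; apply exp_increasing; lra|right; f_equal; ring]. }
assert (hpm : exp p * exp (- p) = 1) by (rewrite <- exp_plus, <- exp_0; f_equal; ring).
assert (exp p / 2 * sin (q p) <= cosh p * sin (q p)) by (apply Rmult_le_compat_r; assumption).
assert (exp p / 2 * ((1 - 2 * exp (- p) * exp (- p)) / 4) <= exp p / 2 * sin (q p))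
  by (apply Rmult_le_compat_l; lra).
replace (exp p / 2 * ((1 - 2 * exp (- p) * exp (- p)) / 4)) with
  (exp p / 8 - (exp p * exp (- p)) * exp (- p) / 4) in H0 by field.
rewrite hpm in H0; lra.
Qed.

Lemma sin_le_cos y : 0 <= y <= PI / 8 -> 0 <= sin y <= cos y.
Proof.
intros hy; assert (hpi := PI_RGT_0); split; [apply sin_ge_0; lra|].
rewrite <- sin_shift; apply sin_incr_1; lra.
Qed.

(** [tan q <= tanh p], from [tan (2 q) = tanh (2 p)]. *)
Lemma cosh_sin_le_sinh_cos p : 0 <= p -> cosh p * sin (q p) <= sinh p * cos (q p).
Proof.
intros hp; assert (hq := sin_le_cos _ (q_bounds p hp)).
assert (hep := exp_pos p); assert (hem := exp_pos (- p)).
assert (hpm : exp p * exp (- p) = 1) by (rewrite <- exp_plus, <- exp_0; f_equal; ring).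
assert (hle : exp (- p) <= exp p).
{ destruct hp as [hp|<-]; [left; apply exp_increasing; lra|right; f_equal; ring]. }
assert (hsc : sin (q p) * sin (q p) + cos (q p) * cos (q p) = 1)
  by (assert (k := sin2_cos2 (q p)); unfold Rsqr in k; lra).
assert (e4 : exp (4 * p) = exp p * exp p * (exp p * exp p))
  by (rewrite <- !exp_plus; f_equal; ring).
assert (id : 2 * (sinh p * cosh p) * (cos (q p) * cos (q p) - sin (q p) * sin (q p)) =
  (cosh p * cosh p + sinh p * sinh p) * (2 * (sin (q p) * cos (q p)))).
{ assert (h2 := sin_2q p); rewrite sin_2a, cos_2a in h2; unfold tanh2 in h2.
  assert (h4 := exp_pos (4 * p)); rewrite e4 in h2, h4.
  apply (f_equal (fun z => z * (exp p * exp p * (exp p * exp p) + 1))) in h2.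
  replace ((exp p * exp p * (exp p * exp p) - 1) / (exp p * exp p * (exp p * exp p) + 1) *
    (cos (q p) * cos (q p) - sin (q p) * sin (q p)) * (exp p * exp p * (exp p * exp p) + 1))
    with ((exp p * exp p * (exp p * exp p) - 1) * (cos (q p) * cos (q p) - sin (q p) * sin (q p)))
    in h2 by (field; lra).
  unfold sinh, cosh; replace (exp (- p)) with (/ exp p) by (rewrite exp_Ropp; reflexivity).
  set (a := exp p) in *; set (S := sin (q p)) in *; set (Co := cos (q p)) in *.
  apply Rmult_eq_reg_r with (2 * (a * a)); [|nra].
  transitivity ((a * a * (a * a) - 1) * (Co * Co - S * S)); [field; lra|].
  rewrite <- h2; field; lra. }
assert (hsh : 0 <= sinh p) by (unfold sinh; lra).
assert (hch : 0 < cosh p) by (unfold cosh; lra).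
set (sh := sinh p) in *; set (ch := cosh p) in *; set (S := sin (q p)) in *; set (Co := cos (q p)) in *.
assert (hCo : 0 < Co) by nra.
assert (key : ch * Co * (sh * Co - ch * S) = sh * S * (sh * Co + ch * S)) by nra.
apply Rnot_lt_le; intros hlt.
assert (0 < ch * Co) by (apply Rmult_lt_0_compat; assumption).
assert (0 <= sh * S * (sh * Co + ch * S)).
{ apply Rmult_le_pos; [apply Rmult_le_pos; lra|].
  apply Rplus_le_le_0_compat; apply Rmult_le_pos; lra. }
nra.
Qed.

Section Curve.
Variables alpha beta : R.
Hypothesis alpha_gt0 : 0 < alpha.
Hypothesis beta_gt0 : 0 < beta.

Notation kappa := (kappa alpha beta).
Notation om := (omega_u alpha beta).
Notation X1 := (rate_low alpha beta).
Notation X2 := (rate_up alpha beta).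
Notation T := (wave alpha beta).
Notation om0 := (om0 alpha beta).

Definition curve_rate : R := Rmin (sin eta0 / 2) (/ 8).

Lemma curve_rate_gt0 : 0 < curve_rate.
Proof. apply Rmin_pos; [assert (h := sin_eta0_gt0); lra|lra]. Qed.

(** Up to height [pi / 8] the real part of [omega] is bounded below, so the decay in [x]
    survives on the whole region between the curve and the line. *)
Lemma phase_between (x t p y : R) : 0 < x -> 0 <= t -> 0 < p -> 0 <= y <= PI / 8 ->
  (eta0 <= y \/ q p <= y) ->
  Re (X1 (p, y) * x - om (p, y) * t) <= - (x * kappa * curve_rate * exp p) + (x * kappa / 4 + t * (2 * om0)) /\
  Re (X2 (p, y) * x - om (p, y) * t) <= - (x * kappa * curve_rate * exp p) + (x * kappa / 4 + t * (2 * om0)).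
Proof.
intros hx ht hp hy hcq; rewrite !Re_phase, (Re_X1 alpha beta), (Re_X2 alpha beta).
assert (hk := kappa_gt0 alpha beta alpha_gt0 beta_gt0); assert (hpi := PI_RGT_0).
assert (ho := Re_om_ge alpha beta alpha_gt0 beta_gt0 p y hy).
assert (hto : t * - (2 * om0) <= t * Re (om (p, y))) by (apply Rmult_le_compat_l; assumption).
assert (hsc := sin_le_cos y hy).
assert (hd1 := Rmin_l (sin eta0 / 2) (/ 8) : curve_rate <= _); assert (hd2 := Rmin_r (sin eta0 / 2) (/ 8) : curve_rate <= _).
assert (hch := cosh_ge p); assert (hep := exp_pos p); assert (hcb := eta0_bounds).
assert (hs0 := sin_eta0_gt0).
assert (hqb := q_bounds p (Rlt_le _ _ hp)).
assert (hs : curve_rate * exp p - / 4 <= cosh p * sin y).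
{ destruct hcq as [h|h].
  - assert (sin eta0 <= sin y) by (apply sin_incr_1; lra).
    assert (exp p / 2 * sin eta0 <= cosh p * sin y) by (apply Rmult_le_compat; lra).
    assert (curve_rate * exp p <= sin eta0 / 2 * exp p) by (apply Rmult_le_compat_r; lra). lra.
  - assert (sin (q p) <= sin y) by (apply sin_incr_1; lra).
    assert (k := cosh_sin_q_ge p (Rlt_le _ _ hp)).
    assert (cosh p * sin (q p) <= cosh p * sin y) by (apply Rmult_le_compat_l; lra).
    assert (curve_rate * exp p <= / 8 * exp p) by (apply Rmult_le_compat_r; lra). lra. }
assert (hmono : forall s, sin y <= s ->
  x * - (kappa * (cosh p * s)) <= - (x * kappa * curve_rate * exp p) + x * kappa / 4).
{ intros s hs'.
  assert (cosh p * sin y <= cosh p * s) by (apply Rmult_le_compat_l; lra).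
  assert (x * kappa * (curve_rate * exp p - / 4) <= x * kappa * (cosh p * s)).
  { apply Rmult_le_compat_l; [apply Rmult_le_pos; lra|lra]. }
  lra. }
assert (h1 := hmono (sin y) (Rle_refl _)); assert (h2 := hmono (cos y) (proj2 hsc)).
lra.
Qed.

Lemma T_curve_bound (g1 g2 : C -> C) x t : tame g1 -> tame g2 -> 0 < x -> 0 <= t ->
  exists M, 0 <= M /\ forall p y, 0 < p -> 0 <= y <= PI / 8 -> (eta0 <= y \/ q p <= y) ->
    Cmod (T g1 g2 x t (p, y)) <= M * exp (- p).
Proof.
intros h1 h2 hx ht; assert (hk := kappa_gt0 alpha beta alpha_gt0 beta_gt0).
destruct (T_bound alpha beta g1 g2 (x * kappa * curve_rate) (x * kappa / 4 + t * (2 * om0)) h1 h2)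
  as [M [hM h]].
{ repeat apply Rmult_lt_0_compat; auto using curve_rate_gt0. }
exists M; split; [exact hM|]; intros p y hp hy hcq.
destruct (phase_between x t p y hx ht hp hy hcq) as [e1 e2].
apply h; assumption.
Qed.

Lemma Cmod_velocity p : Cmod (1, q' p) <= 2.
Proof.
assert (h := q'_bound p).
replace ((1, q' p) : C) with (RtoC 1 + Ci * RtoC (q' p))%C
  by (apply Ceq; unfold Re, Im; simpl; ring).
apply Rle_trans with (1 := Cmod_triangle _ _); rewrite Cmod_mult, !Cmod_R, Rabs_R1.
replace (Cmod Ci) with 1; [lra|].
unfold Cmod, Ci; simpl; symmetry; replace (0 * (0 * 1) + 1 * (1 * 1)) with 1 by ring; apply sqrt_1.
Qed.

Lemma q_continuous p : continuous q p.
Proof. apply (ex_derive_continuous (V := R_NormedModule)); eexists; apply q_derive. Qed.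

Lemma curve_decays (g1 g2 : C -> C) x t : tame g1 -> tame g2 -> 0 < x -> 0 <= t ->
  exists M, decays (fun p => Im (T g1 g2 x t (p, q p) * (1, q' p))) M /\
    forall p, 0 < p -> Cmod (T g1 g2 x t (p, q p) * (1, q' p)) <= M * exp (- p).
Proof.
intros h1 h2 hx ht; destruct (T_curve_bound g1 g2 x t h1 h2 hx ht) as [M [hM h]].
assert (hb : forall p, 0 < p -> Cmod (T g1 g2 x t (p, q p) * (1, q' p)) <= (M * 2) * exp (- p)).
{ intros p hp; rewrite Cmod_mult.
  replace (M * 2 * exp (- p)) with (M * exp (- p) * 2) by ring.
  apply Rmult_le_compat; auto using Cmod_ge_0, Cmod_velocity.
  apply h; [exact hp|apply q_bounds; lra|right; lra]. }
exists (M * 2); split; [|exact hb]; split.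
- intros p.
  refine (proj2 (ccont_mult _ _ _ (entire_ccont _ (entire_T alpha beta alpha_gt0 beta_gt0 g1 g2 x t h1 h2) _ (fun p => (p, q p)) p _) _)).
  + apply ccont_pair; [apply continuous_id|apply q_continuous].
  + apply ccont_pair; [apply continuous_const|apply q'_continuous].
- intros p hp; apply Rle_trans with (1 := Im_le_Cmod _), hb, hp.
Qed.

Lemma Wc_curve (g1 g2 : C -> C) x t : tame g1 -> tame g2 ->
  imaginary0 g1 -> imaginary0 g2 -> 0 < x -> 0 < t ->
  HInt (fun p => Im (T g1 g2 x t (p, q p) * (1, q' p))) = Wc alpha beta g1 g2 x t.
Proof.
intros h1 h2 i1 i2 hx ht; rewrite Wc_T.
destruct (curve_decays g1 g2 x t h1 h2 hx ltac:(lra)) as [B2 [d2 _]].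
destruct (Wc_decays alpha beta alpha_gt0 beta_gt0 g1 g2 x t h1 h2 ltac:(lra) ltac:(lra) ltac:(lra)) as [B1 d1].
destruct (T_curve_bound g1 g2 x t h1 h2 hx ltac:(lra)) as [M [hM h]].
assert (hcb := eta0_bounds); assert (hpi := PI_4).
apply (HInt_graph (T g1 g2 x t) q q' eta0 (entire_T alpha beta alpha_gt0 beta_gt0 g1 g2 x t h1 h2)
  q_derive q'_continuous M B1 B2 1 (T_imaginary0 alpha beta g1 g2 x t i1 i2) d1 d2).
- intros p hp; assert (hq := q_bounds p (Rlt_le _ _ hp)); apply Rabs_le; lra.
- intros p tau hp htau; assert (hq := q_bounds p (Rlt_le _ _ hp)).
  (* the intermediate height lies between [eta0] and [q p] *)
  destruct (Rle_dec eta0 (q p)) as [hcq|hcq].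
  + assert (0 <= tau * (q p - eta0)) by (apply Rmult_le_pos; lra).
    assert (tau * (q p - eta0) <= 1 * (q p - eta0)) by (apply Rmult_le_compat_r; lra).
    apply h; [exact hp|lra|left; lra].
  + assert (0 <= tau * (eta0 - q p)) by (apply Rmult_le_pos; lra).
    assert (tau * (eta0 - q p) <= 1 * (eta0 - q p)) by (apply Rmult_le_compat_r; lra).
    apply h; [exact hp|lra|right; lra].
Qed.
End Curve.

(** * Symmetric integrals over the whole line *)

Lemma is_RInt_real (f : R -> R) a b : (forall s, continuous f s) -> is_RInt f a b (RInt f a b).
Proof. intros h; apply (RInt_correct (V := R_CompleteNormedModule)), ex_RInt_cont, h. Qed.

Lemma is_RInt_reflect (f g : R -> R) a : a < 0 -> (forall s, continuous f s) ->
  (forall s, 0 < s -> g (- s) = f s) -> is_RInt g a 0 (RInt f 0 (- a)).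
Proof.
intros ha hf hg.
assert (h : is_RInt f (- a) (- 0) (- RInt f 0 (- a))).
{ rewrite Ropp_0; apply (is_RInt_swap (V := R_NormedModule)), is_RInt_real, hf. }
apply (is_RInt_comp_opp (V := R_NormedModule)) in h.
apply (is_RInt_opp (V := R_NormedModule)) in h; unfold opp in h; simpl in h.
rewrite Ropp_involutive in h.
refine (is_RInt_ext (V := R_NormedModule) _ _ _ _ _ _ h).
rewrite Rmin_left, Rmax_right by lra; intros s hs.
rewrite Ropp_involutive, <- hg, Ropp_involutive by lra; reflexivity.
Qed.

Lemma lim_near (f : R -> R) (l e : R) : is_lim f p_infty l -> 0 < e ->
  exists N, forall S, N < S -> Rabs (f S - l) < e.
Proof. intros h he; apply is_lim_spec in h; exact (h (mkposreal e he)). Qed.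

(** The curves are symmetric under [lambda -> - conj lambda], so real parts
    cancel and imaginary parts double. *)
Lemma is_RInt_gen_symmetric (f F : R -> C) (lr li : R) :
  (forall s, ccont F s) ->
  (forall s, 0 < s -> f s = F s) ->
  (forall s, 0 < s -> f (- s) = (- Cconj (F s))%C) ->
  is_lim (fun S => RInt (fun s => Re (F s)) 0 S) p_infty lr ->
  is_lim (fun S => RInt (fun s => Im (F s)) 0 S) p_infty li ->
  @is_RInt_gen C_R_NormedModule f (Rbar_locally m_infty) (Rbar_locally p_infty) ((0, 2 * li) : C).
Proof.
intros hc hp hn hr hi P [eps hP].
assert (he := cond_pos eps).
destruct (lim_near _ _ (eps / 2) hr ltac:(lra)) as [Nr hNr].
destruct (lim_near _ _ (eps / 2) hi ltac:(lra)) as [Ni hNi].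
set (N := Rmax 0 (Rmax Nr Ni)).
assert (n1 : 0 <= N) by apply Rmax_l.
assert (n2 : Nr <= N) by (apply Rle_trans with (2 := Rmax_r _ _); apply Rmax_l).
assert (n3 : Ni <= N) by (apply Rle_trans with (2 := Rmax_r _ _); apply Rmax_r).
apply (Filter_prod _ _ _ (fun a => a < - N) (fun b => N < b)).
- exists (- N); auto.
- exists N; auto.
- intros a b ha hb; simpl.
  assert (cr : forall s, continuous (fun s => Re (F s)) s) by (intros s; apply hc).
  assert (ci : forall s, continuous (fun s => Im (F s)) s) by (intros s; apply hc).
  assert (cr' : forall s, continuous (fun s => - Re (F s)) s)
    by (intros s; apply (continuous_opp (V := R_NormedModule)), cr).
  assert (er : RInt (fun s => - Re (F s)) 0 (- a) = - RInt (fun s => Re (F s)) 0 (- a))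
    by (apply (RInt_opp (V := R_CompleteNormedModule) (fun s => Re (F s))), ex_RInt_cont, cr).
  exists ((RInt (fun s => - Re (F s)) 0 (- a) + RInt (fun s => Re (F s)) 0 b,
    RInt (fun s => Im (F s)) 0 (- a) + RInt (fun s => Im (F s)) 0 b) : C); split.
  + apply (is_RInt_fct_extend_pair (U := R_NormedModule) (V := R_NormedModule)).
    * apply (is_RInt_Chasles (V := R_NormedModule)) with 0.
      -- apply (is_RInt_reflect (fun s => - Re (F s))); [lra|exact cr'|].
         intros s hs; rewrite hn by exact hs; reflexivity.
      -- apply (is_RInt_ext (V := R_NormedModule) (fun s => Re (F s))); [|apply is_RInt_real, cr].
         rewrite Rmin_left, Rmax_right by lra; intros s hs; rewrite hp by lra; reflexivity.
    * apply (is_RInt_Chasles (V := R_NormedModule)) with 0.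
      -- apply (is_RInt_reflect (fun s => Im (F s))); [lra|exact ci|].
         intros s hs; rewrite hn by exact hs; unfold Cconj; simpl; apply Ropp_involutive.
      -- apply (is_RInt_ext (V := R_NormedModule) (fun s => Im (F s))); [|apply is_RInt_real, ci].
         rewrite Rmin_left, Rmax_right by lra; intros s hs; rewrite hp by lra; reflexivity.
  + assert (k1 := hNr (- a) ltac:(lra)); assert (k2 := hNr b ltac:(lra)).
    assert (k3 := hNi (- a) ltac:(lra)); assert (k4 := hNi b ltac:(lra)); cbv beta in k1, k2, k3, k4.
    apply Rabs_def2 in k1, k2, k3, k4.
    apply hP; split.
    * change (Rabs (RInt (fun s => - Re (F s)) 0 (- a) + RInt (fun s => Re (F s)) 0 b - 0) < eps).
      rewrite er; apply Rabs_def1; lra.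
    * change (Rabs (RInt (fun s => Im (F s)) 0 (- a) + RInt (fun s => Im (F s)) 0 b - 2 * li) < eps).
      apply Rabs_def1; lra.
Qed.

(** By the intermediate value theorem every large upper bound is some [g P] with [P]
    large. *)
Lemma lim_substitution (f g g' : R -> R) (M : R) :
  (forall s, continuous f s) -> (forall p, is_derive g p (g' p)) -> (forall p, continuous g' p) ->
  g 0 = 0 -> (forall S, exists N, forall P, N <= P -> S <= g P) ->
  decays (fun p => g' p * f (g p)) M ->
  is_lim (fun S => RInt f 0 S) p_infty (HInt (fun p => g' p * f (g p))).
Proof.
intros hf hg hg' h0 hinf hd.
assert (e : forall P, RInt f 0 (g P) = RInt (fun p => g' p * f (g p)) 0 P).
{ intros P; symmetry; apply (is_RInt_unique (V := R_CompleteNormedModule)).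
  rewrite <- h0 at 2; apply (is_RInt_comp (V := R_CompleteNormedModule) f g g').
  - intros; apply hf.
  - intros; split; [apply hg|apply hg']. }
apply is_lim_spec; intros eps.
destruct (lim_near _ _ eps (HInt_correct _ _ hd) (cond_pos eps)) as [N hN].
set (P0 := N + 1); exists (g P0); intros S hS.
destruct (hinf S) as [N' hN']; set (P1 := Rmax N' P0).
assert (hP1 : S <= g P1) by apply hN', Rmax_l.
assert (hP01 : P0 <= P1) by apply Rmax_r.
destruct (IVT_gen g P0 P1 S) as [P [hP eP]].
- intros p; apply derivable_continuous_pt; exists (g' p); apply is_derive_Reals, hg.
- rewrite Rmin_left, Rmax_right by lra; lra.
- rewrite Rmin_left in hP by lra; rewrite <- eP, e; apply hN; unfold P0 in hP; lra.
Qed.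

(** * The square root on the first quadrant *)

(** Continuous on the whole plane, and equal to [Csqrt] on the closed upper
    half-plane. *)
Definition Sq (z : C) : C := (sqrt ((Cmod z + Re z) / 2), sqrt ((Cmod z - Re z) / 2)).

Lemma Csqrt_Sq z : 0 <= Im z -> Csqrt z = Sq z.
Proof.
intros h; unfold Csqrt, Sq; destruct (Rle_dec 0 (Im z)) as [_|n]; [|contradiction].
rewrite Rmult_1_l; reflexivity.
Qed.

Lemma Csqrt_conj z : 0 < Im z -> Csqrt (Cconj z) = Cconj (Sq z).
Proof.
intros h; unfold Csqrt, Sq; rewrite Cmod_conj.
destruct (Rle_dec 0 (Im (Cconj z))) as [n|_].
- exfalso; revert n; unfold Cconj, Im in *; simpl; lra.
- apply Ceq; unfold Cconj, Re, Im; simpl; ring.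
Qed.

Lemma Cmod_sqr_eq (w : C) : Cmod (w * w) = Re w * Re w + Im w * Im w.
Proof.
rewrite Cmod_mult; unfold Cmod; rewrite sqrt_sqrt; unfold Re, Im; [simpl; ring|].
assert (h1 := pow2_ge_0 (fst w)); assert (h2 := pow2_ge_0 (snd w)); lra.
Qed.

Lemma Sq_sqr w : 0 <= Re w -> 0 <= Im w -> Sq (w * w) = w.
Proof.
intros h1 h2; unfold Sq; rewrite Cmod_sqr_eq, Re_mult.
replace ((Re w * Re w + Im w * Im w + (Re w * Re w - Im w * Im w)) / 2) with (Re w * Re w) by field.
replace ((Re w * Re w + Im w * Im w - (Re w * Re w - Im w * Im w)) / 2) with (Im w * Im w) by field.
rewrite !sqrt_square by assumption; destruct w; reflexivity.
Qed.

Lemma Sq_0 : Sq 0 = 0%C.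
Proof.
replace (RtoC 0) with (RtoC 0 * RtoC 0)%C at 1 by ring.
apply Sq_sqr; unfold Re, Im; simpl; lra.
Qed.

Section Division.
Context {X : UniformSpace}.
Implicit Types (f : X -> C) (x : X).

Lemma ccont_norm2 f x : ccont f x -> continuous (fun y => Re (f y) ^ 2 + Im (f y) ^ 2) x.
Proof.
intros [a b].
apply (continuous_ext (fun y => Re (f y) * Re (f y) + Im (f y) * Im (f y)));
  [intros; simpl; ring|].
apply (continuous_plus (V := R_NormedModule)); apply (continuous_mult (K := R_AbsRing)); assumption.
Qed.

Lemma ccont_Cmod f x : ccont f x -> continuous (fun y => Cmod (f y)) x.
Proof.
intros h; exact (continuous_comp _ sqrt x (ccont_norm2 f x h) (continuous_sqrt _)).
Qed.

Lemma ccont_inv f x : ccont f x -> f x <> 0%C -> ccont (fun y => / f y)%C x.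
Proof.
intros h hne; assert (hn := ccont_norm2 f x h); destruct h as [a b].
assert (hne' : Re (f x) ^ 2 + Im (f x) ^ 2 <> 0).
{ intros e; apply hne, Cmod_eq_0.
  change (sqrt (Re (f x) ^ 2 + Im (f x) ^ 2) = 0); rewrite e; apply sqrt_0. }
assert (hi := continuous_comp _ _ x hn (continuous_Rinv _ hne')).
split.
- exact (continuous_mult (K := R_AbsRing) _ _ _ a hi).
- exact (continuous_mult (K := R_AbsRing) _ _ _ (continuous_opp (V := R_NormedModule) _ _ b) hi).
Qed.

Lemma ccont_Sq f x : ccont f x -> ccont (fun y => Sq (f y)) x.
Proof.
intros h; assert (hm := ccont_Cmod f x h); destruct h as [a b].
assert (hs : forall g : X -> R, continuous g x -> continuous (fun y => sqrt (g y / 2)) x).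
{ intros g hg; refine (continuous_comp (fun y => g y / 2) sqrt x _ (continuous_sqrt _)).
  exact (continuous_mult (K := R_AbsRing) _ _ _ hg (continuous_const _ _)). }
unfold Sq; apply ccont_pair; apply hs.
- exact (continuous_plus (V := R_NormedModule) _ _ _ hm a).
- exact (continuous_minus (V := R_NormedModule) _ _ _ hm a).
Qed.
End Division.

(** * The factor [(exp (- o t) - 1) / o] *)

Definition phi (t : R) (o : C) : C := ((Cexp (- (o * t)) - 1) / o)%C.

Lemma phi_pder (o w : C) t : o <> 0%C ->
  pder (fun r => phi r o * w)%C t (- Cexp (- (o * t)) * w).
Proof.
intros ho.
assert (h := pder_plus _ _ _ _ _ (pder_Cexp_affine (- o) 0 (/ o * w) t) (pder_const (- / o * w) t)).
assert (e : forall r : R, (Cexp (- o * r + 0) * (/ o * w) + - / o * w = phi r o * w)%C).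
{ intros r; unfold phi, Cdiv; replace (- o * r + 0)%C with (- (o * r))%C by ring; ring. }
assert (e2 : (Cexp (- o * t + 0) * (- o * (/ o * w)) + 0 = - Cexp (- (o * t)) * w)%C).
{ replace (- o * t + 0)%C with (- (o * t))%C by ring; field; exact ho. }
apply pder_eq with (2 := e2); destruct h as [a b]; split.
- eapply is_derive_ext; [|exact a]; intros r; cbv beta; rewrite e; reflexivity.
- eapply is_derive_ext; [|exact b]; intros r; cbv beta; rewrite e; reflexivity.
Qed.

Lemma phi_0 t : phi t 0 = 0%C.
Proof.
unfold phi; replace (- (RtoC 0 * t))%C with (RtoC 0) by ring.
rewrite Cexp_0; unfold Cdiv; ring.
Qed.

Lemma Re_neg_time (o : C) (t : R) : Re (- (o * t)) = - t * Re o.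
Proof. unfold Re; simpl; ring. Qed.

Lemma Cmod_oscillation (o : C) (t : R) : Re o = 0 -> Cmod (Cexp (- (o * t))) = 1.
Proof. intros h; rewrite Cmod_Cexp, Re_neg_time, h, Rmult_0_r; apply exp_0. Qed.

(** On the curves the exponential is oscillating, hence the difference quotient
    is bounded by [t] although [o] vanishes. *)
Lemma phi_bound t (o w : C) : Re o = 0 ->
  Rabs (Re (phi t o * w)) <= Rabs t * Cmod w /\ Rabs (Im (phi t o * w)) <= Rabs t * Cmod w.
Proof.
intros ho; destruct (Ceq_dec o 0) as [e|ne].
- rewrite e, phi_0, Cmult_0_l; unfold Re, Im; simpl; rewrite Rabs_R0.
  assert (0 <= Rabs t * Cmod w) by (apply Rmult_le_pos; auto using Rabs_pos, Cmod_ge_0); lra.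
- assert (z : phi 0 o = 0%C).
  { unfold phi; replace (- (o * 0))%C with (RtoC 0) by ring; rewrite Cexp_0; unfold Cdiv; ring. }
  assert (hm : forall r : R, Cmod (- Cexp (- (o * r)) * w) <= Cmod w).
  { intros r; rewrite Cmod_mult, Cmod_opp, Cmod_oscillation by exact ho; lra. }
  split.
  + assert (k := mvt_bound (fun r => Re (phi r o * w)) _ 0 t (Cmod w) (fun r => proj1 (phi_pder o w r ne))
      (fun r _ => Rle_trans _ _ _ (Re_le_Cmod _) (hm r))).
    cbv beta in k; rewrite z, Cmult_0_l in k; change (Re (RtoC 0)) with 0 in k.
    rewrite !Rminus_0_r in k; lra.
  + assert (k := mvt_bound (fun r => Im (phi r o * w)) _ 0 t (Cmod w) (fun r => proj2 (phi_pder o w r ne))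
      (fun r _ => Rle_trans _ _ _ (Im_le_Cmod _) (hm r))).
    cbv beta in k; rewrite z, Cmult_0_l in k; change (Im (RtoC 0)) with 0 in k.
    rewrite !Rminus_0_r in k; lra.
Qed.

(** At a zero of [o] total division gives the value [0], which is also the limit: [w]
    vanishes there and [phi_bound] controls the quotient. *)
Lemma ccont_phi {X : UniformSpace} (t : R) (o w : X -> C) (x : X) :
  ccont o x -> ccont w x -> (forall y, Re (o y) = 0) -> (o x = 0%C -> w x = 0%C) ->
  ccont (fun y => phi t (o y) * w y)%C x.
Proof.
intros ho hw hre hz; destruct (Ceq_dec (o x) 0) as [e|ne].
- assert (hx : (phi t (o x) * w x = 0)%C) by (rewrite (hz e); ring).
  assert (key : forall eps : posreal, locally x (fun y => Rabs t * Cmod (w y) < eps)).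
  { intros eps.
    assert (hc : continuous (fun y => Rabs t * Cmod (w y)) x)
      by (apply (continuous_scal_r (V := R_NormedModule)), ccont_Cmod, hw).
    assert (h0 : Rabs t * Cmod (w x) < eps).
    { rewrite (hz e), Cmod_0, Rmult_0_r; apply cond_pos. }
    exact (hc _ (open_lt eps _ h0)). }
  split; apply filterlim_locally; intros eps; generalize (key eps); apply filter_imp; intros y hy.
  + rewrite hx; destruct (phi_bound t (o y) (w y) (hre y)) as [h _].
    change (Rabs (Re (phi t (o y) * w y) - 0) < eps); rewrite Rminus_0_r; lra.
  + rewrite hx; destruct (phi_bound t (o y) (w y) (hre y)) as [_ h].
    change (Rabs (Im (phi t (o y) * w y) - 0) < eps); rewrite Rminus_0_r; lra.
- apply ccont_mult; [|exact hw]; unfold phi, Cdiv, Cminus; apply ccont_mult.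
  + apply ccont_plus; [|apply ccont_const].
    apply ccont_Cexp, ccont_opp, ccont_mult; [exact ho|apply ccont_const].
  + apply ccont_inv; assumption.
Qed.

(** * Continuously differentiable real functions *)

Definition C1 (f : R -> R) : Prop :=
  exists f', (forall s, is_derive f s (f' s)) /\ (forall s, continuous f' s).

Lemma C1_continuous f : C1 f -> forall s, continuous f s.
Proof.
intros [f' [h _]] s; apply (ex_derive_continuous (V := R_NormedModule)); eexists; apply h.
Qed.

Lemma C1_const a : C1 (fun _ => a).
Proof.
exists (fun _ => 0); split; intros s; [|apply continuous_const].
apply (is_derive_const (K := R_AbsRing) (V := R_NormedModule)).
Qed.

Lemma C1_id : C1 (fun s => s).
Proof.
exists (fun _ => 1); split; intros s; [|apply continuous_const].
apply (is_derive_id (K := R_AbsRing)).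
Qed.

Lemma C1_plus f g : C1 f -> C1 g -> C1 (fun s => f s + g s).
Proof.
intros [f' [f1 f2]] [g' [g1 g2]]; exists (fun s => f' s + g' s); split; intros s.
- exact (is_derive_plus (V := R_NormedModule) _ _ _ _ _ (f1 s) (g1 s)).
- exact (continuous_plus (V := R_NormedModule) _ _ _ (f2 s) (g2 s)).
Qed.

Lemma C1_mult f g : C1 f -> C1 g -> C1 (fun s => f s * g s).
Proof.
intros hf hg; assert (cf := C1_continuous f hf); assert (cg := C1_continuous g hg).
destruct hf as [f' [f1 f2]], hg as [g' [g1 g2]].
exists (fun s => f' s * g s + f s * g' s); split; intros s; [apply is_derive_Rmult; auto|].
apply (continuous_plus (V := R_NormedModule));
  apply (continuous_mult (K := R_AbsRing)); auto.
Qed.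

Lemma C1_inv f : (forall s, 0 < f s) -> C1 f -> C1 (fun s => / f s).
Proof.
intros hp hf; assert (cf := C1_continuous f hf); destruct hf as [f' [f1 f2]].
exists (fun s => - f' s * (/ f s * / f s)); split; intros s.
- assert (h := is_derive_inv f s _ (f1 s) (Rgt_not_eq _ _ (hp s))).
  replace (- f' s * (/ f s * / f s)) with (- f' s / f s ^ 2); [exact h|].
  specialize (hp s); field; lra.
- assert (ci : continuous (fun s => / f s) s)
    by exact (continuous_comp f Rinv s (cf s) (continuous_Rinv _ (Rgt_not_eq _ _ (hp s)))).
  apply (continuous_mult (K := R_AbsRing)).
  + apply (continuous_opp (V := R_NormedModule)), f2.
  + apply (continuous_mult (K := R_AbsRing)); exact ci.
Qed.

Lemma C1_sqrt f : (forall s, 0 < f s) -> C1 f -> C1 (fun s => sqrt (f s)).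
Proof.
intros hp hf; assert (cf := C1_continuous f hf); destruct hf as [f' [f1 f2]].
exists (fun s => f' s * / (2 * sqrt (f s))); split; intros s.
- exact (is_derive_sqrt f s _ (f1 s) (hp s)).
- apply (continuous_mult (K := R_AbsRing)); [apply f2|].
  apply (continuous_comp (fun s => 2 * sqrt (f s)) Rinv).
  + apply (continuous_scal_r (V := R_NormedModule) 2).
    exact (continuous_comp f sqrt s (cf s) (continuous_sqrt _)).
  + apply continuous_Rinv; assert (h := sqrt_lt_R0 _ (hp s)); lra.
Qed.

Lemma C1_ext f g : (forall s, f s = g s) -> C1 f -> C1 g.
Proof.
intros e [f' [f1 f2]]; exists f'; split; [|exact f2].
intros s; exact (is_derive_ext _ _ _ _ e (f1 s)).
Qed.

Lemma derive_even (k h : R -> R) s d : 0 < s ->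
  (forall r, 0 < r -> k r = h r /\ k (- r) = h r) -> is_derive h s d ->
  Derive k s = d /\ Derive k (- s) = - d.
Proof.
intros hs he hd; split; apply is_derive_unique.
- apply (is_derive_ext_loc h); [|exact hd].
  exists (mkposreal s hs); intros y hy; change (Rabs (y - s) < s) in hy.
  apply Rabs_def2 in hy; symmetry; apply he; lra.
- apply (is_derive_ext_loc (fun r => h (- r))).
  + exists (mkposreal s hs); intros y hy; change (Rabs (y - - s) < s) in hy.
    apply Rabs_def2 in hy; rewrite <- (Ropp_involutive y) at 2; symmetry; apply he; lra.
  + replace (- d) with (scal (- 1) d) by (unfold scal; simpl; unfold mult; simpl; ring).
    apply (is_derive_comp h Ropp (- s) d (- 1)); [rewrite Ropp_involutive; exact hd|].
    auto_derive; [exact I|ring].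
Qed.

Lemma entire_mu alpha beta : entire (mu alpha beta) (lam alpha beta).
Proof.
assert (hu : forall gamma s l, pder gamma s l -> pder (fun r => - gamma r)%C s (- l)%C).
{ intros g s l [h1 h2]; split.
  - exact (is_derive_opp (V := R_NormedModule) _ _ _ h1).
  - exact (is_derive_opp (V := R_NormedModule) _ _ _ h2). }
split; [|split].
- intros g s l h.
  assert (h1 := pder_mult _ _ _ _ _ (pder_const (RtoC (kappa alpha beta / 2)) s)
    (pder_plus _ _ _ _ _ (pder_Cexp _ _ _ h) (pder_Cexp _ _ _ (hu _ _ _ h)))).
  apply pder_eq with (1 := h1); unfold lam; ring.
- intros X G x h; apply ccont_mult; [apply ccont_const|].
  apply ccont_plus; [apply ccont_Cexp, h|apply ccont_Cexp, ccont_opp, h].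
- intros X G x h; apply ccont_mult; [apply ccont_const|].
  apply ccont_plus; [apply ccont_Cexp, h|apply ccont_opp, ccont_Cexp, ccont_opp, h].
Qed.

Lemma ccont_ext {X : UniformSpace} (f g : X -> C) x :
  (forall y, f y = g y) -> ccont f x -> ccont g x.
Proof.
intros e [a b]; split.
- refine (continuous_ext _ _ x _ a); intros y; cbv beta; rewrite e; reflexivity.
- refine (continuous_ext _ _ x _ b); intros y; cbv beta; rewrite e; reflexivity.
Qed.

Lemma Cinv_Cconj z : (/ Cconj z = Cconj (/ z))%C.
Proof.
destruct z as [a b]; unfold Cinv, Cconj; simpl.
replace (- b * (- b * 1)) with (b * (b * 1)) by ring.
apply Ceq; unfold Re, Im, Rdiv; simpl; ring.
Qed.

Lemma Cconj_mult z w : Cconj (z * w) = (Cconj z * Cconj w)%C.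
Proof. apply Ceq; unfold Re, Im; simpl; ring. Qed.
Lemma Cconj_plus z w : Cconj (z + w) = (Cconj z + Cconj w)%C.
Proof. apply Ceq; unfold Re, Im; simpl; ring. Qed.
Lemma Cconj_opp z : Cconj (- z) = (- Cconj z)%C.
Proof. apply Ceq; unfold Re, Im; simpl; ring. Qed.
Lemma Cconj_RtoC r : Cconj (RtoC r) = RtoC r.
Proof. apply Ceq; unfold Re, Im; simpl; ring. Qed.
Lemma Cconj_Ci : Cconj Ci = (- Ci)%C.
Proof. apply Ceq; unfold Re, Im; simpl; ring. Qed.
Lemma Cconj_invol z : Cconj (Cconj z) = z.
Proof. apply Ceq; unfold Re, Im; simpl; ring. Qed.
Lemma Ci_sqr : (Ci * Ci = - (1))%C.
Proof. apply Ceq; unfold Re, Im; simpl; ring. Qed.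

Lemma phi_conj t o : phi t (Cconj o) = Cconj (phi t o).
Proof.
unfold phi, Cdiv, Cminus; rewrite Cconj_mult, Cconj_plus, <- Cexp_conj, !Cconj_opp, Cconj_mult, !Cconj_RtoC.
rewrite Cinv_Cconj; reflexivity.
Qed.

Section Contour.
Variables alpha beta : R.
Hypothesis alpha_gt0 : 0 < alpha.
Hypothesis beta_gt0 : 0 < beta.

Notation omega := (omega alpha beta).

Definition root (l : C) : C := Sq (l * l + RtoC (alpha / beta)).

(** [lambda (i lambda + rho) rho exp (i lambda x)], with the principal square root replaced
    by [Sq], which stays continuous across the imaginary axis. *)
Definition weight (x : R) (l : C) : C :=
  (Cexp (Ci * l * x) * (l * (Ci * l - root l) * - root l))%C.

Definition quotient (x t : R) (l : C) : C := (phi t (omega l) * weight x l)%C.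

Lemma omega_factor l : omega l = (beta * (l * l) * (l * l + RtoC (alpha / beta)))%C.
Proof.
unfold Defs.omega; replace (RtoC alpha) with (RtoC beta * RtoC (alpha / beta))%C
  by (rewrite Cmult_RtoC; f_equal; field; lra).
simpl; ring.
Qed.

(** The zeros of [omega] are those of [lambda] and of the root, both factors of the weight;
    this makes the singularities removable. *)
Lemma weight_zero x l : omega l = 0%C -> weight x l = 0%C.
Proof.
rewrite omega_factor; intros h.
destruct (Ceq_dec l 0) as [->|hl]; [unfold weight; ring|].
destruct (Ceq_dec (l * l + RtoC (alpha / beta)) 0) as [e|ne].
- unfold weight, root; rewrite e, Sq_0; ring.
- exfalso; revert h; apply Cmult_neq_0; [apply Cmult_neq_0|exact ne].
  + intros e; apply (f_equal Re) in e; unfold Re in e; simpl in e; lra.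
  + apply Cmult_neq_0; exact hl.
Qed.

Lemma Im_root_arg l : Im (l * l + RtoC (alpha / beta)) = 2 * (Re l * Im l).
Proof. unfold Re, Im; simpl; ring. Qed.

Lemma integrand_rho x t l r : rho alpha beta l = (- r)%C ->
  integrand alpha beta x t l =
    (phi t (omega l) * (Cexp (Ci * l * x) * (l * (Ci * l - r) * - r)))%C.
Proof.
intros e; unfold integrand; rewrite e; unfold phi, Cdiv, Cminus.
rewrite (Cexp_plus (Ci * l * x)); ring.
Qed.

Lemma integrand_ff x t l : 0 <= Re l -> 0 <= Im l -> integrand alpha beta x t l = quotient x t l.
Proof.
intros h1 h2; apply integrand_rho; unfold rho, root.
replace (l ^ 2)%C with (l * l)%C by (simpl; ring).
rewrite Csqrt_Sq; [reflexivity|].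
rewrite Im_root_arg; assert (0 <= Re l * Im l) by (apply Rmult_le_pos; assumption); lra.
Qed.

Lemma omega_reflect l : omega (- Cconj l) = Cconj (omega l).
Proof.
rewrite !omega_factor, !Cconj_mult, Cconj_plus, Cconj_mult, !Cconj_RtoC; ring.
Qed.

Lemma integrand_reflect x t l : 0 < Re l -> 0 < Im l ->
  integrand alpha beta x t (- Cconj l) = (- Cconj (quotient x t l))%C.
Proof.
intros h1 h2; rewrite (integrand_rho x t _ (Cconj (root l))).
- rewrite omega_reflect, phi_conj; unfold quotient, weight, Cminus.
  rewrite !Cconj_mult, Cconj_plus, !Cconj_opp, Cconj_mult, <- Cexp_conj, !Cconj_mult, Cconj_Ci, Cconj_RtoC.
  replace (Ci * - Cconj l * x)%C with (- Ci * Cconj l * x)%C by ring; ring.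
- unfold rho, root; f_equal.
  rewrite <- Csqrt_conj.
  + f_equal; rewrite Cconj_plus, Cconj_mult, Cconj_RtoC; simpl; ring.
  + rewrite Im_root_arg; assert (0 < Re l * Im l) by (apply Rmult_lt_0_compat; assumption); lra.
Qed.

(** * Half of a boundary curve and its parametrization in the [u]-plane *)

Section HalfCurve.
Variables (x t : R) (h h' : R -> R).
Hypothesis h_derive : forall s, is_derive h s (h' s).
Hypothesis h'_cont : forall s, continuous h' s.
Hypothesis h_boundary : forall s, Re (omega (s, h s)) = 0.
Hypothesis h_pos : forall s, 0 < s -> 0 < h s.

Definition pulled (s : R) : C := (quotient x t (s, h s) * (1, h' s))%C.

Lemma ccont_pulled s : ccont pulled s.
Proof.
assert (hl : ccont (fun s => (s, h s)) s).
{ apply ccont_pair; [apply continuous_id|].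
  apply (ex_derive_continuous (V := R_NormedModule)); eexists; apply h_derive. }
assert (ho : ccont (fun s => omega (s, h s)) s).
{ assert (hl2 := ccont_mult _ _ s hl hl).
  apply (ccont_ext _ _ s (fun s => eq_sym (omega_factor (s, h s)))).
  exact (ccont_mult _ _ s (ccont_mult _ _ s (ccont_const (RtoC beta) s) hl2)
    (ccont_plus _ _ s hl2 (ccont_const (RtoC (alpha / beta)) s))). }
apply ccont_mult.
2:{ apply ccont_pair; [apply continuous_const|apply h'_cont]. }
apply (ccont_phi t (fun s => omega (s, h s)) (fun s => weight x (s, h s)) s ho); auto.
- assert (hr : ccont (fun s => root (s, h s)) s)
    by exact (ccont_Sq _ s (ccont_plus _ _ s (ccont_mult _ _ s hl hl) (ccont_const _ s))).
  assert (hil := ccont_mult _ _ s (ccont_const Ci s) hl).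
  exact (ccont_mult _ _ s (ccont_Cexp _ s (ccont_mult _ _ s hil (ccont_const (RtoC x) s)))
    (ccont_mult _ _ s (ccont_mult _ _ s hl (ccont_plus _ _ s hil (ccont_opp _ s hr))) (ccont_opp _ s hr))).
- apply weight_zero.
Qed.

Variables (G G' : R -> C) (M : R).
Hypothesis G_pder : forall p, pder G p (G' p).
Hypothesis G'_cont : forall p, ccont G' p.
Hypothesis G_0 : Re (G 0) = 0.
Hypothesis G_curve : forall p, 0 < p -> 0 < Re (G p) /\ Im (G p) = h (Re (G p)).
Hypothesis G_inf : forall S, exists N, forall P, N <= P -> S <= Re (G P).
Hypothesis G_bound : forall p, 0 < p ->
  Rabs (Re (quotient x t (G p) * G' p)) <= M * exp (- p) /\
  Rabs (Im (quotient x t (G p) * G' p)) <= M * exp (- p).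

(** Both components of the velocity agree because [G] runs along the graph of [h]. *)
Lemma G'_tangent p : 0 < p -> G' p = (RtoC (Re (G' p)) * (1, h' (Re (G p))))%C.
Proof.
intros hp.
assert (e : Im (G' p) = Re (G' p) * h' (Re (G p))).
{ transitivity (Derive (fun r => Im (G r)) p);
    [symmetry; apply is_derive_unique, G_pder|].
  apply is_derive_unique.
  apply (is_derive_ext_loc (fun r => h (Re (G r)))).
  - exists (mkposreal p hp); intros y hy; change (Rabs (y - p) < p) in hy.
    apply Rabs_def2 in hy; symmetry; apply G_curve; lra.
  - exact (is_derive_comp h _ p _ _ (h_derive _) (proj1 (G_pder p))). }
apply Ceq; rewrite ?Re_mult, ?Im_mult; unfold RtoC; unfold Re, Im in *; simpl; [ring|rewrite e; ring].
Qed.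

Lemma pulled_G p : 0 < p ->
  (quotient x t (G p) * G' p)%C = (RtoC (Re (G' p)) * pulled (Re (G p)))%C.
Proof.
intros hp; rewrite (G'_tangent p hp) at 1; unfold pulled.
assert (e : G p = (Re (G p), h (Re (G p)))).
{ rewrite <- (proj2 (G_curve p hp)); destruct (G p); reflexivity. }
rewrite <- e; ring.
Qed.

Lemma Re_scal r (z : C) : Re (RtoC r * z) = r * Re z.
Proof. unfold Re; simpl; ring. Qed.
Lemma Im_scal r (z : C) : Im (RtoC r * z) = r * Im z.
Proof. unfold Im; simpl; ring. Qed.

Lemma half_decays :
  decays (fun p => Re (G' p) * Re (pulled (Re (G p)))) M /\
  decays (fun p => Re (G' p) * Im (pulled (Re (G p)))) M.
Proof.
assert (cR : forall p, continuous (fun p => Re (G p)) p)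
  by (intros p; exact (proj1 (pder_ccont G p _ (G_pder p)))).
split; split.
- intros p; apply (continuous_mult (K := R_AbsRing)); [exact (proj1 (G'_cont p))|].
  exact (continuous_comp _ (fun s => Re (pulled s)) p (cR p) (proj1 (ccont_pulled _))).
- intros p hp; rewrite <- Re_scal, <- pulled_G by exact hp; apply G_bound, hp.
- intros p; apply (continuous_mult (K := R_AbsRing)); [exact (proj1 (G'_cont p))|].
  exact (continuous_comp _ (fun s => Im (pulled s)) p (cR p) (proj2 (ccont_pulled _))).
- intros p hp; rewrite <- Im_scal, <- pulled_G by exact hp; apply G_bound, hp.
Qed.

Definition half_integral : R := HInt (fun p => Re (G' p) * Im (pulled (Re (G p)))).

Lemma half_limits : exists lr : R,
  is_lim (fun S => RInt (fun s => Re (pulled s)) 0 S) p_infty lr /\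
  is_lim (fun S => RInt (fun s => Im (pulled s)) 0 S) p_infty half_integral.
Proof.
destruct half_decays as [d1 d2]; eexists; split.
- apply (lim_substitution (fun s => Re (pulled s)) (fun p => Re (G p)) (fun p => Re (G' p)) M); auto.
  + intros s; exact (proj1 (ccont_pulled s)).
  + intros p; exact (proj1 (G_pder p)).
  + intros p; exact (proj1 (G'_cont p)).
- apply (lim_substitution (fun s => Im (pulled s)) (fun p => Re (G p)) (fun p => Re (G' p)) M); auto.
  + intros s; exact (proj2 (ccont_pulled s)).
  + intros p; exact (proj1 (G_pder p)).
  + intros p; exact (proj1 (G'_cont p)).
Qed.

(** For [s > 0] the pulled back integrand is [pulled s]; for [s < 0] it is given by
    the reflection, because [gamma] is even. *)
Lemma contour_low_gen (gamma : R -> R) :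
  (forall r, 0 < r -> gamma r = h r /\ gamma (- r) = h r) ->
  @is_RInt_gen C_R_NormedModule (pullback (integrand alpha beta x t) (fun s => (s, gamma s)))
    (Rbar_locally m_infty) (Rbar_locally p_infty) ((0, 2 * half_integral) : C).
Proof.
intros he; destruct half_limits as [lr [h1 h2]].
apply (is_RInt_gen_symmetric _ pulled lr half_integral ccont_pulled); [| |exact h1|exact h2].
- intros s hs; destruct (derive_even gamma h s _ hs he (h_derive s)) as [e1 _].
  unfold pullback, pulled, Derive_nC; simpl Derive_n.
  rewrite integrand_ff; unfold Re, Im; simpl fst; simpl snd; [|lra|].
  + rewrite (proj1 (he s hs)); do 2 f_equal.
    * apply is_derive_unique, (is_derive_id (K := R_AbsRing)).
    * exact e1.
  + rewrite (proj1 (he s hs)); left; auto.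
- intros s hs; destruct (derive_even gamma h s _ hs he (h_derive s)) as [_ e2].
  unfold pullback, pulled, Derive_nC; simpl Derive_n.
  replace ((- s, gamma (- s)) : C) with (- Cconj (s, h s))%C.
  2:{ rewrite (proj2 (he s hs)); apply Ceq; unfold Re, Im; simpl; ring. }
  rewrite integrand_reflect; [|exact hs|apply h_pos, hs].
  rewrite Cconj_mult; unfold Re, Im; simpl fst; simpl snd.
  replace (Derive (fun x0 : R => x0) (- s)) with 1
    by (symmetry; apply is_derive_unique, (is_derive_id (K := R_AbsRing))).
  replace (Derive (fun x0 : R => gamma x0) (- s)) with (- h' s) by (symmetry; exact e2).
  unfold Cconj at 3; simpl; ring.
Qed.

(** The reversed orientation puts the left half of the curve at [s > 0], where the
    reflection turns [pulled s] into its conjugate. *)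
Lemma contour_up_gen (gamma : R -> R) :
  (forall r, 0 < r -> gamma r = h r /\ gamma (- r) = h r) ->
  @is_RInt_gen C_R_NormedModule (pullback (integrand alpha beta x t) (fun s => (- s, gamma (- s))))
    (Rbar_locally m_infty) (Rbar_locally p_infty) ((0, 2 * - half_integral) : C).
Proof.
intros he; destruct half_limits as [lr [h1 h2]].
assert (he' : forall r, 0 < r -> gamma (- r) = h r /\ gamma (- - r) = h r).
{ intros r hr; rewrite Ropp_involutive; destruct (he r hr); split; assumption. }
assert (eid : forall s, Derive (fun r => - r) s = - (1)).
{ intros s; apply is_derive_unique; auto_derive; [exact I|ring]. }
apply (is_RInt_gen_symmetric _ (fun s => Cconj (pulled s)) lr (- half_integral)).
- intros s; destruct (ccont_pulled s) as [a b]; split; [exact a|].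
  exact (continuous_opp (V := R_NormedModule) _ _ b).
- intros s hs; destruct (derive_even (fun r => gamma (- r)) h s _ hs he' (h_derive s)) as [e1 _].
  unfold pullback, pulled, Derive_nC; simpl Derive_n.
  replace ((- s, gamma (- s)) : C) with (- Cconj (s, h s))%C.
  2:{ rewrite (proj2 (he s hs)); apply Ceq; unfold Re, Im; simpl; ring. }
  rewrite integrand_reflect; [|exact hs|apply h_pos, hs].
  rewrite Cconj_mult; unfold Re, Im; simpl fst; simpl snd.
  replace (Derive (fun x0 : R => - x0) s) with (- (1)) by (symmetry; apply eid).
  replace (Derive (fun x0 : R => gamma (- x0)) s) with (h' s) by (symmetry; exact e1).
  replace (Cconj (1, h' s)) with (- (((- (1))%R, h' s) : C))%C; [ring|].
  apply Ceq; unfold Re, Im; simpl; ring.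
- intros s hs; destruct (derive_even (fun r => gamma (- r)) h s _ hs he' (h_derive s)) as [_ e2].
  rewrite Cconj_invol; unfold pullback, pulled, Derive_nC; simpl Derive_n.
  rewrite Ropp_involutive, (proj1 (he s hs)), integrand_ff; [|unfold Re; simpl; lra|left; apply h_pos, hs].
  unfold Re, Im; simpl fst; simpl snd.
  replace (Derive (fun x0 : R => - x0) (- s)) with (- (1)) by (symmetry; apply eid).
  replace (Derive (fun x0 : R => gamma (- x0)) (- s)) with (- h' s) by (symmetry; exact e2).
  replace ((- (1), - h' s) : C) with (- ((1, h' s) : C))%C; [ring|].
  apply Ceq; unfold Re, Im; simpl; ring.
- exact h1.
- apply (is_lim_ext (fun S => - RInt (fun s => Im (pulled s)) 0 S)).
  + intros S; symmetry; apply (RInt_opp (V := R_CompleteNormedModule) (fun s => Im (pulled s))).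
    apply ex_RInt_cont; intros s; exact (proj2 (ccont_pulled s)).
  + exact (is_lim_opp _ p_infty half_integral h2).
Qed.
End HalfCurve.
End Contour.

Lemma reflected_product (P E M L V : C) :
  (P * (E * (Ci * M * (Ci * (Ci * M) - Ci * L) * - (Ci * L))) * (Ci * (L * V)) =
   - (P * (E * (- Ci * (L * L) * M * (- Ci * L - M)) * V)))%C.
Proof.
transitivity (P * E * M * (L * L) * V *
  ((Ci * Ci) * (Ci * Ci) * L - (Ci * Ci) * (Ci * Ci) * Ci * M))%C; [ring|].
transitivity (P * E * M * (L * L) * V * (- (Ci * Ci) * L - Ci * M))%C; [rewrite Ci_sqr; ring|ring].
Qed.

Lemma exp_unbounded (k b S : R) : 0 < k ->
  exists N, 0 <= N /\ forall P, N <= P -> S <= k * (exp P / 8 - b).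
Proof.
intros hk; exists (Rmax 0 (8 * (S / k + b))); split; [apply Rmax_l|]; intros P hP.
assert (h := Rmax_r 0 (8 * (S / k + b))); assert (he := exp_ineq1_le P).
replace S with (k * (S / k)) by (field; lra).
apply Rmult_le_compat_l; lra.
Qed.

Section Assembly.
Variables alpha beta : R.
Hypothesis alpha_gt0 : 0 < alpha.
Hypothesis beta_gt0 : 0 < beta.

Notation omega := (omega alpha beta).
Notation kappa := (kappa alpha beta).
Notation lam := (lam alpha beta).
Notation mu := (mu alpha beta).
Notation om := (omega_u alpha beta).
Notation X1 := (rate_low alpha beta).
Notation X2 := (rate_up alpha beta).
Notation T := (wave alpha beta).
Notation A := (amp_low alpha beta).
Notation B := (amp_up alpha beta).
Notation ff := (quotient alpha beta).

(** * Smoothness of the two boundary curves *)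

(** The diagonal separates the two curves. *)
Lemma height_cases s y : 0 < s -> 0 <= y -> Re (omega (s, y)) = 0 ->
  (y <= s -> y = height_low alpha beta s) /\ (s <= y -> y = height_up alpha beta s).
Proof.
intros hs hy h0; destruct (heights alpha beta alpha_gt0 beta_gt0 s) as [hL [hLH hE]].
set (L := height_low alpha beta s) in *; set (H := height_up alpha beta s) in *.
assert (hs4 : 0 < s ^ 4) by (apply pow_lt; exact hs).
(* on the diagonal [y = s] the real part of [omega] is strictly negative *)
assert (hd : (s ^ 2 - L ^ 2) * (s ^ 2 - H ^ 2) < 0).
{ assert (e := hE s); rewrite Re_omega in e.
  apply Rmult_lt_reg_l with beta; [exact beta_gt0|]; rewrite <- e, Rmult_0_r.
  replace (alpha * (s ^ 2 - s ^ 2) + beta * (s ^ 4 - 6 * s ^ 2 * s ^ 2 + s ^ 4))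
    with (- (4 * (beta * s ^ 4))) by ring.
  assert (0 < beta * s ^ 4) by (apply Rmult_lt_0_compat; assumption); lra. }
assert (hLs : L < s /\ s < H).
{ assert (L ^ 2 < H ^ 2) by nra.
  split; apply Rnot_le_lt; intros c'; [assert (s ^ 2 <= L ^ 2) by nra|assert (H ^ 2 <= s ^ 2) by nra]; nra. }
rewrite hE in h0; apply Rmult_integral in h0; destruct h0 as [h0|h0]; [lra|].
apply Rmult_integral in h0.
assert (hyLH : y = L \/ y = H).
{ destruct h0 as [h0|h0]; [left|right].
  - assert (e : (y - L) * (y + L) = 0) by (rewrite <- h0; ring).
    apply Rmult_integral in e; destruct e; lra.
  - assert (e : (y - H) * (y + H) = 0) by (rewrite <- h0; ring).
    apply Rmult_integral in e; destruct e; lra. }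
destruct hyLH; split; intros; lra.
Qed.

Lemma discr_gt0 s : 0 < discr alpha beta s.
Proof.
unfold discr; assert (h2 := pow2_ge_0 s); assert (h4 := pow2_ge_0 (s ^ 2)).
assert (h0 : 0 < alpha ^ 2) by (apply pow_lt; exact alpha_gt0).
assert (h1 : 0 < alpha * beta) by (apply Rmult_lt_0_compat; assumption).
assert (0 <= alpha * beta * s ^ 2) by (apply Rmult_le_pos; lra).
assert (0 <= beta ^ 2 * (s ^ 2) ^ 2) by (apply Rmult_le_pos; [apply pow2_ge_0|assumption]).
replace (s ^ 4) with ((s ^ 2) ^ 2) by ring; lra.
Qed.

Lemma trace_gt0 s : 0 < alpha + 6 * beta * s ^ 2.
Proof.
assert (0 <= beta * s ^ 2) by (apply Rmult_le_pos; [lra|apply pow2_ge_0]); lra.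
Qed.

(** [s * slope s] continues the right half of the lower curve smoothly through its
    corner at [0]. *)
Definition slope (s : R) : R :=
  sqrt (2 * (alpha + beta * s ^ 2) * / (alpha + 6 * beta * s ^ 2 + sqrt (discr alpha beta s))).
Definition height_low_odd (s : R) : R := s * slope s.

Lemma slope_arg_gt0 s :
  0 < 2 * (alpha + beta * s ^ 2) * / (alpha + 6 * beta * s ^ 2 + sqrt (discr alpha beta s)).
Proof.
assert (h := sqrt_lt_R0 _ (discr_gt0 s)); assert (h' := trace_gt0 s).
assert (0 <= beta * s ^ 2) by (apply Rmult_le_pos; [lra|apply pow2_ge_0]).
apply Rmult_lt_0_compat; [lra|apply Rinv_0_lt_compat; lra].
Qed.

Lemma C1_poly (a b d : R) : C1 (fun s => a + b * s ^ 2 + d * s ^ 4).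
Proof.
apply (C1_ext (fun s => a + b * (s * s) + d * ((s * s) * (s * s)))); [intros s; ring|].
assert (h2 := C1_mult _ _ C1_id C1_id).
exact (C1_plus _ _ (C1_plus _ _ (C1_const a) (C1_mult _ _ (C1_const b) h2))
  (C1_mult _ _ (C1_const d) (C1_mult _ _ h2 h2))).
Qed.

Lemma C1_sqrt_discr : C1 (fun s => sqrt (discr alpha beta s)).
Proof.
apply C1_sqrt; [exact discr_gt0|].
exact (C1_poly (alpha ^ 2) (8 * alpha * beta) (32 * beta ^ 2)).
Qed.

Lemma C1_poly2 (a b : R) : C1 (fun s => a + b * s ^ 2).
Proof.
apply (C1_ext (fun s => a + b * s ^ 2 + 0 * s ^ 4)); [intros s; ring|apply C1_poly].
Qed.

Lemma C1_height_low_odd : C1 height_low_odd.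
Proof.
apply C1_mult; [exact C1_id|].
apply C1_sqrt; [exact slope_arg_gt0|].
apply C1_mult; [exact (C1_mult _ _ (C1_const 2) (C1_poly2 alpha beta))|].
apply C1_inv.
- intros s; assert (h := sqrt_lt_R0 _ (discr_gt0 s)); assert (h' := trace_gt0 s); lra.
- exact (C1_plus _ _ (C1_poly2 alpha (6 * beta)) C1_sqrt_discr).
Qed.

Lemma C1_height_up : C1 (height_up alpha beta).
Proof.
apply C1_sqrt.
- intros s; assert (h := sqrt_lt_R0 _ (discr_gt0 s)); assert (h' := trace_gt0 s).
  apply Rdiv_lt_0_compat; lra.
- exact (C1_mult _ _ (C1_plus _ _ (C1_poly2 alpha (6 * beta)) C1_sqrt_discr) (C1_const (/ (2 * beta)))).
Qed.

Lemma height_low_sqr s :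
  (alpha + 6 * beta * s ^ 2 - sqrt (discr alpha beta s)) / (2 * beta) = height_low_odd s ^ 2.
Proof.
unfold height_low_odd; rewrite Rpow_mult_distr; unfold slope.
rewrite pow2_sqrt by (left; apply slope_arg_gt0).
assert (h := sqrt_lt_R0 _ (discr_gt0 s)); assert (h' := trace_gt0 s).
assert (e := sqrt_sqrt (discr alpha beta s) (Rlt_le _ _ (discr_gt0 s))).
set (r := sqrt (discr alpha beta s)) in *; set (w := alpha + 6 * beta * s ^ 2) in *.
apply Rmult_eq_reg_r with (2 * beta * (w + r)); [|apply Rmult_integral_contrapositive; lra].
replace ((w - r) / (2 * beta) * (2 * beta * (w + r))) with (w * w - r * r) by (field; lra).
rewrite e; unfold w, discr; field; fold w; lra.
Qed.

Lemma height_low_abs s : height_low alpha beta s = Rabs (height_low_odd s).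
Proof.
unfold height_low; rewrite height_low_sqr, <- sqrt_Rsqr_abs; f_equal; unfold Rsqr; ring.
Qed.

Lemma slope_gt0 s : 0 < slope s.
Proof. apply sqrt_lt_R0, slope_arg_gt0. Qed.

Lemma height_low_even r : 0 < r ->
  height_low alpha beta r = height_low_odd r /\ height_low alpha beta (- r) = height_low_odd r.
Proof.
intros hr; rewrite !height_low_abs; unfold height_low_odd.
assert (e : slope (- r) = slope r).
{ unfold slope, discr; replace ((- r) ^ 2) with (r ^ 2) by ring.
  replace ((- r) ^ 4) with (r ^ 4) by ring; reflexivity. }
assert (h := slope_gt0 r); assert (0 < r * slope r) by (apply Rmult_lt_0_compat; assumption).
split; [apply Rabs_right; lra|].
rewrite e, Rabs_left; lra.
Qed.

Lemma height_up_even r : 0 < r ->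
  height_up alpha beta r = height_up alpha beta r /\ height_up alpha beta (- r) = height_up alpha beta r.
Proof.
intros _; split; [reflexivity|].
unfold height_up, discr; replace ((- r) ^ 2) with (r ^ 2) by ring.
replace ((- r) ^ 4) with (r ^ 4) by ring; reflexivity.
Qed.

Lemma low_boundary s : Re (omega (s, height_low_odd s)) = 0.
Proof.
destruct (heights alpha beta alpha_gt0 beta_gt0 s) as [_ [_ hE]]; rewrite hE, height_low_abs, pow2_abs; ring.
Qed.

Lemma up_boundary s : Re (omega (s, height_up alpha beta s)) = 0.
Proof.
destruct (heights alpha beta alpha_gt0 beta_gt0 s) as [_ [_ hE]]; rewrite hE; ring.
Qed.

Lemma low_pos s : 0 < s -> 0 < height_low_odd s.
Proof. intros hs; apply Rmult_lt_0_compat; [exact hs|apply slope_gt0]. Qed.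

Lemma up_pos s : 0 < s -> 0 < height_up alpha beta s.
Proof. intros _; destruct (heights alpha beta alpha_gt0 beta_gt0 s) as [h1 [h2 _]]; lra. Qed.

(** * Parametrization of the boundary curves by [u] *)

Notation u p := ((p, q p) : C).
Notation vel p := ((1, q' p) : C).

Definition G_low (p : R) : C := lam (u p).
Definition dG_low (p : R) : C := (mu (u p) * vel p)%C.
(** The point [lam (conj u + i pi / 2)]. *)
Definition G_up (p : R) : C := (Ci * Cconj (mu (u p)))%C.
Definition dG_up (p : R) : C := (Ci * Cconj (lam (u p) * vel p))%C.

Lemma u_pder p : pder (fun p => u p) p (vel p).
Proof. apply pder_pair; [apply (is_derive_id (K := R_AbsRing))|apply q_derive]. Qed.

Lemma u_ccont p : ccont (fun p => u p) p.
Proof. exact (pder_ccont _ _ _ (u_pder p)). Qed.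

Lemma vel_ccont p : ccont (fun p => vel p) p.
Proof. apply ccont_pair; [apply continuous_const|apply q'_continuous]. Qed.

Lemma ccont_conj {X : UniformSpace} (f : X -> C) x : ccont f x -> ccont (fun y => Cconj (f y)) x.
Proof. intros [a b]; split; [exact a|exact (continuous_opp (V := R_NormedModule) _ _ b)]. Qed.

Lemma G_low_pder p : pder G_low p (dG_low p).
Proof. exact (proj1 (entire_lam alpha beta) _ _ _ (u_pder p)). Qed.

Lemma G_up_pder p : pder G_up p (dG_up p).
Proof.
destruct (proj1 (entire_mu alpha beta) _ _ _ (u_pder p)) as [a b].
assert (h : pder (fun r => Cconj (mu (u r))) p (Cconj (lam (u p) * vel p))).
{ split; [exact a|exact (is_derive_opp (V := R_NormedModule) _ _ _ b)]. }
apply (pder_eq _ _ _ _ (pder_mult _ _ _ _ _ (pder_const Ci p) h)); unfold dG_up; ring.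
Qed.

Lemma dG_low_ccont p : ccont dG_low p.
Proof.
exact (ccont_mult _ _ p (entire_ccont _ (is_entire_mu alpha beta) _ _ p (u_ccont p)) (vel_ccont p)).
Qed.

Lemma dG_up_ccont p : ccont dG_up p.
Proof.
apply (ccont_mult _ _ p (ccont_const Ci p)).
apply (ccont_conj _ p).
exact (ccont_mult _ _ p (proj2 (proj2 (entire_mu alpha beta)) _ _ p (u_ccont p)) (vel_ccont p)).
Qed.

Lemma G_low_pair p : G_low p = (kappa * (sinh p * cos (q p)), kappa * (cosh p * sin (q p))).
Proof. apply lam_pair. Qed.

Lemma G_up_pair p : G_up p = (kappa * (sinh p * sin (q p)), kappa * (cosh p * cos (q p))).
Proof. unfold G_up; rewrite mu_pair; apply Ceq; unfold Re, Im; simpl; ring. Qed.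

Lemma omega_G_up p : omega (G_up p) = Cconj (om (u p)).
Proof.
rewrite omega_factor by assumption; unfold G_up, Defs.omega, om.
assert (h := mu_sqr alpha beta alpha_gt0 beta_gt0 (u p)).
assert (hc : (Cconj (mu (u p)) * Cconj (mu (u p)) =
  Cconj (lam (u p)) * Cconj (lam (u p)) + RtoC (alpha / beta))%C).
{ rewrite <- !Cconj_mult, h, Cconj_plus, Cconj_RtoC; reflexivity. }
rewrite !Cconj_mult, Cconj_RtoC.
replace (Ci * Cconj (mu (u p)) * (Ci * Cconj (mu (u p))))%C with
  ((Ci * Ci) * (Cconj (mu (u p)) * Cconj (mu (u p))))%C by ring.
rewrite Ci_sqr, hc; ring.
Qed.

Lemma sin_q_pos p : 0 < p -> 0 < sin (q p) /\ sin (q p) <= cos (q p) /\ sin (q p) <= 1 /\ 0 < sinh p < cosh p /\ cosh p - sinh p <= 1.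
Proof.
intros hp; assert (hpi := PI_RGT_0); assert (hq := q_bounds p (Rlt_le _ _ hp)).
assert (hq0 : 0 < q p).
{ unfold q; assert (0 < atan (tanh2 p)); [|lra].
  rewrite <- atan_0; apply atan_increasing; unfold tanh2.
  assert (h := exp_increasing 0 (4 * p) ltac:(lra)); rewrite exp_0 in h; apply Rdiv_lt_0_compat; lra. }
split; [apply sin_gt_0; lra|split; [apply sin_le_cos, hq|split; [apply SIN_bound|]]].
unfold sinh, cosh; assert (h1 := exp_pos (- p)).
assert (h2 : exp (- p) < exp p) by (apply exp_increasing; lra).
assert (h3 := exp_increasing (- p) 0 ltac:(lra)); rewrite exp_0 in h3; lra.
Qed.

Lemma G_low_curve p : 0 < p -> 0 < Re (G_low p) /\ Im (G_low p) = height_low_odd (Re (G_low p)).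
Proof.
intros hp; assert (hk := kappa_gt0 alpha beta alpha_gt0 beta_gt0).
destruct (sin_q_pos p hp) as [h1 [h2 [h3 [h4 h5]]]].
assert (h0 : Re (omega (G_low p)) = 0).
{ unfold G_low; rewrite omega_lam by assumption; apply Re_om_curve; assumption. }
assert (hle := cosh_sin_le_sinh_cos p (Rlt_le _ _ hp)).
rewrite G_low_pair in *; unfold Re, Im; cbn [fst snd].
assert (hs : 0 < kappa * (sinh p * cos (q p))) by (apply Rmult_lt_0_compat; [|apply Rmult_lt_0_compat]; lra).
assert (hy : 0 <= kappa * (cosh p * sin (q p))) by (apply Rmult_le_pos; [|apply Rmult_le_pos]; lra).
split; [exact hs|].
rewrite <- (proj1 (height_low_even _ hs)).
apply (proj1 (height_cases _ _ hs hy h0)), Rmult_le_compat_l; lra.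
Qed.

Lemma G_up_curve p : 0 < p -> 0 < Re (G_up p) /\ Im (G_up p) = height_up alpha beta (Re (G_up p)).
Proof.
intros hp; assert (hk := kappa_gt0 alpha beta alpha_gt0 beta_gt0).
destruct (sin_q_pos p hp) as [h1 [h2 [h3 [h4 h5]]]].
assert (h0 : Re (omega (G_up p)) = 0).
{ rewrite omega_G_up; apply (Re_om_curve alpha beta alpha_gt0 beta_gt0 p). }
rewrite G_up_pair in *; unfold Re, Im; cbn [fst snd].
assert (hs : 0 < kappa * (sinh p * sin (q p))) by (apply Rmult_lt_0_compat; [|apply Rmult_lt_0_compat]; lra).
assert (hy : 0 <= kappa * (cosh p * cos (q p))) by (apply Rmult_le_pos; [|apply Rmult_le_pos]; lra).
split; [exact hs|].
apply (proj2 (height_cases _ _ hs hy h0)), Rmult_le_compat_l; [lra|].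
apply Rmult_le_compat; lra.
Qed.

Lemma G_low_inf S : exists N, forall P, N <= P -> S <= Re (G_low P).
Proof.
assert (hk := kappa_gt0 alpha beta alpha_gt0 beta_gt0).
destruct (exp_unbounded kappa (/ 4) S hk) as [N [hN h]]; exists N; intros P hP.
apply Rle_trans with (1 := h P hP); rewrite G_low_pair; unfold Re; simpl.
apply Rmult_le_compat_l; [lra|].
apply Rle_trans with (2 := cosh_sin_le_sinh_cos P ltac:(lra)).
apply cosh_sin_q_ge; lra.
Qed.

Lemma G_up_inf S : exists N, forall P, N <= P -> S <= Re (G_up P).
Proof.
assert (hk := kappa_gt0 alpha beta alpha_gt0 beta_gt0).
destruct (exp_unbounded kappa (/ 4 + 1) S hk) as [N [hN h]]; exists (N + 1); intros P hP.
apply Rle_trans with (1 := h P ltac:(lra)); rewrite G_up_pair; unfold Re; simpl.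
apply Rmult_le_compat_l; [lra|].
destruct (sin_q_pos P ltac:(lra)) as [h1 [h2 [h3 [h4 h5]]]].
assert (k := cosh_sin_q_ge P ltac:(lra)).
assert ((cosh P - sinh P) * sin (q P) <= 1 * 1) by (apply Rmult_le_compat; lra).
lra.
Qed.

Notation zero := (fun _ : C => RtoC 0).

Lemma ff_low x t p : 0 < p ->
  (ff x t (G_low p) * dG_low p = - (phi t (om (u p)) * (T A zero x 0 (u p) * vel p)))%C.
Proof.
intros hp; assert (hk := kappa_gt0 alpha beta alpha_gt0 beta_gt0).
destruct (sin_q_pos p hp) as [h1 [h2 [h3 [h4 h5]]]].
assert (hr : root alpha beta (G_low p) = mu (u p)).
{ unfold root, G_low; rewrite <- mu_sqr by assumption; apply Sq_sqr; rewrite mu_pair;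
    unfold Re, Im; cbn [fst snd]; (apply Rmult_le_pos; [|apply Rmult_le_pos]; lra). }
unfold quotient, weight; rewrite hr; unfold G_low, dG_low, wave, amp_low.
rewrite omega_lam by assumption.
replace (X1 (u p) * x - om (u p) * 0)%C with (Ci * lam (u p) * x)%C by (unfold rate_low; ring).
ring.
Qed.

Lemma ff_up x t p : 0 < p ->
  (ff x t (G_up p) * dG_up p = - Cconj (phi t (om (u p)) * (T zero B x 0 (u p) * vel p)))%C.
Proof.
intros hp; assert (hk := kappa_gt0 alpha beta alpha_gt0 beta_gt0).
destruct (sin_q_pos p hp) as [h1 [h2 [h3 [h4 h5]]]].
assert (hr : root alpha beta (G_up p) = (Ci * Cconj (lam (u p)))%C).
{ unfold root.
  replace (G_up p * G_up p + RtoC (alpha / beta))%C with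
    (Ci * Cconj (lam (u p)) * (Ci * Cconj (lam (u p))))%C.
  - apply Sq_sqr.
    + replace (Re (Ci * Cconj (lam (u p)))) with (Im (lam (u p))) by (unfold Re, Im; simpl; ring).
      rewrite lam_pair; unfold Im; cbn [fst snd]; apply Rmult_le_pos; [|apply Rmult_le_pos]; lra.
    + replace (Im (Ci * Cconj (lam (u p)))) with (Re (lam (u p))) by (unfold Re, Im; simpl; ring).
      rewrite lam_pair; unfold Re; cbn [fst snd]; apply Rmult_le_pos; [|apply Rmult_le_pos]; lra.
  - assert (h := mu_sqr alpha beta alpha_gt0 beta_gt0 (u p)).
    apply (f_equal Cconj) in h; rewrite Cconj_plus, Cconj_RtoC, !Cconj_mult in h.
    unfold G_up.
    replace (Ci * Cconj (mu (u p)) * (Ci * Cconj (mu (u p))))%C with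
      ((Ci * Ci) * (Cconj (mu (u p)) * Cconj (mu (u p))))%C by ring.
    rewrite h; replace (Ci * Cconj (lam (u p)) * (Ci * Cconj (lam (u p))))%C with
      ((Ci * Ci) * (Cconj (lam (u p)) * Cconj (lam (u p))))%C by ring.
    rewrite Ci_sqr; ring. }
unfold quotient, weight; rewrite hr, omega_G_up; unfold G_up, dG_up, wave.
replace (X2 (u p) * x - om (u p) * 0)%C with (- mu (u p) * x)%C by (unfold rate_up; ring).
rewrite Cmult_0_r, Cplus_0_l, phi_conj, !Cconj_mult, <- Cexp_conj.
replace (Ci * (Ci * Cconj (mu (u p))) * x)%C with (Cconj (- mu (u p) * x)).
2:{ rewrite Cconj_mult, Cconj_opp, Cconj_RtoC.
    replace (Ci * (Ci * Cconj (mu (u p))))%C with ((Ci * Ci) * Cconj (mu (u p)))%C by ring.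
    rewrite Ci_sqr; ring. }
replace (Cconj (B (u p))) with
  (- Ci * (Cconj (lam (u p)) * Cconj (lam (u p))) * Cconj (mu (u p)) *
    (- Ci * Cconj (lam (u p)) - Cconj (mu (u p))))%C.
2:{ unfold amp_up, Cminus; rewrite !Cconj_mult, Cconj_plus, Cconj_opp, Cconj_mult, Cconj_Ci; reflexivity. }
apply reflected_product.
Qed.

(** * The contour integrals *)

Lemma tame_zero : tame zero.
Proof. apply tame_const. Qed.

Lemma Re_om_u p : Re (om (u p)) = 0.
Proof. apply Re_om_curve; assumption. Qed.

Lemma low_bound x t : 0 < x -> exists M, forall p, 0 < p ->
  Rabs (Re (ff x t (G_low p) * dG_low p)) <= M * exp (- p) /\
  Rabs (Im (ff x t (G_low p) * dG_low p)) <= M * exp (- p).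
Proof.
intros hx; destruct (curve_decays alpha beta alpha_gt0 beta_gt0 A zero x 0
  (tame_A alpha beta alpha_gt0 beta_gt0) tame_zero hx (Rle_refl 0)) as [M [_ h]].
exists (Rabs t * M); intros p hp; rewrite ff_low by exact hp; specialize (h p hp).
destruct (phi_bound t (om (u p)) (T A zero x 0 (u p) * vel p) (Re_om_u p)) as [k1 k2].
assert (Rabs t * Cmod (T A zero x 0 (u p) * vel p) <= Rabs t * (M * exp (- p)))
  by (apply Rmult_le_compat_l; [apply Rabs_pos|exact h]).
change (Rabs (- Re (phi t (om (u p)) * (T A zero x 0 (u p) * vel p))) <= Rabs t * M * exp (- p) /\
  Rabs (- Im (phi t (om (u p)) * (T A zero x 0 (u p) * vel p))) <= Rabs t * M * exp (- p)).
rewrite !Rabs_Ropp; lra.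
Qed.

Lemma up_bound x t : 0 < x -> exists M, forall p, 0 < p ->
  Rabs (Re (ff x t (G_up p) * dG_up p)) <= M * exp (- p) /\
  Rabs (Im (ff x t (G_up p) * dG_up p)) <= M * exp (- p).
Proof.
intros hx; destruct (curve_decays alpha beta alpha_gt0 beta_gt0 zero B x 0
  tame_zero (tame_B alpha beta alpha_gt0 beta_gt0) hx (Rle_refl 0)) as [M [_ h]].
exists (Rabs t * M); intros p hp; rewrite ff_up by exact hp; specialize (h p hp).
destruct (phi_bound t (om (u p)) (T zero B x 0 (u p) * vel p) (Re_om_u p)) as [k1 k2].
assert (Rabs t * Cmod (T zero B x 0 (u p) * vel p) <= Rabs t * (M * exp (- p)))
  by (apply Rmult_le_compat_l; [apply Rabs_pos|exact h]).
change (Rabs (- Re (phi t (om (u p)) * (T zero B x 0 (u p) * vel p))) <= Rabs t * M * exp (- p) /\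
  Rabs (- - Im (phi t (om (u p)) * (T zero B x 0 (u p) * vel p))) <= Rabs t * M * exp (- p)).
rewrite !Rabs_Ropp; lra.
Qed.

(** The two right halves of the contour, as one integrand in [p]. *)
Lemma U_formula x : 0 < x -> exists K : R -> R -> R,
  (forall t, exists M, decays (K t) M) /\
  (forall t p, 0 < p -> K t p = - Im (phi t (om (u p)) * (T A B x 0 (u p) * vel p))) /\
  (forall t, ex_integral_dOmega alpha beta (integrand alpha beta x t)) /\
  (forall t, U alpha beta x t = RtoC (- (2 * beta / PI) * HInt (K t))).
Proof.
intros hx.
destruct C1_height_low_odd as [hl [hl1 hl2]]; destruct C1_height_up as [hu [hu1 hu2]].
set (KL := fun t p => Re (dG_low p) * Im (pulled alpha beta x t height_low_odd hl (Re (G_low p)))).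
set (KU := fun t p => Re (dG_up p) * Im (pulled alpha beta x t (height_up alpha beta) hu (Re (G_up p)))).
assert (z1 : Re (G_low 0) = 0) by (rewrite G_low_pair, sinh_0; unfold Re; simpl; ring).
assert (z2 : Re (G_up 0) = 0) by (rewrite G_up_pair, sinh_0; unfold Re; simpl; ring).
assert (dL : forall t, exists M, decays (KL t) M).
{ intros t; destruct (low_bound x t hx) as [M hM]; exists M.
  apply (half_decays alpha beta beta_gt0 x t height_low_odd hl hl1 hl2 low_boundary
    G_low dG_low M G_low_pder dG_low_ccont G_low_curve hM). }
assert (dU : forall t, exists M, decays (KU t) M).
{ intros t; destruct (up_bound x t hx) as [M hM]; exists M.
  apply (half_decays alpha beta beta_gt0 x t (height_up alpha beta) hu hu1 hu2 up_boundary
    G_up dG_up M G_up_pder dG_up_ccont G_up_curve hM). }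
assert (cL : forall t, @is_RInt_gen C_R_NormedModule
  (pullback (integrand alpha beta x t) (curve_low alpha beta))
  (Rbar_locally m_infty) (Rbar_locally p_infty) ((0, 2 * HInt (KL t)) : C)).
{ intros t; destruct (low_bound x t hx) as [M hM].
  exact (contour_low_gen alpha beta beta_gt0 x t height_low_odd hl hl1 hl2 low_boundary low_pos
    G_low dG_low M G_low_pder dG_low_ccont z1 G_low_curve G_low_inf hM _ height_low_even). }
assert (cU : forall t, @is_RInt_gen C_R_NormedModule
  (pullback (integrand alpha beta x t) (curve_up alpha beta))
  (Rbar_locally m_infty) (Rbar_locally p_infty) ((0, 2 * - HInt (KU t)) : C)).
{ intros t; destruct (up_bound x t hx) as [M hM].
  exact (contour_up_gen alpha beta beta_gt0 x t (height_up alpha beta) hu hu1 hu2 up_boundary up_pos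
    G_up dG_up M G_up_pder dG_up_ccont z2 G_up_curve G_up_inf hM _ height_up_even). }
exists (fun t p => 1 * KL t p + -1 * KU t p); split; [|split; [|split]].
- intros t; destruct (dL t) as [M1 h1]; destruct (dU t) as [M2 h2].
  eexists; exact (decays_lin _ _ _ _ 1 (-1) h1 h2).
- intros t p hp; unfold KL, KU.
  rewrite <- (Im_scal (Re (dG_low p))), <- (Im_scal (Re (dG_up p))).
  rewrite <- (pulled_G alpha beta x t height_low_odd hl hl1 G_low dG_low G_low_pder G_low_curve p hp).
  rewrite <- (pulled_G alpha beta x t (height_up alpha beta) hu hu1 G_up dG_up G_up_pder G_up_curve p hp).
  rewrite ff_low, ff_up by exact hp.
  assert (e : T A B x 0 (u p) = (T A zero x 0 (u p) + T zero B x 0 (u p))%C)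
    by (unfold wave; ring).
  rewrite e, Cmult_plus_distr_r, Cmult_plus_distr_l, Im_plus.
  generalize (phi t (om (u p)) * (T A zero x 0 (u p) * vel p))%C (phi t (om (u p)) * (T zero B x 0 (u p) * vel p))%C.
  intros z w; unfold Im; simpl; ring.
- intros t; split; eexists; [apply cL|apply cU].
- intros t; destruct (dL t) as [M1 h1]; destruct (dU t) as [M2 h2].
  rewrite (HInt_lin _ _ _ _ 1 (-1) h1 h2).
  unfold U, integral_dOmega, contour_integral.
  rewrite (is_RInt_gen_unique (V := C_R_CompleteNormedModule) _ _ (cL t)).
  rewrite (is_RInt_gen_unique (V := C_R_CompleteNormedModule) _ _ (cU t)).
  assert (hpi := PI_neq0).
  replace (beta * Ci / PI)%C with (RtoC (beta / PI) * Ci)%C.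
  + apply Ceq; unfold Re, Im; simpl; field; exact hpi.
  + unfold Cdiv; rewrite <- RtoC_inv by exact hpi.
    unfold Rdiv; rewrite <- Cmult_RtoC; ring.
Qed.

Lemma om_nonzero p : 0 < p -> om (u p) <> 0%C.
Proof.
intros hp; assert (hk := kappa_gt0 alpha beta alpha_gt0 beta_gt0).
destruct (sin_q_pos p hp) as [h1 [h2 [h3 [h4 h5]]]].
assert (hl : lam (u p) <> 0%C).
{ intros e; apply (f_equal Re) in e; rewrite lam_pair in e; unfold Re in e; cbn [fst snd RtoC] in e.
  assert (0 < kappa * (sinh p * cos (q p))) by (apply Rmult_lt_0_compat; [|apply Rmult_lt_0_compat]; lra).
  lra. }
assert (hm : mu (u p) <> 0%C).
{ intros e; apply (f_equal Re) in e; rewrite mu_pair in e; unfold Re in e; cbn [fst snd RtoC] in e.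
  assert (0 < kappa * (cosh p * cos (q p))) by (apply Rmult_lt_0_compat; [|apply Rmult_lt_0_compat]; lra).
  lra. }
unfold omega_u; apply Cmult_neq_0; [|apply Cmult_neq_0; exact hm].
apply Cmult_neq_0; [|apply Cmult_neq_0; exact hl].
intros e; apply (f_equal Re) in e; unfold Re in e; simpl in e; lra.
Qed.

Lemma T_time x t w : T A B x t w = (Cexp (- (om w * t)) * T A B x 0 w)%C.
Proof.
unfold wave, Cminus; rewrite !Cexp_plus.
replace (- (om w * 0))%C with (RtoC 0) by ring; rewrite Cexp_0; ring.
Qed.

(** The time derivative of [phi t o] is [- exp (- o t)], which turns the wave at time [0]
    into the wave at time [t]; the curve is then moved to the line by [Wc_curve]. *)
Lemma U_derive_aux x t : 0 < x -> 0 < t ->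
  (forall s, ex_integral_dOmega alpha beta (integrand alpha beta x s)) /\
  exists D : R -> R, (forall s, U alpha beta x s = RtoC (D s)) /\
  exists M, forall s, Rabs (D s - D t - (s - t) * (- (2 * beta / PI) * Wc alpha beta A B x t)) <= M * (s - t) ^ 2.
Proof.
intros hx ht; destruct (U_formula x hx) as [K [hK1 [hK2 [hK3 hK4]]]]; split; [exact hK3|].
exists (fun s => - (2 * beta / PI) * HInt (K s)); split; [exact hK4|].
assert (tA := tame_A alpha beta alpha_gt0 beta_gt0); assert (tB := tame_B alpha beta alpha_gt0 beta_gt0).
assert (to := tame_om alpha beta alpha_gt0 beta_gt0).
destruct (curve_decays alpha beta alpha_gt0 beta_gt0 (fun w => om w * A w)%C (fun w => om w * B w)%C x 0
  (tame_mult _ _ to tA) (tame_mult _ _ to tB) hx (Rle_refl 0)) as [M [_ hM]].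
destruct (curve_decays alpha beta alpha_gt0 beta_gt0 A B x t tA tB hx (Rlt_le _ _ ht)) as [Mt [dt _]].
exists (Rabs (- (2 * beta / PI)) * M); intros s; apply scaled_quad.
rewrite <- (Wc_curve alpha beta alpha_gt0 beta_gt0 A B x t tA tB
  (imaginary0_A alpha beta) (imaginary0_B alpha beta) hx ht).
destruct (hK1 s) as [Ms ds]; destruct (hK1 t) as [M0 d0].
apply (HInt_diff_le _ _ _ _ _ _ _ _ ds d0 dt); intros p hp.
rewrite !hK2 by exact hp; rewrite (T_time x t).
set (o := om (u p)); set (Z := (T A B x 0 (u p) * vel p)%C).
assert (ho : o <> 0%C) by exact (om_nonzero p hp).
assert (hre : Re o = 0) by exact (Re_om_u p).
assert (hZ : Cmod (o * Z) <= M * exp (- p)).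
{ specialize (hM p hp).
  replace (o * Z)%C with (T (fun w => om w * A w)%C (fun w => om w * B w)%C x 0 (u p) * vel p)%C; [exact hM|].
  unfold o, Z, wave; ring. }
replace (Im (Cexp (- (o * t)) * T A B x 0 (u p) * vel p)) with (- Im (- Cexp (- (o * t)) * Z)).
2:{ unfold Z; generalize (Cexp (- (o * t))) (T A B x 0 (u p)); intros a b; unfold Im; simpl; ring. }
replace (M * (s - t) ^ 2 * exp (- p)) with (M * exp (- p) * (s - t) ^ 2) by ring.
apply (taylor2_bound (fun r => - Im (phi r o * Z)) (fun r => - Im (- Cexp (- (o * r)) * Z))
  (fun r => - Im (Cexp (- (o * r)) * (o * Z)))).
- intros r; exact (is_derive_opp (V := R_NormedModule) _ _ _ (proj2 (phi_pder o Z r ho))).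
- intros r; apply (is_derive_opp (V := R_NormedModule)).
  assert (h := proj2 (pder_Cexp_affine (- o) 0 (- Z) r)).
  replace (Im (Cexp (- (o * r)) * (o * Z))) with (Im (Cexp (- o * r + 0) * (- o * - Z))).
  + refine (is_derive_ext _ _ _ _ _ h); intros y.
    replace (- o * y + 0)%C with (- (o * y))%C by ring; f_equal; ring.
  + replace (- o * r + 0)%C with (- (o * r))%C by ring; f_equal; ring.
- intros r _; rewrite Rabs_Ropp; apply Rle_trans with (1 := Im_le_Cmod _).
  rewrite Cmod_mult, Cmod_oscillation, Rmult_1_l by exact hre; exact hZ.
Qed.

Definition scale : R := - (2 * beta / PI).

Lemma v_eq x t : 0 < x -> 0 < t ->
  v alpha beta x t = Vc alpha beta scale x t /\
  @is_derive R_AbsRing C_R_NormedModule (fun tau => U alpha beta x tau) t (v alpha beta x t).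
Proof.
intros hx ht; destruct (U_derive_aux x t hx ht) as [_ [D [hD [M hM]]]].
assert (hd := quad_derive D t _ M 1 Rlt_0_1 (fun y _ => hM y)).
assert (hd' := quad_derive_RtoC D t _ M 1 Rlt_0_1 (fun y _ => hM y)).
assert (e : v alpha beta x t = Vc alpha beta scale x t).
{ change (((Derive (fun tau => Re (U alpha beta x tau)) t,
    Derive (fun tau => Im (U alpha beta x tau)) t) : C) = (scale * Wc alpha beta A B x t, 0)).
  apply injective_projections; cbn [fst snd].
  - transitivity (Derive D t); [|apply is_derive_unique, hd].
    apply Derive_ext; intros s; rewrite hD; reflexivity.
  - transitivity (Derive (fun _ => 0) t); [|apply Derive_const].
    apply Derive_ext; intros s; rewrite hD; reflexivity. }
split; [exact e|rewrite e].
refine (is_derive_ext (V := C_R_NormedModule) _ _ _ _ (fun s => eq_sym (hD s)) hd').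
Qed.

Lemma scale_neg : scale < 0.
Proof.
unfold scale; assert (h := PI_RGT_0); assert (0 < 2 * beta / PI) by (apply Rdiv_lt_0_compat; lra); lra.
Qed.
End Assembly.

Theorem mainTheorem8 (alpha beta : R) (halpha : 0 < alpha) (hbeta : 0 < beta) :
  (forall x t, 0 < x -> 0 < t ->
     ex_integral_dOmega alpha beta (integrand alpha beta x t) /\
     @is_derive R_AbsRing C_R_NormedModule
       (fun tau => U alpha beta x tau) t (v alpha beta x t)) /\
  (exists w : R -> R -> C,
     (forall x t, 0 < x -> 0 < t -> w x t = v alpha beta x t) /\
     is_solution alpha beta w) /\
  (exists x t, 0 < x /\ 0 < t /\ v alpha beta x t <> 0%C) /\
  ~ (forall V1 V2 : R -> R -> C,
       is_solution alpha beta V1 -> is_solution alpha beta V2 ->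
       forall x t, Qbar0 x t -> V1 x t = V2 x t) /\
  (exists V : nat -> R -> R -> C,
     (forall n, is_solution alpha beta (V n)) /\
     (forall m n, m <> n -> exists x t, Qbar0 x t /\ V m x t <> V n x t)).
Proof.
destruct (Wc_nonzero alpha beta halpha hbeta) as [x0 [t0 [hx0 [ht0 hW]]]].
assert (hQ : Qbar0 x0 t0) by (split; [lra|split; [lra|intros [h _]; lra]]).
assert (hsep : forall s s', s <> s' -> Vc alpha beta s x0 t0 <> Vc alpha beta s' x0 t0).
{ intros s s' hs e; apply (f_equal Re) in e; apply Rmult_eq_reg_r in e; auto. }
split; [|split; [|split; [|split]]].
- intros x t hx ht; split; [apply (U_derive_aux alpha beta halpha hbeta x t hx ht)|].
  apply (v_eq alpha beta halpha hbeta x t hx ht).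
- exists (Vc alpha beta (scale beta)); split; [|apply Vc_is_solution; assumption].
  intros x t hx ht; symmetry; apply v_eq; assumption.
- exists x0, t0; split; [exact hx0|split; [exact ht0|]].
  rewrite (proj1 (v_eq alpha beta halpha hbeta x0 t0 hx0 ht0)).
  intros e; apply (f_equal Re) in e; apply Rmult_integral in e.
  assert (h := scale_neg beta hbeta); destruct e; [lra|auto].
- intros huniq; apply (hsep 1 0 R1_neq_R0).
  apply huniq; try apply Vc_is_solution; assumption.
- exists (fun n => Vc alpha beta (INR n)); split.
  + intros n; apply Vc_is_solution; assumption.
  + intros m n hmn; exists x0, t0; split; [exact hQ|].
    apply hsep; intros e; apply hmn, INR_eq, e.
Qed.
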